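(* Let $(Z,d,\nu)$ be a complete doubling metric measure space with uniformized hyperbolic filling $X_\rho$ (parameters $\alpha,\tau$). Let $p\ge1$, $0<\beta<p$, $\theta=1-\beta/p$, and equip $\bar X_\rho$ with $\mu_\beta$. Suppose that a measurable function $f:Z\to[-\infty,\infty]$ admits a $p$-integrable hyperbolic upper gradient $g$ on $\bar X_\rho$. Then $f\in\tilde B^\theta_p(Z)$ with $$\|f\|_{B^\theta_p(Z)}\le C\|g\|_{L^p(X_\rho)},$$ where $C$ depends only on $\alpha,\tau,C_\nu,\beta,p$.
   Context: **Metric measure spaces.** A metric measure space is a metric space with a Borel regular measure giving every ball positive finite measure. $(Z,d,\nu)$ is doubling: $\nu(B_Z(z,2r))\le C_\nu\,\nu(B_Z(z,r))$ for all $z,r$. **Hyperbolic filling.** Fix $\alpha>1$ and $\tau>\max\{3,\alpha/(\alpha-1)\}$. For each $n\in\mathbb Z$ choose a maximal $\alpha^{-n}$-separated set $S_n\subset Z$ (distinct points at distance $\ge\alpha^{-n}$). Put $V_n=\{(z,n):z\in S_n\}$, $V=\bigcup_n V_n$, $\pi(z,n)=z$, $h(z,n)=n$, and $B(v)=B_Z(\pi(v),\tau\alpha^{-h(v)})$. Distinct vertices $v,w$ are joined by an edge ($v\sim w$) iff $|h(v)-h(w)|\le 1$ and $B(v)\cap B(w)\ne\emptyset$. $X$ is the resulting (connected) metric graph with unit-length edges; $h$ is extended linearly to edges. **Uniformization.** $\rho(x)=\alpha^{-h(x)}$, $d_\rho(x,y)=\inf_\gamma\int_\gamma\rho\,ds$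 over curves in $X$ from $x$ to $y$; $X_\rho=(X,d_\rho)$, $\bar X_\rho$ its completion, $\partial X_\rho=\bar X_\rho\setminus X_\rho$. There is a canonical biLipschitz identification (constant depending on $\alpha,\tau$) of $Z$ with $\partial X_\rho$: $z\in Z$ corresponds to $\lim_{n\to\infty}v_n$ in $\bar X_\rho$ for any $v_n\in V_n$ with $d(\pi(v_n),z)<\alpha^{-n}$. After this construction the metric of $Z$ is replaced by the biLipschitz equivalent metric induced by $d_\rho$, so that $Z=\partial X_\rho$ isometrically ($S_n$ and $B(v)$ are those coming from the original metric). **Measures.** Let $\mathcal L$ be Lebesgue measure on the unit edges of $X$, $\mu(A)=\sum_{v\in V}\sum_{w\sim v}(\nu(B(v))+\nu(B(w)))\,\mathcal L(A\cap vw)$ where $vw$ is the edge from $v$ to $w$, and $d\mu_\beta=\alpha^{-\beta h}\,d\mu$ on $X_\rho$, extended by $\mu_\beta(\partial X_\rho)=0$. **Hyperbolic upper gradient.** A Borel function $g:\bar X_\rho\to[0,\infty]$ is a hyperbolic upper gradient for a measurable $f:Z\to[-\infty,\infty]$ if there is a subset $G\subset Z$ of full $\nu$-measure such that $|f(x)-f(y)|\le\int_\gamma g\,ds$ for all $x,y\in G$ and every (nonconstant, compact, rectifiable) curve $\gamma$ in $\bar X_\rho$ joining $x$ to $y$ (arclength with respect to $d_\rho$; by convention $\int_\gamma g\,ds=\infty$ is required if $f(x)$ or $f(y)$ is infinite). **Besov space.** $\|u\|_{B^\theta_p(Z)}^p=\int_Z\int_Z\frac{|u(x)-u(y)|^p}{d(x,y)^{p\theta}}\frac{d\nu(x)\,d\nu(y)}{\nu(B(x,d(x,y)))}$;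 $\tilde B^\theta_p(Z)$ is the set of $u$ that are $p$-integrable on every ball with $\|u\|_{B^\theta_p(Z)}<\infty$. *)

(* Defs.v *)
From HB Require Import structures.
From mathcomp Require Import all_boot all_order all_algebra.
From mathcomp Require Import all_classical all_reals all_analysis.
From mathcomp Require Import measurable_realfun.
Set Implicit Arguments.
Unset Strict Implicit.
Unset Printing Implicit Defensive.
Import Order.TTheory GRing.Theory Num.Theory.
Import numFieldNormedType.Exports.
Local Open Scope classical_set_scope.
Local Open Scope ring_scope.

#[short(type="completeMetricType")]
HB.structure Definition CompleteMetric (R : numDomainType) :=
  {T of Metric R T & Complete T}.

Section Curves.
Context {R : realType} {T : Type} (d : T -> T -> R).

Definition polygon_length (gamma : R -> T) (a : R) (s : seq R) : R :=
  \sum_(i < size s) d (gamma (nth a (a :: s) i)) (gamma (nth a s i)).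

Definition curve_length (gamma : R -> T) (a b : R) : \bar R :=
  ereal_sup [set (polygon_length gamma a s)%:E | s in itv_partition a b].

Definition rectifiable_curve (gamma : R -> T) (a b : R) : Prop :=
  [/\ a <= b,
      forall t, t \in `[a, b] -> forall e, 0 < e -> exists2 del, 0 < del &
        forall s, s \in `[a, b] -> `|s - t| < del ->
          d (gamma t) (gamma s) < e
    & (curve_length gamma a b < +oo)%E].

(* The arclength parametrization is the map [s |-> gamma t] for any [t] such
   that the length of [gamma] on [[a, t]] is [s]: [gamma] is constant on the
   set of these [t]. *)
Definition arclength_param (gamma : R -> T) (a b s : R) : T :=
  gamma (xget a [set t | t \in `[a, b] /\ curve_length gamma a t = s%:E]).

Definition curve_integral (g : T -> \bar R) (gamma : R -> T) (a b : R)
    : \bar R :=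
  (\int[lebesgue_measure]_(s in `[0%R, fine (curve_length gamma a b)])
     g (arclength_param gamma a b s))%E.

End Curves.

Section HyperbolicFilling.
Context {R : realType}.

Definition separated (Z : completeMetricType R) (r : R) (A : set Z) : Prop :=
  forall x y, A x -> A y -> x <> y -> r <= mdist x y.

Definition maximal_separated (Z : completeMetricType R) (r : R) (A : set Z) :=
  separated r A /\ forall B, A `<=` B -> separated r B -> B = A.

(* [tau] only enters through the balls attached to the vertices. *)
Record filling (alpha tau : R) (Z : completeMetricType R) := Filling {
  net : int -> set Z ;
  net_maximal : forall n, maximal_separated (alpha ^ (- n)) (net n) }.

Context {alpha tau : R} {Z : completeMetricType R} (S : filling alpha tau Z).

Implicit Types v w : Z * int.

Definition is_vertex v : Prop := net S v.2 v.1.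

Definition vertex_ball v : set Z :=
  ball v.1 (tau * alpha ^ (- v.2)).

Definition adjacent v w : Prop :=
  [/\ is_vertex v, is_vertex w, v <> w, `|v.2 - w.2| <= 1
    & vertex_ball v `&` vertex_ball w !=set0].

(* Points of the graph are given by their barycentric coordinates with respect
   to the vertices. *)
Definition bary v w (t : R) : Z * int -> R :=
  fun u => (1 - t) * (u == v)%:R + t * (u == w)%:R.

Definition is_point (x : Z * int -> R) : Prop :=
  (exists2 v, is_vertex v & x = bary v v 0) \/
  exists v w t, [/\ adjacent v w, t \in `[0, 1] & x = bary v w t].

Record graph := Point { coord : Z * int -> R ; coordP : is_point coord }.

Lemma net_neq0 n : net S n !=set0.
Proof.
apply/set0P/eqP => S0; have [_ /(_ [set point])] := net_maximal S n.
rewrite S0 => h; have : [set (point : Z)] = set0.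
  by apply: h => // x y -> ->.
by move/seteqP => [+ _] => /(_ point erefl).
Qed.

Lemma is_point0 : is_point (bary (xget point (net S 0), 0%Z)
                              (xget point (net S 0), 0%Z) 0).
Proof.
left; exists (xget point (net S 0), 0%Z) => //; rewrite /is_vertex/=.
by have [z Sz] := net_neq0 0; apply: xgetPex; exists z.
Qed.

HB.instance Definition _ := gen_eqMixin graph.
HB.instance Definition _ := gen_choiceMixin graph.
HB.instance Definition _ := isPointed.Build graph (Point is_point0).

(* [edge v w t] is the point at distance [t] from [v] on the edge [vw]; it is
   meaningful for adjacent [v] and [w] and [t] in [0, 1]. *)
Definition edge v w (t : R) : graph :=
  xget point [set x : graph | coord x = bary v w t].

Definition vertex v : graph := edge v v 0.

Inductive chain : graph -> graph -> R -> Prop :=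
| chain_nil x : chain x x 0
| chain_cons v w s t y l : adjacent v w -> s \in `[0, 1] -> t \in `[0, 1] ->
    chain (edge v w t) y l -> chain (edge v w s) y (`|s - t| + l).

Definition graph_dist (x y : graph) : R := inf [set l | chain x y l].

(* The linear extension of the height function of the vertices. *)
Definition height (x : graph) : R :=
  \sum_(v \in [set: Z * int]) coord x v * (v.2)%:~R.

Definition rho (x : graph) : R := alpha `^ (- height x).

Definition dist_rho (x y : graph) : R :=
  fine (ereal_inf [set r | exists gamma a b,
    [/\ rectifiable_curve graph_dist gamma a b, gamma a = x, gamma b = y
      & r = curve_integral graph_dist (EFin \o rho) gamma a b]]).

Record completion := Completion {
  completion_space :> completeMetricType R ;
  emb : graph -> completion_space ;
  emb_isometry : forall x y, mdist (emb x) (emb y) = dist_rho x y ;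
  emb_dense : dense (range emb) }.

(* A set is measurable when its trace on every edge is a Borel set. *)
Definition graph_measurable (A : set graph) : Prop :=
  forall v w, adjacent v w -> measurable (`[0, 1] `&` edge v w @^-1` A).

Lemma graph_measurable0 : graph_measurable set0.
Proof. by move=> v w _; rewrite preimage_set0 setI0. Qed.

Lemma graph_measurableC A : graph_measurable A -> graph_measurable (~` A).
Proof.
move=> mA v w vw; rewrite preimage_setC.
rewrite (_ : _ `&` _ = `[0, 1] `\` (`[0, 1] `&` edge v w @^-1` A)).
  by apply: measurableD => //; exact: mA.
by rewrite setDIr setDv set0U setDE.
Qed.

Lemma graph_measurable_bigcup (F : (set graph)^nat) :
  (forall i, graph_measurable (F i)) -> graph_measurable (\bigcup_i F i).
Proof.
move=> mF v w vw; rewrite preimage_bigcup setI_bigcupr.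
by apply: bigcupT_measurable => i; exact: mF.
Qed.

HB.instance Definition _ := @isMeasurable.Build default_measure_display graph
  graph_measurable graph_measurable0 graph_measurableC graph_measurable_bigcup.

Lemma edgeE v w t : adjacent v w -> t \in `[0, 1] ->
  coord (edge v w t) = bary v w t.
Proof.
move=> vw t01; have xP : is_point (bary v w t) by right; exists v, w, t.
have : exists x : graph, coord x = bary v w t by exists (Point xP).
exact: xgetPex.
Qed.

Lemma heightE v w t : adjacent v w -> t \in `[0, 1] ->
  height (edge v w t) = (1 - t) * v.2%:~R + t * w.2%:~R.
Proof.
move=> vw t01; rewrite /height edgeE//.
rewrite (eq_fsbigr (fun u : Z * int => (1 - t) * v.2%:~R * (u == v)%:R +
    t * w.2%:~R * (u == w)%:R)); last first.
  move=> u _; rewrite /bary mulrDl; congr (_ + _).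
    by case: eqP => [->|_]; rewrite ?mulr0 ?mul0r// !mulr1.
  by case: eqP => [->|_]; rewrite ?mulr0 ?mul0r// !mulr1.
have E x (c : R) : x \in [set v; w] ->
    \sum_(u \in [set v; w]) c * (u == x)%:R = c.
  rewrite inE => xvw; rewrite -(fsbig_widen [set x])/=.
  - by rewrite fsbig_set1 eqxx mulr1.
  - by move=> u ->.
  - by move=> u [_ /eqP/negbTE /= ->]; rewrite mulr0.
rewrite -(fsbig_widen [set v; w])//=; last first.
  by move=> u [_ /not_orP[/eqP/negbTE uv /eqP/negbTE uw]] /=; 
    rewrite uv uw !mulr0 addr0.
rewrite fsbig_split//= !E ?inE//; [by right|by left].
Qed.


Lemma graph_measurable_height : measurable_fun [set: graph] height.
Proof.
move=> _ B mB; rewrite setTI.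
suff: graph_measurable (height @^-1` B) by [].
move=> v w vw.
rewrite (_ : _ `&` _ = `[0, 1] `&`
    (fun t => (1 - t) * v.2%:~R + t * w.2%:~R) @^-1` B); last first.
  by apply/seteqP; split=> t [t01 /=]; rewrite heightE.
have mf : measurable_fun [set: R]
    (fun t : R => (1 - t) * v.2%:~R + t * w.2%:~R).
  apply: measurable_funD; apply: measurable_funM => //.
  exact: measurable_funB.
apply: measurableI => //; rewrite -[X in measurable X]setTI.
exact: mf.
Qed.

Section Measures.
Local Open Scope ereal_scope.
Variable nu : {outer_measure set Z -> \bar R}.

Definition graph_measure (A : set graph) : \bar R :=
  \esum_(v in is_vertex) \esum_(w in adjacent v)
    ((nu (vertex_ball v) + nu (vertex_ball w)) *
     lebesgue_measure (`[0%R, 1%R] `&` edge v w @^-1` A)).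

Let graph_measure0 : graph_measure set0 = 0.
Proof.
apply: esum1 => v _; apply: esum1 => w _.
by rewrite preimage_set0 setI0 measure0 mule0.
Qed.

Let term_ge0 v w A : 0 <= (nu (vertex_ball v) + nu (vertex_ball w)) *
     lebesgue_measure (`[0%R, 1%R] `&` edge v w @^-1` A).
Proof. by rewrite mule_ge0// adde_ge0// outer_measure_ge0. Qed.

Let graph_measure_ge0 A : 0 <= graph_measure A.
Proof. by apply: esum_ge0 => v _; apply: esum_ge0. Qed.

Let nneseries_mull (c : \bar R) (f : (\bar R)^nat) : 0 <= c ->
  (forall n, 0 <= f n) ->
  \sum_(0 <= n <oo) c * f n = c * \sum_(0 <= n <oo) f n.
Proof.
move=> c0 f0; case: c c0 => [r|_|//]; first by rewrite lee_fin => r0; rewrite nneseriesZl.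
have [f00|/existsNP[n /eqP fn]] := pselect (forall n, f n = 0).
  by rewrite !eseries0 ?mule0// => i _ _; rewrite f00 mule0.
have fn0 : 0 < f n by rewrite lt0e fn f0.
have -> : \sum_(0 <= n <oo) +oo * f n = +oo.
  apply: (@nneseries_pinfty _ _ _ n) => //; last by rewrite gt0_mulye.
  by move=> m _; rewrite mule_ge0.
rewrite gt0_mulye// (@nneseriesD1 _ _ n)//.
by rewrite (lt_le_trans fn0)// leeDl// nneseries_ge0.
Qed.

Let esum_swap (I J : choiceType) (A : set I) (B : set J) (a : I -> J -> \bar R) :
  (forall i j, 0 <= a i j) ->
  \esum_(i in A) \esum_(j in B) a i j = \esum_(j in B) \esum_(i in A) a i j.
Proof.
move=> a0; rewrite !esum_esum//.
rewrite (@reindex_esum _ _ _ (B `*`` fun=> A) _ (fun p => (p.2, p.1)))//.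
split=> [[j i] /= []//| |[i j] /= [Ai Bj]]; last by exists (j, i).
by move=> [j i] [j' i'] _ _ /= [-> ->].
Qed.

Let graph_measure_sigma_additive : semi_sigma_additive graph_measure.
Proof.
move=> F mF tF mUF; apply: cvg_toP.
  by apply: is_cvg_nneseries => n _ _.
rewrite nneseries_esumT// esum_swap; last by move=> *; exact: esum_ge0.
apply: eq_esum => v _; rewrite esum_swap//; apply: eq_esum => w vw.
rewrite -nneseries_esumT// nneseries_mull ?adde_ge0 ?outer_measure_ge0//.
congr (_ * _); rewrite preimage_bigcup setI_bigcupr.
apply/esym; apply: measure_semi_bigcup.
- by move=> i; exact: mF.
- apply/trivIsetP => i j _ _ ij; rewrite -setIIr -(preimage_setI (edge v w)).
  by move/trivIsetP : tF => /(_ i j) ->//; rewrite preimage_set0 setI0.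
- by apply: bigcupT_measurable => i; exact: mF.
Qed.

HB.instance Definition _ := isMeasure.Build _ _ _ graph_measure
  graph_measure0 graph_measure_ge0 graph_measure_sigma_additive.

Variable beta : R.

Definition weighted_measure (A : set graph) : \bar R :=
  \int[graph_measure]_(x in A) (alpha `^ (- beta * height x))%:E.

Let weighted_measure0 : weighted_measure set0 = 0.
Proof. exact: integral_set0. Qed.

Let weighted_measure_ge0 A : 0 <= weighted_measure A.
Proof. by apply: integral_ge0 => x _; rewrite lee_fin powR_ge0. Qed.

Let weighted_measure_sigma_additive : semi_sigma_additive weighted_measure.
Proof.
move=> F mF tF mUF; apply: cvg_toP.
  by apply: is_cvg_nneseries => n _ _.
rewrite /weighted_measure ge0_integral_bigcup//; last first.
  by move=> x _; rewrite lee_fin powR_ge0.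
apply/measurable_EFinP; apply: (@measurableT_comp _ _ _ _ _ _ (powR alpha)).
  exact: measurable_powRr.
apply: measurable_funM => //.
exact: measurable_funS graph_measurable_height.
Qed.

HB.instance Definition _ := isMeasure.Build _ _ _ weighted_measure
  weighted_measure0 weighted_measure_ge0 weighted_measure_sigma_additive.

End Measures.


Lemma rho_bounded v w : adjacent v w -> exists2 M, 0 <= M &
  forall t, t \in `[0, 1] -> rho (edge v w t) <= M.
Proof.
move=> vw; pose K : R := `|v.2%:~R| + `|w.2%:~R|.
exists (1 + expR (K * `|ln alpha|)).
  by rewrite addr_ge0// expR_ge0.
move=> t t01; rewrite /rho heightE// /powR; case: ifPn => _.
  apply: (@le_trans _ _ 1); first by case: (_ == _).
  by rewrite lerDl expR_ge0.
apply: (@le_trans _ _ (expR (K * `|ln alpha|))); last by rewrite lerDr.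
rewrite ler_expR (le_trans (ler_norm _))// normrM normrN ler_wpM2r//.
move: t01; rewrite in_itv/= => /andP[t0 t1].
rewrite (le_trans (ler_normD _ _))// !normrM lerD//.
  by rewrite ger0_norm ?subr_ge0// ler_piMl// gerBl.
by rewrite ger0_norm// ler_piMl.
Qed.

Lemma chain_ge0 x y l : chain x y l -> 0 <= l.
Proof. by elim=> // *; rewrite addr_ge0. Qed.

Lemma graph_dist_edge v w s t : adjacent v w ->
  s \in `[0, 1] -> t \in `[0, 1] ->
  graph_dist (edge v w s) (edge v w t) <= `|s - t|.
Proof.
move=> vw s01 t01; apply: ge_inf.
  by exists 0 => l; exact: chain_ge0.
by rewrite /= -[`|_ - _|]addr0; apply: chain_cons => //; exact: chain_nil.
Qed.

Lemma polygon_length_edge v w a b (s : seq R) : adjacent v w ->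
  0 <= a -> b <= 1 -> itv_partition a b s ->
  polygon_length graph_dist (edge v w) a s <= b - a.
Proof.
move=> vw; elim: s a => [|x s IH] a a0 b1.
  by move=> /itv_partition_nil ->; rewrite /polygon_length big_ord0 subrr.
move=> abs; have ax : a < x by case: abs => /= /andP[].
have xbs := itv_partition_cons abs.
have xb := itv_partition_le xbs.
rewrite /polygon_length big_ord_recl/=.
have -> : b - a = (x - a) + (b - x) by rewrite [RHS]addrC addrA subrK.
rewrite lerD//.
  rewrite (le_trans (graph_dist_edge vw _ _))//.
  - by rewrite in_itv/= a0 (le_trans (ltW ax))// (le_trans xb).
  - by rewrite in_itv/= (le_trans a0 (ltW ax)) (le_trans xb).
  - by rewrite distrC ger0_norm// subr_ge0 ltW.
have := IH x (le_trans a0 (ltW ax)) b1 xbs.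
apply: le_trans; rewrite /polygon_length le_eqVlt; apply/orP; left; apply/eqP.
apply: eq_bigr => i _; rewrite /= add0n.
congr (graph_dist (edge v w _) (edge v w _)).
  by apply: set_nth_default; rewrite /= ltnS ltnW.
by apply: set_nth_default.
Qed.

Lemma dist_rho_edge v w : adjacent v w -> exists2 M, 0 <= M &
  forall a b, 0 <= a -> a <= b -> b <= 1 ->
    dist_rho (edge v w a) (edge v w b) <= M * (b - a).
Proof.
move=> vw; have [M M0 rhoM] := rho_bounded vw.
exists M => // a b a0 ab b1.
have Lab : (curve_length graph_dist (edge v w) a b <= (b - a)%:E)%E.
  apply: ge_ereal_sup => _ [s sP <-]; rewrite lee_fin.
  exact: polygon_length_edge.
have ab01 t : t \in `[a, b] -> t \in `[0, 1].
  rewrite !in_itv/= => /andP[at_ tb].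
  by rewrite (le_trans a0 at_) (le_trans tb b1).
have rect : rectifiable_curve graph_dist (edge v w) a b.
  split => //; last by rewrite (le_lt_trans Lab)// ltry.
  move=> t tab e e0; exists e => // s sab st.
  by rewrite (le_lt_trans (graph_dist_edge vw _ _))// ?ab01// distrC.
set r := curve_integral graph_dist (EFin \o rho) (edge v w) a b.
have r_le : (r <= (M * (b - a))%:E)%E.
  rewrite /r /curve_integral; set L := fine _.
  have L0 : L <= b - a.
    rewrite /L; move: Lab; case: (curve_length _ _ _ _) => //=.
    by rewrite subr_ge0.
  apply: (@le_trans _ _ (\int[lebesgue_measure]_(s in `[0%R, L]) M%:E)%E).
    rewrite ge0_integralE; last by move=> x _; rewrite lee_fin powR_ge0.
    rewrite ge0_integralE; last by move=> x _; rewrite lee_fin.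
    apply: ereal_sup_le => _ [h hP <-]; exists h => // x.
    apply: (le_trans (hP x)); rewrite /patch; case: ifP => // _.
    rewrite lee_fin; apply: rhoM; apply: ab01.
    by case: xgetP => [y _ [/=]//|_]; rewrite in_itv/= lexx.
  rewrite integral_cst//= lebesgue_measure_itv/= lte_fin.
  case: ifPn => [Lp|_]; last by rewrite mule0 lee_fin mulr_ge0// subr_ge0.
  by rewrite -EFinD -EFinM lee_fin subr0 ler_wpM2l.
rewrite /dist_rho; set I := ereal_inf _.
have : (I <= (M * (b - a))%:E)%E.
  by apply: le_trans r_le; apply: ereal_inf_lbound; exists (edge v w), a, b.
case: I => //=; first by rewrite mulr_ge0// subr_ge0.
Qed.

Section MeasureOnCompletion.
Variable X : completion.

Definition borel_completion := g_sigma_algebraType (@open X).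

Lemma emb_measurable :
  measurable_fun [set: graph] (emb X : graph -> borel_completion).
Proof.
apply: measurability; first by [].
move=> _ [U oU <-]; rewrite setTI.
suff: graph_measurable (emb X @^-1` U) by [].
move=> v w vw; have [M M0 dM] := dist_rho_edge vw.
apply: open_measurable_subspace => //.
have : {within `[(0:R), 1], continuous (emb X \o edge v w)}.
  apply/subspace_continuousP => t; rewrite /= => t01.
  apply/metricType_numDomainType.cvgrPdist_lt => e e0.
  have : \forall s \near nbhs t, `|t - s| < e / (M + 1).
    by apply: (@cvgr_dist_lt _ R^o); [exact: cvg_id|rewrite divr_gt0// ltr_wpDl].
  apply: filterS => s; rewrite ltr_pdivlMr ?ltr_wpDl// => tse s01.
  apply: le_lt_trans tse; rewrite /= mulrDr mulr1.
  have [t0 t1] : 0 <= t /\ t <= 1 by move: t01; rewrite in_itv => /andP.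
  have [s0 s1] : 0 <= s /\ s <= 1 by move: s01; rewrite /= in_itv => /andP.
  apply: (@le_trans _ _ (M * `|t - s|)); last by rewrite mulrC lerDl.
  have [ts|st] := leP t s.
    by rewrite emb_isometry distrC ger0_norm ?subr_ge0// dM.
  rewrite metric_sym emb_isometry ger0_norm ?subr_ge0; last exact: ltW.
  by rewrite dM// ltW.
by move/continuousP => /(_ _ oU).
Qed.

Variables (nu : {outer_measure set Z -> \bar R}) (beta : R).

(* The boundary, i.e. the complement of the range of [emb], is a null set. *)
Definition completion_measure (A : set borel_completion) : \bar R :=
  weighted_measure nu beta (emb X @^-1` A).

Let completion_measure0 : completion_measure set0 = 0%E.
Proof. by rewrite /completion_measure preimage_set0 measure0. Qed.

Let completion_measure_ge0 A : (0 <= completion_measure A)%E.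
Proof. exact: measure_ge0. Qed.

Let completion_measure_sigma_additive : semi_sigma_additive completion_measure.
Proof.
move=> F mF tF mUF; rewrite /completion_measure preimage_bigcup.
have mE (A : set borel_completion) : measurable A ->
    measurable (emb X @^-1` A).
  by move=> mA; rewrite -[X in measurable X]setTI; exact: emb_measurable.
apply: measure_semi_sigma_additive.
- by move=> n; exact: mE.
- apply/trivIsetP => i j _ _ ij; rewrite -preimage_setI.
  by move/trivIsetP : tF => /(_ i j) ->//; rewrite preimage_set0.
- by rewrite -preimage_bigcup; exact: mE.
Qed.

HB.instance Definition _ := isMeasure.Build _ _ _ completion_measure
  completion_measure0 completion_measure_ge0 completion_measure_sigma_additive.

End MeasureOnCompletion.

Section Boundary.
Variable X : completion.

Definition boundary_point (z : Z) : X :=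
  get [set x : X | forall u : nat -> Z,
    (forall n, net S n%:Z (u n) /\ mdist (u n) z < alpha ^ (- n%:Z)) ->
    emb X (vertex (u n, n%:Z)) @[n --> \oo] --> x].

Definition boundary_dist (x y : Z) : R :=
  mdist (boundary_point x) (boundary_point y).

(* In [\bar R] the quantity [`|f x - f y|] is [+oo] as soon as [f x] or [f y] is
   infinite, because [+oo - +oo = -oo - -oo = -oo]. *)
Definition hyperbolic_upper_gradient (nu : {outer_measure set Z -> \bar R})
    (f : Z -> \bar R) (g : X -> \bar R) : Prop :=
  [/\ forall x, (0 <= g x)%E,
      measurable_fun [set: borel_completion X] (g : borel_completion X -> \bar R)
    & exists2 G : set Z, nu (~` G) = 0%E &
        forall x y, G x -> G y -> forall (gamma : R -> X) (a b : R),
          rectifiable_curve mdist gamma a b ->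
          (exists2 t, t \in `[a, b] & gamma t <> gamma a) ->
          gamma a = boundary_point x -> gamma b = boundary_point y ->
          (`|f x - f y| <= curve_integral mdist g gamma a b)%E].

End Boundary.

End HyperbolicFilling.

Arguments borel_completion {R alpha tau Z S} X.
Arguments completion_measure {R alpha tau Z S} X nu beta A.
Arguments boundary_point {R alpha tau Z S} X z.
Arguments boundary_dist {R alpha tau Z S} X x y.
Arguments hyperbolic_upper_gradient {R alpha tau Z S} X nu f g.

Section MetricMeasureSpace.
Context {R : realType} {Z : completeMetricType R}.
Variable nu : {outer_measure set Z -> \bar R}.
Local Open Scope ereal_scope.

Definition borel_regular : Prop :=
  <<s @open Z >> `<=` nu.-caratheodory /\
  forall A, exists B, [/\ <<s @open Z >> B, A `<=` B & nu A = nu B].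

Definition metric_measure_space : Prop :=
  borel_regular /\
  forall (z : Z) (r : R), (0 < r)%R -> 0 < nu (ball z r) < +oo.

Definition doubling (C : R) : Prop :=
  forall (z : Z) (r : R), (0 < r)%R -> nu (ball z (2 * r)) <= C%:E * nu (ball z r).

Local Notation nuZ := (nu : set (caratheodory_type nu) -> \bar R).

(* [d] is the distance used for the balls and the Besov norm. *)
Variables (d : Z -> Z -> R) (p theta : R).

(* The integrand vanishes for [x = y] if [u x] is finite. *)
Definition besov_norm (u : Z -> \bar R) : \bar R :=
  (\int[nuZ]_y \int[nuZ]_x
     (`|u x - u y| `^ p / ((d x y) `^ (p * theta))%:E /
      nu [set z | (d x z < d x y)%R])) `^ p^-1.

Definition besov_space (u : Z -> \bar R) : Prop :=
  [/\ measurable_fun [set: caratheodory_type nu] u,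
      forall (z : Z) (r : R), (0 < r)%R ->
        \int[nuZ]_(x in [set x | (d z x < r)%R]) `|u x| `^ p < +oo
    & besov_norm u < +oo].

End MetricMeasureSpace.

(* Main.v *)
(** The distance between two points [x] and [y] of [Z] being about
    [alpha ^ (- n)], they are joined in the completion by a curve that descends
    from [x] to a vertex of level [n] and climbs back to [y], so the upper
    gradient bounds [|f x - f y|] by the sum over [k >= n] of [alpha ^ (- k)]
    times the averages of [g] on the edges of level [k] of that curve. Since the
    edges are one-dimensional and have positive measure, no averaging over
    curves is needed. Splitting [alpha ^ (- k)] into two geometric factors turns
    the [p]-th power of the sum into a sum of energies [\int g ^ p] of edges
    near [x] and near [y]. Integrated against the Besov kernel, which doubling
    compares with the normalized indicators of the balls of the net of level
    [n], these energies add up to a multiple of the energy of [g], because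
    [p (1 - theta) = beta]. The identification of [Z] with the boundary is
    biLipschitz because functions on the vertices that vary by at most a multiple
    of [alpha ^ (- h)] along edges extend to Lipschitz functions for [d_rho]. *)
Require Import Defs.
From HB Require Import structures.
From mathcomp Require Import all_boot all_order all_algebra.
From mathcomp Require Import all_classical all_reals all_analysis.
From mathcomp Require Import measurable_realfun.
From mathcomp Require Import zify ring lra.
(* [adjacent] and [coord] are shadowed by the libraries. *)
Import Defs.
Import Order.TTheory GRing.Theory Num.Theory.
Import numFieldNormedType.Exports.
Local Open Scope classical_set_scope.
Local Open Scope ring_scope.

(** * Curve length and arclength parametrization *)

(** Two obstacles shape the proof. First, [g] is only Borel and [curve_integral] is taken in an
    arclength parameter selected by choice, so a classical change of variables does not apply. Every
    passage between a curve, its edges and the measure on the completion is an inequality between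
    push-forward measures of sets, extended to nonnegative measurable functions by
    [le_integral_superposition]. Second, the level [n] and the curve depend on the pair [x], [y],
    with no measurability in the pair. So the energy of one edge is replaced by a sum over all
    vertices whose net ball contains the point, and the chosen level by the sum over all levels.
    These majorants are countable sums of measurable terms, and integrals of nonnegative functions
    are monotone even for a nonmeasurable minorant. The two geometric factors are
    [alpha ^ (- k delta)] and [alpha ^ (- k (1 - delta))]: [0 < delta] makes the sum along a ray
    converge, [delta < theta] the sum over the depth below the starting level. *)

Definition pseudodist {R : realType} {T : Type} (d : T -> T -> R) : Prop :=
  [/\ forall x, d x x = 0, forall x y, d x y = d y x
    & forall x y z, d x z <= d x y + d y z].

Definition lipschitz_on {R : realType} {T : Type} (d : T -> T -> R)
    (gamma : R -> T) (a b : R) : Prop :=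
  forall s t, a <= s -> s <= t -> t <= b -> d (gamma s) (gamma t) <= t - s.

Section CurveLength.
Context {R : realType} {T : Type} (d : T -> T -> R) (gamma : R -> T).
Hypothesis dP : pseudodist d.

Local Notation V := (curve_length d gamma).

Lemma pseudodist_ge0 x y : 0 <= d x y.
Proof.
have [d0 ds dt] := dP; have := dt x y x.
by rewrite d0 (ds y x) -mulr2n pmulrn_lge0.
Qed.

Lemma polygon_length_nil a : polygon_length d gamma a [::] = 0.
Proof. by rewrite /polygon_length big_ord0. Qed.

Lemma polygon_length_cons a x (s : seq R) :
  polygon_length d gamma a (x :: s) =
  d (gamma a) (gamma x) + polygon_length d gamma x s.
Proof.
rewrite /polygon_length big_ord_recl/=; congr (_ + _).
apply: eq_bigr => i _; rewrite /= add0n.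
congr (d (gamma _) (gamma _)); apply: set_nth_default => //=.
by rewrite ltnS ltnW.
Qed.

Lemma polygon_length_cat a b (s t : seq R) : last a s = b ->
  polygon_length d gamma a (s ++ t) =
  polygon_length d gamma a s + polygon_length d gamma b t.
Proof.
elim: s a => [|x s IH] a /= => [<-|sb]; first by rewrite polygon_length_nil add0r.
by rewrite !polygon_length_cons IH// addrA.
Qed.

Lemma curve_length_polygon a b s : itv_partition a b s ->
  ((polygon_length d gamma a s)%:E <= V a b)%E.
Proof. by move=> abs; apply: ereal_sup_ubound; exists s. Qed.

Lemma curve_lengthxx a : V a a = 0%E.
Proof.
apply/eqP; rewrite eq_le; apply/andP; split.
  apply: ge_ereal_sup => _ [s /itv_partitionxx -> <-].
  by rewrite polygon_length_nil.
have /curve_length_polygon : itv_partition a a [::] by split => /=.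
by rewrite polygon_length_nil.
Qed.

Lemma curve_length_dist a b : a <= b -> ((d (gamma a) (gamma b))%:E <= V a b)%E.
Proof.
rewrite le_eqVlt => /predU1P[->|ab].
  by have [-> _ _] := dP; rewrite curve_lengthxx.
apply: le_trans (curve_length_polygon _ _ _ (itv_partition1 ab)).
by rewrite polygon_length_cons polygon_length_nil addr0.
Qed.

Lemma curve_length_ge0 a b : a <= b -> (0 <= V a b)%E.
Proof.
move=> ab; apply: le_trans (curve_length_dist _ _ ab).
by rewrite lee_fin pseudodist_ge0.
Qed.

Lemma curve_length_superadd a b c : a <= b -> b <= c ->
  (V a b + V b c <= V a c)%E.
Proof.
move=> ab bc; have [Vac|Vac] := eqVneq (V a c) +oo%E; first by rewrite Vac leey.
have step s : itv_partition a b s ->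
    ((polygon_length d gamma a s)%:E + V b c <= V a c)%E.
  move=> abs; rewrite -leeBrDl//; apply: ge_ereal_sup => _ [t bct <-].
  rewrite leeBrDl// -EFinD -(polygon_length_cat _ b) ?curve_length_polygon//.
    exact: itv_partition_cat abs bct.
  by case: abs => _ /eqP.
have [W|W] := eqVneq (V b c) +oo%E.
  move: ab; rewrite le_eqVlt => /predU1P[<-|ab].
    by rewrite curve_lengthxx add0e.
  have := step _ (itv_partition1 ab).
  by rewrite W addeC/= leye_eq (negbTE Vac).
have Wf : V b c \is a fin_num.
  by rewrite ge0_fin_numE ?curve_length_ge0// ltey.
rewrite -leeBrDr//; apply: ge_ereal_sup => _ [s abs <-].
by rewrite leeBrDr//; exact: step.
Qed.

Lemma curve_length_add a b c : a <= b -> b <= c -> (V a c = V a b + V b c)%E.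
Proof.
move=> ab bc; apply/eqP; rewrite eq_le curve_length_superadd// andbT.
apply: ge_ereal_sup => _ [s acs <-]; move: acs ab.
elim: s a => [|x s IH] a.
  move=> /itv_partition_nil ac ab; rewrite polygon_length_nil.
  by rewrite adde_ge0// curve_length_ge0.
move=> acs ab; have ax : a < x by case: acs => /= /andP[].
have xcs := itv_partition_cons acs.
rewrite polygon_length_cons EFinD; have [xb|bx] := leP x b.
  have := IH x xcs xb.
  move=> /(leeD (curve_length_dist _ _ (ltW ax)))/le_trans; apply.
  by rewrite addeA leeD2r// curve_length_superadd// ltW.
have [_ _ dt] := dP.
apply: (@le_trans _ _ ((d (gamma a) (gamma b))%:E + ((d (gamma b) (gamma x))%:E
    + (polygon_length d gamma x s)%:E))%E).
  by rewrite -!EFinD lee_fin addrA lerD2r.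
apply: leeD; first exact: curve_length_dist.
apply: (@le_trans _ _ (V b x + V x c)%E).
  by apply: leeD; [exact/curve_length_dist/ltW|exact: curve_length_polygon].
apply: curve_length_superadd; first exact: ltW.
exact: itv_partition_le xcs.
Qed.

Lemma curve_length_lipschitz a b : a <= b -> lipschitz_on d gamma a b ->
  (V a b <= (b - a)%:E)%E.
Proof.
move=> ab lip; apply: ge_ereal_sup => _ [s abs <-]; rewrite lee_fin.
have : a <= a by []; move: {1 3 4 5}a abs => x xbs ax.
elim: s x xbs ax => [|y s IH] x xbs ax.
  by rewrite polygon_length_nil subr_ge0 (itv_partition_le xbs).
have xy : x < y by case: xbs => /= /andP[].
have ybs := itv_partition_cons xbs.
rewrite polygon_length_cons.
have -> : b - x = (y - x) + (b - y) by ring.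
rewrite lerD ?IH ?(le_trans ax (ltW xy))// lip ?(ltW xy)//.
exact: itv_partition_le ybs.
Qed.

Lemma lipschitz_on_rectifiable a b : a <= b -> lipschitz_on d gamma a b ->
  rectifiable_curve d gamma a b.
Proof.
move=> ab lip; split => //; last first.
  by rewrite (le_lt_trans (curve_length_lipschitz _ _ ab lip))// ltry.
move=> t; rewrite in_itv/= => /andP[at_ tb] e e0; exists e => // s.
rewrite in_itv/= => /andP[as_ sb]; apply: le_lt_trans.
have [_ ds _] := dP.
have [st|/ltW ts] := leP s t.
  by rewrite ds (le_trans (lip _ _ _ _ _))// distrC ler_norm.
by rewrite (le_trans (lip _ _ _ _ _))// ler_norm.
Qed.

Section Rectifiable.
Variables (a b : R).
Hypothesis rect : rectifiable_curve d gamma a b.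

Let ab : a <= b. Proof. by case: rect. Qed.

Lemma curve_length_sub_fin s t : a <= s -> s <= t -> t <= b ->
  V s t \is a fin_num.
Proof.
move=> as_ st tb; have [_ _ Vab] := rect.
rewrite ge0_fin_numE ?curve_length_ge0//; apply: le_lt_trans Vab.
rewrite (curve_length_add a t b)// ?(le_trans as_)//.
rewrite (curve_length_add a s t)// -addeA addeCA leeDl//.
by rewrite adde_ge0// curve_length_ge0.
Qed.

(** Take a polygon on [[t, b]] whose length misses [V t b] by less than [e / 2] and insert a vertex
    [u] so close to [t] that the first side is at most [e / 2]. The deficits of the pieces are
    nonnegative, so the one on [[t, u]] is below [e / 2] as well. *)
Lemma curve_length_rcont t (e : R) : a <= t -> t < b -> 0 < e ->
  exists2 u, t < u <= b & (V t u <= e%:E)%E.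
Proof.
move=> at_ tb e0; have [_ cont _] := rect.
have e20 : 0 < e / 2 by rewrite divr_gt0.
have [|del del0 Hdel] := cont t _ _ e20; first by rewrite in_itv/= at_ ltW.
have Vtb := curve_length_sub_fin _ _ at_ (ltW tb) (lexx b).
have [_ [s tbs <-]] := ub_ereal_sup_adherent e20 Vtb.
case: s tbs => [/itv_partition_nil tb'|x s tbs sup]; first by rewrite tb' ltxx in tb.
have tx : t < x by case: tbs => /= /andP[].
have xbs := itv_partition_cons tbs.
have xb := itv_partition_le xbs.
pose u := Num.min x (t + del / 2).
have ux : u <= x by rewrite ge_min lexx.
have tu : t < u by rewrite lt_min tx ltrDl divr_gt0.
have ub : u <= b := le_trans ux xb.
exists u; first by rewrite tu.
have dtu : d (gamma t) (gamma u) <= e / 2.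
  apply/ltW/Hdel; first by rewrite in_itv/= ub (le_trans at_ (ltW tu)).
  rewrite gtr0_norm ?subr_gt0// ltrBlDl (@le_lt_trans _ _ (t + del / 2))//.
    by rewrite ge_min lexx orbT.
  by rewrite ltrD2l ltr_pdivrMr// ltr_pMr// ltr1n.
have au : a <= u := le_trans at_ (ltW tu).
have Vtu := curve_length_sub_fin _ _ at_ (ltW tu) ub.
have Vub := curve_length_sub_fin _ _ au ub (lexx b).
have Vux := curve_length_sub_fin _ _ au ux xb.
have Vxb := curve_length_sub_fin _ _ (le_trans au ux) xb (lexx b).
move: sup; rewrite -/(V t b) polygon_length_cons.
rewrite (curve_length_add t u b)// ?(ltW tu)// (curve_length_add u x b)//.
have := curve_length_polygon _ _ _ xbs.
have := curve_length_dist _ _ ux.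
move: Vtu Vux Vxb.
case: (V t u) => // V1 _; case: (V u x) => // V2 _; case: (V x b) => // V3 _.
rewrite !lee_fin -!EFinD lte_fin.
have [_ _ dt] := dP; have := dt (gamma t) (gamma u) (gamma x).
lra.
Qed.

(** By continuity, moving the last vertex of a polygon from [t] back to a nearby [u] shortens it by
    at most [e]. The induction only serves to reach the last side. *)
Lemma curve_length_lsc t q (e : R) : a <= t -> t <= b -> 0 < e ->
  forall x, a <= x -> x < t -> itv_partition x t q ->
  exists2 del, 0 < del & forall u, x <= u -> t - del < u -> u <= t ->
    ((polygon_length d gamma x q)%:E <= V x u + e%:E)%E.
Proof.
move=> at_ tb e0; have [_ cont _] := rect; have [_ ds dt] := dP.
elim: q => [|y q IH] x ax xt xtq.
  by move/itv_partition_nil : xtq xt => ->; rewrite ltxx.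
have xy : x < y by case: xtq => /= /andP[].
have ytq := itv_partition_cons xtq.
have := itv_partition_le ytq; rewrite le_eqVlt => /predU1P[yt|yt].
  subst y; move/itv_partitionxx : ytq => ->.
  have [|del del0 Hdel] := cont t _ _ e0; first by rewrite in_itv/= at_.
  exists del => // u xu tu ut.
  rewrite polygon_length_cons polygon_length_nil addr0.
  apply: (@le_trans _ _ ((d (gamma x) (gamma u))%:E + e%:E)%E); last first.
    by rewrite leeD2r// curve_length_dist.
  rewrite -EFinD lee_fin (le_trans (dt _ (gamma u) _))// lerD2l ds.
  apply/ltW/Hdel.
    by rewrite in_itv/= (le_trans ax xu) (le_trans ut tb).
  by rewrite ler0_norm ?subr_le0// opprB ltrBlDl -ltrBlDr.
have [del del0 H] := IH y (le_trans ax (ltW xy)) yt ytq.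
exists (Num.min del (t - y)); first by rewrite lt_min del0 subr_gt0.
move=> u xu tu ut.
have yu : y <= u.
  apply/ltW/(le_lt_trans _ tu); rewrite -[leLHS](subKr t) lerB//.
  by rewrite ge_min lexx orbT.
rewrite polygon_length_cons EFinD (curve_length_add x y u)// ?(ltW xy)//.
rewrite -addeA leeD ?(curve_length_dist _ _ (ltW xy))// H//.
by apply: le_lt_trans tu; rewrite lerB// ge_min lexx.
Qed.

(** The witness is the supremum of the times at which the length is at most [s]: semicontinuity from
    the left bounds the length there by [s], and right continuity excludes that it is smaller. *)
Lemma curve_length_ivt s : 0 <= s -> s <= fine (V a b) ->
  exists2 t, t \in `[a, b] & V a t = s%:E.
Proof.
move=> s0 sL.
have Vab := curve_length_sub_fin _ _ (lexx a) ab (lexx b).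
pose A := [set t | t \in `[a, b] /\ (V a t <= s%:E)%E].
have Aa : A a by split; rewrite ?in_itv/= ?lexx ?ab// curve_lengthxx lee_fin.
have hsA : has_sup A.
  by split; [exists a|exists b => x [+ _]; rewrite in_itv/= => /andP[]].
pose t := sup A.
have at_ : a <= t by apply: ub_le_sup Aa; case: hsA.
have tb : t <= b.
  by apply: ge_sup; [exists a|move=> x [+ _]; rewrite in_itv/= => /andP[]].
exists t; first by rewrite in_itv/= at_.
have Vat := curve_length_sub_fin _ _ (lexx a) at_ tb.
have lsc : (V a t <= s%:E)%E.
  move: at_; rewrite le_eqVlt => /predU1P[<-|at_].
    by rewrite curve_lengthxx lee_fin.
  apply: ge_ereal_sup => _ [q atq <-]; apply/lee_addgt0Pr => e e0.
  have [del del0 H] :=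
    curve_length_lsc t q e (ltW at_) tb e0 a (lexx _) at_ atq.
  have [u Au tu] := sup_adherent del0 hsA.
  have au : a <= u by case: Au => [+ _]; rewrite in_itv/= => /andP[].
  apply: le_trans (H u au tu _) _; first by apply: ub_le_sup Au; case: hsA.
  by rewrite leeD2r//; case: Au.
apply/eqP; rewrite eq_le lsc/= leNgt; apply/negP => ts.
have t_b : t < b.
  rewrite lt_neqAle tb andbT; apply/eqP => tb'.
  by move: ts; rewrite tb' -(fineK Vab) lte_fin ltNge sL.
have [|u /andP[tu ub] Vtu] :=
    curve_length_rcont t (s - fine (V a t)) at_ t_b.
  by rewrite subr_gt0 -lte_fin fineK.
have : u <= t.
  apply: ub_le_sup; first by case: hsA.
  split; first by rewrite in_itv/= ub (le_trans at_ (ltW tu)).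
  rewrite (curve_length_add a t u)// ?(ltW tu)//.
  apply: (le_trans (leeD (lexx _) Vtu)).
  by rewrite -{1}(fineK Vat) -EFinD lee_fin addrC subrK.
by rewrite leNgt tu.
Qed.

Local Notation L := (fine (V a b)).

Lemma arclength_paramP s : 0 <= s -> s <= L -> exists t,
  [/\ t \in `[a, b], V a t = s%:E & arclength_param d gamma a b s = gamma t].
Proof.
move=> s0 sL; have [t tab tE] := curve_length_ivt _ s0 sL.
set P := [set t | t \in `[a, b] /\ curve_length d gamma a t = s%:E].
have [] : P (xget a P) by apply: xgetPex; exists t.
by exists (xget a P).
Qed.

Lemma arclength_param_lipschitz :
  lipschitz_on d (arclength_param d gamma a b) 0 L.
Proof.
move=> s t s0 st tL; have [ds0 _ _] := dP.
move: st; rewrite le_eqVlt => /predU1P[E|st]; first by rewrite E ds0 subrr.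
have [u [uab uE ->]] := arclength_paramP _ s0 (le_trans (ltW st) tL).
have [v [vab vE ->]] := arclength_paramP _ (le_trans s0 (ltW st)) tL.
move: uab vab; rewrite !in_itv/= => /andP[au ub] /andP[av vb].
have uv : u <= v.
  rewrite leNgt; apply/negP => vu.
  have := curve_length_add a v u av (ltW vu); rewrite uE vE => E.
  have := curve_length_ge0 _ _ (ltW vu).
  have := curve_length_sub_fin _ _ av (ltW vu) ub.
  by case: (V v u) E => // r [sE] _; rewrite lee_fin; lra.
have := curve_length_add a u v au uv; rewrite uE vE => E.
have := curve_length_dist _ _ uv.
have := curve_length_sub_fin _ _ au uv vb.
by case: (V u v) E => // r [sE] _; rewrite lee_fin; lra.
Qed.

(** The time selected by [arclength_param] may differ from [t], but the length in between is zero,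
    so a distance that separates points gives the same value of [gamma]. *)
Lemma arclength_param_length t : (forall x y, d x y = 0 -> x = y) ->
  t \in `[a, b] -> arclength_param d gamma a b (fine (V a t)) = gamma t.
Proof.
move=> dsep tab; have := tab; rewrite in_itv/= => /andP[at_ tb].
have Vat := curve_length_sub_fin _ _ (lexx a) at_ tb.
have Vtb := curve_length_sub_fin _ _ at_ tb (lexx b).
have [||u [uab uE ->]] := arclength_paramP (fine (V a t)).
- by rewrite fine_ge0// curve_length_ge0.
- rewrite (curve_length_add a t b)// fineD// lerDl fine_ge0//.
  exact: (curve_length_ge0 _ _ tb).
rewrite fineK// in uE; move: uab; rewrite in_itv/= => /andP[au ub].
have zero x y : a <= x -> x <= y -> y <= b -> V a x = V a y ->
    gamma x = gamma y.
  move=> ax xy yb E; apply: dsep; apply/eqP; rewrite eq_le pseudodist_ge0 andbT.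
  rewrite -lee_fin (le_trans (curve_length_dist _ _ xy))//.
  have := curve_length_add a x y ax xy; rewrite -E.
  have := curve_length_sub_fin _ _ (lexx a) ax (le_trans xy yb).
  have := curve_length_sub_fin _ _ ax xy yb.
  case: (V x y) => // r _; case: (V a x) => // r' _ [] /esym/eqP.
  by rewrite -subr_eq0 addrAC subrr add0r => /eqP ->.
have [ut|/ltW tu] := leP u t; first exact: zero.
by apply/esym; exact: zero.
Qed.

End Rectifiable.

End CurveLength.

(** * Integrals *)

Section Superposition.
Local Open Scope ereal_scope.
Import HBNNSimple.

(** The integral of a nonnegative function is a supremum over the simple functions below it, hence
    monotone without measurability. This covers integrands built from [arclength_param] and the
    Besov integrand. *)
Lemma ge0_le_integral_nomeas {d} {T : measurableType d} {R : realType}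
    (m : {measure set T -> \bar R}) (D : set T) (f g : T -> \bar R) :
  (forall x, D x -> 0 <= f x) -> (forall x, D x -> f x <= g x) ->
  \int[m]_(x in D) f x <= \int[m]_(x in D) g x.
Proof.
move=> f0 fg; rewrite !ge0_integralE//; last first.
  by move=> x Dx; rewrite (le_trans (f0 x Dx))// fg.
apply: ereal_sup_le => _ [h hP <-]; exists h => // x.
apply: (le_trans (hP x)); rewrite /patch; case: ifPn => // xD.
by apply: fg; rewrite inE in xD.
Qed.

Lemma integral_nnsfun_comp {d d'} {T : measurableType d}
    {T' : measurableType d'} {R : realType} (m : {measure set T -> \bar R})
    (D : set T) (phi : T -> T') (h : {nnsfun T' >-> R}) :
  measurable D -> measurable_fun D phi ->
  \int[m]_(x in D) (h (phi x))%:E =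
  \sum_(r \in range h) r%:E * m (D `&` phi @^-1` (h @^-1` [set r])).
Proof.
move=> mD mphi.
have mh r : measurable (h @^-1` [set r]) by [].
under eq_integral do rewrite fimfunE -fsumEFin//.
have mf r : measurable_fun D (fun x => (\1_(h @^-1` [set r]) (phi x) : R)).
  by apply: (@measurableT_comp _ _ _ _ _ _ (\1_(h @^-1` [set r]) : T' -> R)).
rewrite ge0_integral_fsum//; last 2 first.
- by move=> r; apply/measurable_EFinP/measurable_funM.
- by move=> r x _; rewrite nnfun_muleindic_ge0.
apply: eq_fsbigr => r /[!inE] -[y _ <-].
under eq_integral do rewrite EFinM.
rewrite ge0_integralZl_EFin//; last exact/measurable_EFinP.
congr (_ * _).
transitivity (\int[m]_(x in D) (\1_(D `&` phi @^-1` (h @^-1` [set h y])) x)%:E).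
  apply: eq_integral => x xD; rewrite !indicE in_setI xD/=.
  suff -> : (phi x \in h @^-1` [set h y]) = (x \in phi @^-1` (h @^-1` [set h y])) by [].
  by apply/idP/idP => /set_mem H; exact/mem_set.
rewrite integral_indic; [|exact: mD|by apply: mphi].
by congr (m _); rewrite setIC setIA setIid.
Qed.

Lemma mul_measure_preimage_ge0 {d d'} {T : measurableType d}
    {T' : measurableType d'} {R : realType} (m : {measure set T -> \bar R})
    (D : set T) (phi : T -> T') (h : {nnsfun T' >-> R}) (r : R) :
  0 <= r%:E * m (D `&` phi @^-1` (h @^-1` [set r])).
Proof.
have [r0|r0] := ltP r 0%R; last by rewrite mule_ge0.
by rewrite preimage_nnfun0// preimage_set0 setI0 measure0 mule0.
Qed.

(** A domination of finitely many weighted push-forwards by another push-forward, known on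
    measurable sets, passes to simple functions and then, by monotone convergence, to [F]. It serves
    for the Lipschitz substitution and for comparing integrals over edges with integrals over the
    graph and over its completion. *)
Lemma le_integral_superposition {d d1 d2} {T : measurableType d}
    {T1 : measurableType d1} {T2 : measurableType d2} {R : realType}
    (m1 : {measure set T1 -> \bar R}) (m2 : {measure set T2 -> \bar R})
    (I : eqType) (s : seq I) (c : I -> R) (M : R) (D1 : set T1) (D2 : set T2)
    (phi1 : I -> T1 -> T) (phi2 : T2 -> T) (F : T -> \bar R) :
  (forall i, i \in s -> 0 <= c i)%R -> (0 <= M)%R ->
  measurable D1 -> measurable D2 ->
  (forall i, i \in s -> measurable_fun D1 (phi1 i)) -> measurable_fun D2 phi2 ->
  (forall x, 0 <= F x) -> measurable_fun setT F ->
  (forall A, measurable A ->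
    \sum_(i <- s) (c i)%:E * m1 (D1 `&` phi1 i @^-1` A) <=
    M%:E * m2 (D2 `&` phi2 @^-1` A)) ->
  \sum_(i <- s) (c i)%:E * \int[m1]_(x in D1) F (phi1 i x) <=
  M%:E * \int[m2]_(x in D2) F (phi2 x).
Proof.
move=> c0 M0 mD1 mD2 mphi1 mphi2 F0 mF dom.
pose h n := nnsfun_approx measurableT mF n.
have hF x : (h n x)%:E @[n --> \oo] --> F x by exact: cvg_nnsfun_approx.
have hnd x n n' : (n <= n')%N -> ((h n x)%:E <= (h n' x)%:E)%E.
  by move=> nn'; rewrite lee_fin; exact/lefP/nd_nnsfun_approx.
have hle n x : (h n x)%:E <= F x.
  by apply: cvge_ge (hF x); exists n => // k /= nk; exact: hnd.
have mh n : measurable_fun setT (fun x => (h n x)%:E) by exact/measurable_EFinP.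
have step n : \sum_(i <- s) (c i)%:E * \int[m1]_(x in D1) (h n (phi1 i x))%:E <=
    M%:E * \int[m2]_(x in D2) F (phi2 x).
  apply: (@le_trans _ _ (M%:E * \int[m2]_(x in D2) (h n (phi2 x))%:E)).
    rewrite integral_nnsfun_comp// ge0_mule_fsumr; last first.
      by move=> r; exact: mul_measure_preimage_ge0.
    rewrite (eq_big_seq (fun i => \sum_(r \in range (h n)) (c i)%:E * (r%:E *
        m1 (D1 `&` phi1 i @^-1` (h n @^-1` [set r]))))); last first.
      move=> i si /=; rewrite integral_nnsfun_comp//; last exact: mphi1.
      rewrite ge0_mule_fsumr// => r; exact: mul_measure_preimage_ge0.
    under eq_bigr do rewrite fsbig_finite//.
    rewrite fsbig_finite// exchange_big/= big_seq [leRHS]big_seq.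
    apply: lee_sum => r; rewrite in_fset_set// inE => -[y _ <-].
    under eq_bigr do rewrite muleCA.
    rewrite big_seq -ge0_sume_distrr; last first.
      by move=> i si; rewrite mule_ge0// lee_fin c0.
    by rewrite -big_seq [leRHS]muleCA lee_wpmul2l// ?lee_fin//; exact: dom.
  apply: lee_wpmul2l; first by rewrite lee_fin.
  by apply: ge0_le_integral_nomeas => // x _; rewrite lee_fin.
have cvgL : \sum_(i <- s | i \in s)
    (c i)%:E * \int[m1]_(x in D1) (h n (phi1 i x))%:E @[n --> \oo] -->
    \sum_(i <- s | i \in s) (c i)%:E * \int[m1]_(x in D1) F (phi1 i x).
  apply: cvg_nnesum => i si.
    apply: nearW => n; rewrite mule_ge0 ?lee_fin ?c0// integral_ge0// => x _.
    by rewrite lee_fin.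
  apply: cvgeZl => //.
  have -> : \int[m1]_(x in D1) F (phi1 i x) =
      \int[m1]_(x in D1) limn (fun n => (h n (phi1 i x))%:E).
    by apply: eq_integral => x _; apply/esym/cvg_lim => //; exact: hF.
  apply: cvg_monotone_convergence => //.
  - move=> n; apply: (measurableT_comp (mh n)); exact: mphi1.
  - by move=> n x _; rewrite lee_fin.
  - by move=> x _ n n' nn'; exact: hnd.
rewrite big_seq; apply: (cvge_to_le cvgL); apply: nearW => n.
by rewrite -big_seq; exact: step.
Qed.

End Superposition.

(** * Lipschitz substitution on the real line *)

Section LipschitzSubstitution.
Context {R : realType}.
Notation lam := (@lebesgue_measure R).

Definition lip_on (phi : R -> R) (a b M : R) : Prop :=
  forall s t, s \in `[a, b] -> t \in `[a, b] ->
    `|phi s - phi t| <= M * `|s - t|.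

Lemma lip_on_continuous phi a b M : 0 <= M -> lip_on phi a b M ->
  {within `[a, b], continuous phi}.
Proof.
move=> M0 lip; apply/subspace_continuousP => t /= tab.
apply/cvgrPdist_lt => e e0.
have : \forall s \near nbhs t, `|t - s| < e / (M + 1).
  by apply: (@cvgr_dist_lt _ R^o); [exact: cvg_id|rewrite divr_gt0// ltr_wpDl].
apply: filterS => s; rewrite ltr_pdivlMr ?ltr_wpDl// => tse sab.
apply: le_lt_trans tse; apply: (le_trans (lip _ _ tab sab)).
by rewrite mulrDr mulr1 mulrC lerDl.
Qed.

Lemma lip_on_measurable phi a b M : 0 <= M -> lip_on phi a b M ->
  measurable_fun `[a, b] phi.
Proof.
move=> M0 lip; apply: subspace_continuous_measurable_fun => //.
exact: lip_on_continuous M0 lip.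
Qed.

Lemma lip_image_measurable phi a b M : 0 <= M -> lip_on phi a b M ->
  measurable (phi @` `[a, b]).
Proof.
move=> M0 lip; apply: closed_measurable; apply: compact_closed => //.
apply: continuous_compact; last exact: segment_compact.
exact: lip_on_continuous M0 lip.
Qed.

Let le_lam (A B : set R) : measurable A -> measurable B -> A `<=` B ->
  (lam A <= lam B)%E.
Proof. by move=> mA mB AB; apply: le_measure => //; exact: mem_set. Qed.

(** Cover the preimage by an open set of almost the same measure and split it into disjoint open
    intervals: the image of each lies in a closed interval at most [M] times as long. Neither
    injectivity nor a derivative of [phi] enters. *)
Lemma lip_image_le phi a b M A B : 0 <= M -> lip_on phi a b M ->
  measurable A -> measurable B -> B `<=` phi @` `[a, b] ->
  (lam (B `&` A) <= M%:E * lam (`[a, b] `&` phi @^-1` A))%E.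
Proof.
move=> M0 lip mA mB Bphi.
have mE : measurable (`[a, b] `&` phi @^-1` A).
  exact: (lip_on_measurable _ _ _ _ M0 lip).
set E := _ `&` _ in mE *.
have Efin : (lam E < +oo)%E.
  apply: (@le_lt_trans _ _ (lam `[a, b])).
    by apply: le_lam => //; exact: subIsetl.
  by rewrite /= lebesgue_measure_itv /=; case: ifP => // _; rewrite -EFinB ltry.
apply/lee_addgt0Pr => e e0.
(* [M + 1] instead of [M] keeps the denominator positive when [M = 0]. *)
have e'0 : 0 < e / (M + 1) by rewrite divr_gt0// ltr_wpDl.
have [U [oU EU UE]] := lebesgue_regularity_outer mE Efin e'0.
have mU : measurable U := open_measurable oU.
have UE' : (lam U <= lam E + (e / (M + 1))%:E)%E.
  rewrite -(setDUK EU) measureU//; [|exact: measurableD|by rewrite setDIK].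
  by rewrite leeD2l// ltW.
pose J := open_disjoint_itv oU.
pose J' n := J n `&` `[a, b].
have mJ n : measurable (J n) by apply: open_measurable; exact: open_disjoint_itv_open.
have Jfin n : (lam (J n) < +oo)%E.
  apply: (@le_lt_trans _ _ (lam U)).
    apply: le_lam => //.
    by move=> x Jx; rewrite (open_disjoint_itv_bigcup oU); exists n.
  by rewrite (le_lt_trans UE')// lte_add_pinfty// ltry.
have JE n s t : J n s -> J n t -> s <= t -> t - s <= fine (lam (J n)).
  move=> Js Jt st; rewrite -lee_fin fineK ?ge0_fin_numE//.
  apply: (@le_trans _ _ (lam `[s, t])).
    rewrite lebesgue_measure_itv/= lte_fin; case: ltP => //.
    by move=> ts; rewrite lee_fin subr_le0.
  apply: le_lam => // x /=; rewrite in_itv/= => /andP[sx xt].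
  apply: (open_disjoint_itv_is_interval Js Jt).
  by rewrite sx.
pose K n := `[inf (phi @` J' n), sup (phi @` J' n)]%classic.
have cover : B `&` A `<=` \bigcup_n K n.
  move=> y [/Bphi[t tab <-] Aphi].
  have : U t by apply: EU.
  rewrite {1}(open_disjoint_itv_bigcup oU) => -[n _ Jnt]; exists n => //.
  have J't : J' n t by [].
  have [ub lb] : has_ubound (phi @` J' n) /\ has_lbound (phi @` J' n).
    have bnd s : J' n s -> `|phi s - phi t| <= M * `|b - a|.
      move=> [_ sab]; apply: (le_trans (lip _ _ sab tab)); rewrite ler_wpM2l//.
      move: sab tab; rewrite /= !in_itv/= => /andP[as_ sb] /andP[at_ tb].
      by rewrite ler_norml ger0_norm; lra.
    by split; [exists (phi t + M * `|b - a|)|exists (phi t - M * `|b - a|)];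
      move=> _ [s Js <-]; have := bnd s Js; rewrite ler_norml; lra.
  by rewrite /K /= in_itv/= ge_inf ?ub_le_sup//; exists t.
have KM n : (lam (K n) <= M%:E * lam (J n))%E.
  rewrite /K lebesgue_measure_itv/= lte_fin; case: ltP => [infsup|_]; last first.
    by rewrite mule_ge0// lee_fin.
  have J'0 : (phi @` J' n) !=set0.
    apply/set0P/eqP => J'0; move: infsup; rewrite J'0.
    by rewrite sup0 inf0 ltxx.
  rewrite -(fineK (_ : lam (J n) \is a fin_num)) ?ge0_fin_numE// -EFinM lee_fin.
  rewrite lerBlDr; apply: ge_sup => // _ [s [Js sab] <-].
  rewrite -lerBlDl; apply: lb_le_inf => // _ [t [Jt tab] <-].
  rewrite lerBlDl -lerBlDr.
  apply: (le_trans (ler_norm _)); apply: (le_trans (lip _ _ sab tab)).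
  rewrite ler_wpM2l//; have [st|/ltW ts] := leP s t.
    by rewrite ler0_norm ?subr_le0// opprB; exact: JE.
  by rewrite ger0_norm ?subr_ge0//; exact: JE.
have mK n : measurable (K n) by exact: measurable_itv.
apply: (@le_trans _ _ (\sum_(n <oo) lam (K n))%E).
  apply: measure_sigma_subadditive => //; exact: measurableI.
apply: (@le_trans _ _ (\sum_(n <oo) (M%:E * lam (J n)))%E).
  by apply: lee_nneseries.
rewrite nneseriesZl//.
have -> : (\sum_(n <oo) lam (J n) = lam U)%E.
  rewrite [in RHS](open_disjoint_itv_bigcup oU).
  rewrite measure_bigcup; [|by move=> i _; exact: mJ|exact: open_disjoint_itv_trivIset].
  by apply: eq_eseriesl => n; rewrite in_setT.
have UM : (M%:E * lam U <= M%:E * (lam E + (e / (M + 1))%:E))%E.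
  by rewrite lee_wpmul2l// lee_fin.
apply: (le_trans UM).
rewrite muleDr//; last by rewrite ge0_adde_def ?inE// lee_fin ltW.
rewrite leeD2l// -EFinM lee_fin mulrCA ger_pMr//.
by rewrite ler_pdivrMr ?ltr_wpDl// mul1r lerDl.
Qed.

Lemma le_integral_lip phi a b M B (F : R -> \bar R) : 0 <= M ->
  lip_on phi a b M -> measurable B -> B `<=` phi @` `[a, b] ->
  (forall x, (0 <= F x)%E) -> measurable_fun setT F ->
  (\int[lam]_(x in B) F x <= M%:E * \int[lam]_(x in `[a, b]) F (phi x))%E.
Proof.
move=> M0 lip mB Bphi F0 mF.
have := @le_integral_superposition _ _ _ _ _ _ R lam lam _ [:: tt] (fun=> 1) M B `[a, b]
  (fun _ x => x) phi F.
rewrite !big_seq1 mul1e; apply => //.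
  exact: (lip_on_measurable _ _ _ _ M0 lip).
move=> A mA; rewrite big_seq1 mul1e; exact: lip_image_le.
Qed.

End LipschitzSubstitution.

(** * Integrals along a Lipschitz curve cut into countably many pieces *)

Section CurveIntegralBound.
Context {R : realType} {X : completeMetricType R}.
Notation lam := (@lebesgue_measure R).
Notation borel := (g_sigma_algebraType (@open X)).

Lemma mdist_pseudodist : pseudodist (@mdist R X).
Proof.
split; [exact: mdistxx|exact: metric_sym|].
by move=> x y z; exact: metric_triangle.
Qed.

Lemma lipschitz_on_borel (gamma : R -> X) (a b M : R) : 0 <= M ->
  (forall s t, s \in `[a, b] -> t \in `[a, b] ->
    mdist (gamma s) (gamma t) <= M * `|s - t|) ->
  measurable_fun `[a, b] (gamma : R -> borel).
Proof.
move=> M0 lip; apply: measurability; first by [].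
move=> _ [U oU <-]; apply: open_measurable_subspace => //.
have : {within `[a, b], continuous gamma}.
  apply/subspace_continuousP => t /= tab.
  apply/metricType_numDomainType.cvgrPdist_lt => e e0.
  have : \forall s \near nbhs t, `|t - s| < e / (M + 1).
    by apply: (@cvgr_dist_lt _ R^o); [exact: cvg_id|rewrite divr_gt0// ltr_wpDl].
  apply: filterS => s; rewrite ltr_pdivlMr ?ltr_wpDl// => tse sab.
  apply: le_lt_trans tse; apply: (le_trans (lip _ _ tab sab)).
  by rewrite mulrDr mulr1 mulrC lerDl.
by move/continuousP => /(_ _ oU).
Qed.

Lemma lipschitz_on_norm (gamma : R -> X) (a b : R) :
  lipschitz_on mdist gamma a b -> forall s t, s \in `[a, b] -> t \in `[a, b] ->
  mdist (gamma s) (gamma t) <= `|s - t|.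
Proof.
move=> lip s t; rewrite !in_itv/= => /andP[as_ sb] /andP[at_ tb].
have [st|/ltW ts] := leP s t; first by rewrite ler0_norm ?subr_le0// opprB lip.
by rewrite metric_sym ger0_norm ?subr_ge0// lip.
Qed.

(** The length function [ell] of a 1-Lipschitz curve is 1-Lipschitz, so [ell \o phi i] is
    [M i]-Lipschitz and [le_integral_lip] transports the integral over its image to [[0, 1]]. There
    are two families because the curve to come has two branches. *)
Lemma curve_integral_le (g : X -> \bar R) (gamma : R -> X) (a b : R)
    (phi psi : nat -> R -> R) (M : nat -> R) :
  (forall x, (0 <= g x)%E) -> measurable_fun setT (g : borel -> \bar R) ->
  a <= b -> lipschitz_on mdist gamma a b ->
  (forall i, 0 <= M i) ->
  (forall i, lip_on (phi i) 0 1 (M i)) -> (forall i, lip_on (psi i) 0 1 (M i)) ->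
  (forall i t, t \in `[0, 1] -> phi i t \in `[a, b]) ->
  (forall i t, t \in `[0, 1] -> psi i t \in `[a, b]) ->
  (forall t, t \in `]a, b[ ->
    exists i, (phi i @` `[0, 1]) t \/ (psi i @` `[0, 1]) t) ->
  (curve_integral mdist g gamma a b <=
   \sum_(i <oo) (M i)%:E *
     (\int[lam]_(t in `[0%R, 1%R]) g (gamma (phi i t)) +
      \int[lam]_(t in `[0%R, 1%R]) g (gamma (psi i t))))%E.
Proof.
move=> g0 mg ab lip M0 lphi lpsi phiab psiab cover.
have dP := mdist_pseudodist.
have rect := lipschitz_on_rectifiable mdist gamma dP a b ab lip.
rewrite /curve_integral; set L := fine _.
pose ell t := fine (curve_length mdist gamma a t).
have finV s t : a <= s -> s <= t -> t <= b ->
    curve_length mdist gamma s t \is a fin_num.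
  exact: (curve_length_sub_fin mdist gamma dP a b rect).
have ellD s t : a <= s -> s <= t -> t <= b -> 0 <= ell t - ell s <= t - s.
  move=> as_ st tb; rewrite /ell (curve_length_add mdist gamma dP a s t)//.
  rewrite fineD ?finV// ?(le_trans st)// addrAC subrr add0r.
  rewrite fine_ge0 ?(curve_length_ge0 _ _ dP)//=.
  rewrite -lee_fin fineK ?finV//.
  apply: curve_length_lipschitz => // x y sx xy yt.
  by rewrite lip// ?(le_trans as_)// (le_trans yt).
have ell_lip s t : s \in `[a, b] -> t \in `[a, b] -> `|ell s - ell t| <= `|s - t|.
  rewrite !in_itv/= => /andP[as_ sb] /andP[at_ tb].
  have [st|/ltW ts] := leP s t.
    have /andP[h1 h2] := ellD _ _ as_ st tb.
    by rewrite distrC (distrC s) !ger0_norm ?subr_ge0// -subr_ge0.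
  have /andP[h1 h2] := ellD _ _ at_ ts sb.
  by rewrite !ger0_norm ?subr_ge0// -subr_ge0.
have ellphi_lip chi i : (forall i, lip_on (chi i) 0 1 (M i)) ->
    (forall i t, t \in `[0, 1] -> chi i t \in `[a, b]) ->
    lip_on (ell \o chi i) 0 1 (M i).
  move=> lchi chiab s t s01 t01 /=; apply: le_trans (lchi i s t s01 t01).
  by apply: ell_lip; exact: chiab.
pose A (chi : nat -> R -> R) i := (ell \o chi i) @` `[0, 1].
have mA i : measurable (A phi i).
  by apply: lip_image_measurable (M0 i) (ellphi_lip _ _ _ _).
have mB i : measurable (A psi i).
  by apply: lip_image_measurable (M0 i) (ellphi_lip _ _ _ _).
have L0 : 0 <= L by rewrite fine_ge0// (curve_length_ge0 _ _ dP).
have ell0 t : t \in `[a, b] -> ell t \in `[0, L].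
  rewrite !in_itv/= => /andP[at_ tb].
  have /andP[h1 _] := ellD _ _ (lexx a) at_ tb.
  have /andP[h2 _] := ellD _ _ at_ tb (lexx b).
  rewrite -[L]/(ell b); move: h1; rewrite {2}/ell curve_lengthxx// subr0.
  by move: h2; rewrite subr_ge0 => -> ->.
pose gt := arclength_param mdist gamma a b.
pose F := (g \o gt) \_ `[0, L].
have F0 x : (0 <= F x)%E by rewrite /F/patch; case: ifP => // _; exact: g0.
have FA0 (B : set R) x : (0 <= (F \_ B) x)%E by rewrite /patch; case: ifP.
have mF : measurable_fun setT F.
  apply/(measurable_restrictT _ _).1 => //.
  apply: (measurableT_comp mg); apply: (lipschitz_on_borel _ _ _ 1) => // s t sL tL.
  rewrite mul1r; apply: lipschitz_on_norm sL tL.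
  exact: arclength_param_lipschitz.
(* Dropping the endpoints is harmless for the integral and ensures that the time of arclength [s] is
   interior, which is all that [cover] handles: the pieces accumulate at the ends. *)
have -> : (\int[lam]_(s in `[0%R, L]) g (gt s) = \int[lam]_(s in `]0%R, L[) F s)%E.
  rewrite -(@integral_itv_bndoo _ _ _ _ true false); last exact: measurable_funTS.
  by apply: eq_integral => s sL; rewrite /F/patch sL.
apply: (@le_trans _ _ (\int[lam]_s (\sum_(i <oo)
    ((F \_ (A phi i)) s + (F \_ (A psi i)) s)))%E).
  rewrite [leLHS]integral_mkcond; apply: ge0_le_integral_nomeas => s _.
    by rewrite /patch; case: ifP.
  have S0 n : (0 <= (F \_ (A phi n)) s + (F \_ (A psi n)) s)%E by rewrite adde_ge0.
  rewrite {1}/patch; case: ifPn => [/set_mem /= sL|_]; last exact: nneseries_ge0.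
  have [t [tab tE _]] : exists t, [/\ t \in `[a, b],
      curve_length mdist gamma a t = s%:E & gt s = gamma t].
    move: sL; rewrite in_itv/= => /andP[s0 sL].
    exact: (arclength_paramP mdist gamma dP a b rect s (ltW s0) (ltW sL)).
  have tab' : t \in `]a, b[.
    move: sL tab; rewrite !in_itv/= => /andP[s0 sL] /andP[at_ tb].
    rewrite !lt_neqAle at_ tb !andbT; apply/andP; split; apply/eqP => E.
      by move: tE s0; rewrite -E curve_lengthxx// => -[<-]; rewrite ltxx.
    by move: sL; rewrite /L -E tE /= ltxx.
  have [i it] := cover t tab'.
  rewrite (nneseriesD1 (n := i))//.
  apply: (@le_trans _ _ ((F \_ (A phi i)) s + (F \_ (A psi i)) s)%E); last first.
    by rewrite leeDl// nneseries_ge0.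
  have FA chi : (chi i @` `[0, 1]) t -> (F s <= (F \_ (A chi i)) s)%E.
    move=> [u u01 ut]; rewrite [leRHS]/patch mem_set//; exists u => //=.
    by rewrite ut /ell tE.
  case: it => /FA h; apply: (le_trans h); first by rewrite leeDl.
  by rewrite leeDr.
rewrite integral_nneseries//; last 2 first.
- move=> n; apply: emeasurable_funD.
    exact: (measurable_restrictT F (mA n)).1 (measurable_funTS mF).
  exact: (measurable_restrictT F (mB n)).1 (measurable_funTS mF).
- by move=> n x _; rewrite adde_ge0.
have key chi i : (forall i, lip_on (chi i) 0 1 (M i)) ->
    (forall i t, t \in `[0, 1] -> chi i t \in `[a, b]) -> measurable (A chi i) ->
    (\int[lam]_x (F \_ (A chi i)) x <=
     (M i)%:E * \int[lam]_(t in `[0%R, 1%R]) g (gamma (chi i t)))%E.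
  move=> lchi chiab mAi; rewrite -integral_mkcond.
  apply: (@le_trans _ _ ((M i)%:E * \int[lam]_(t in `[0%R, 1%R]) F ((ell \o chi i) t))%E).
    by apply: le_integral_lip => //; exact: ellphi_lip.
  rewrite lee_wpmul2l ?lee_fin//; apply: ge0_le_integral_nomeas => // t /= t01.
  have tab := chiab i t t01.
  rewrite /F/patch mem_set; last exact: ell0.
  by rewrite /= /gt/ell arclength_param_length//; exact: mdist_positivity.
apply: lee_nneseries => [i _ _|i _].
  by apply: integral_ge0 => x _; rewrite adde_ge0.
rewrite ge0_integralD//; last 2 first.
- exact: (measurable_restrictT F (mA i)).1 (measurable_funTS mF).
- exact: (measurable_restrictT F (mB i)).1 (measurable_funTS mF).
rewrite ge0_muleDr; [|exact: integral_ge0..].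
by apply: leeD; exact: key.
Qed.

End CurveIntegralBound.

(** * The graph distance and the uniformized distance *)

Section Graph.
Context {R : realType} {alpha tau : R} {Z : completeMetricType R}.
Context (S : filling alpha tau Z).
Hypothesis alpha_gt1 : 1 < alpha.
Hypothesis tau_gt3 : 3 < tau.

Let alpha_gt0 : 0 < alpha. Proof. exact: lt_trans alpha_gt1. Qed.
Let alpha_neq0 : alpha != 0. Proof. by rewrite gt_eqF. Qed.

Lemma scale_gt0 (n : int) : 0 < alpha ^ n. Proof. exact: exprz_gt0. Qed.

Lemma scale_le (m n : int) : (m <= n)%R -> alpha ^ m <= alpha ^ n.
Proof. by move=> mn; rewrite ler_weXz2l// ltW. Qed.

Lemma scale_lt (m n : int) : (m < n)%R -> alpha ^ m < alpha ^ n.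
Proof. by move=> mn; rewrite ltr_eXz2l. Qed.

Lemma scaleD (m n : int) : alpha ^ (m + n) = alpha ^ m * alpha ^ n.
Proof. by rewrite expfzDr. Qed.

Lemma powR_int (n : int) : alpha `^ (n%:~R) = alpha ^ n.
Proof. by rewrite powR_intmul// ltW. Qed.

Lemma powR_add (r s : R) : alpha `^ (r + s) = alpha `^ r * alpha `^ s.
Proof. by rewrite powRD// alpha_neq0 implybT. Qed.

(** By Bernoulli's inequality. *)
Lemma scale_unbounded (r : R) : exists k : nat, r < alpha ^ k%:Z.
Proof.
have bern k : 1 + k%:R * (alpha - 1) <= alpha ^+ k.
  elim: k => [|k IH]; first by rewrite mul0r addr0.
  have a1 : 0 <= alpha - 1 by rewrite subr_ge0 ltW.
  have k0 : (0 : R) <= k%:R by [].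
  rewrite exprS; apply: (le_trans _ (ler_wpM2l (ltW alpha_gt0) IH)).
  by rewrite -natr1; have := mulr_ge0 k0 (mulr_ge0 a1 a1); lra.
have a1 : 0 < alpha - 1 by rewrite subr_gt0.
exists (Num.truncn (`|r| / (alpha - 1))).+1.
apply: (lt_le_trans _ (bern _)).
have := truncnS_gt (`|r| / (alpha - 1)).
rewrite ltr_pdivrMr// => h; apply: (le_lt_trans (ler_norm r)).
by apply: (lt_trans h); rewrite ltrDr.
Qed.

(** Otherwise [z] could be added to the net, against maximality. *)
Lemma net_near (n : int) (z : Z) :
  exists2 u, net S n u & mdist u z < alpha ^ (- n).
Proof.
have [sep max] := net_maximal S n; apply: contrapT => H.
have far u : net S n u -> alpha ^ (- n) <= mdist u z.
  by move=> Su; rewrite leNgt; apply/negP => uz; apply: H; exists u.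
have E : net S n `|` [set z] = net S n.
  apply: max; first exact: subsetUl.
  move=> x y [Sx|->] [Sy|->] xy //; [exact: sep|exact: far|].
  by rewrite metric_sym; exact: far.
have /far : net S n z by rewrite -E; right.
by rewrite mdistxx leNgt scale_gt0.
Qed.

Definition anchor (n : int) (z : Z) : Z := xget z [set u | net S n u /\
  mdist u z < alpha ^ (- n)].

Lemma anchorP n z : net S n (anchor n z) /\
  mdist (anchor n z) z < alpha ^ (- n).
Proof.
apply: (@xgetPex _ z [set u | net S n u /\ mdist u z < alpha ^ (- n)]).
by have [u ? ?] := net_near n z; exists u.
Qed.

Lemma adjacentC (v w : Z * int) : adjacent S v w -> adjacent S w v.
Proof. by case=> Sv Sw vw hvw B; split => //; [exact: nesym|rewrite distrC|rewrite setIC]. Qed.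

(** Since [3 < tau], the point [z] lies in both vertex balls. The factor 3 leaves room for vertices
    that are only approximately nearest to [z]. *)
Lemma adjacent_common (z u u' : Z) (n n' : int) : net S n u -> net S n' u' ->
  (u, n) <> (u', n') -> `|n - n'| <= 1 ->
  mdist u z < 3 * alpha ^ (- n) -> mdist u' z < 3 * alpha ^ (- n') ->
  adjacent S (u, n) (u', n').
Proof.
move=> Su Su' neq nn' uz u'z; split => //; exists z.
by split; rewrite /vertex_ball /= ballEmdist /=;
   [apply: (lt_trans uz)|apply: (lt_trans u'z)]; rewrite ltr_pM2r// scale_gt0.
Qed.

Lemma adjacent_up (z u u' : Z) (n : int) : net S n u -> net S (n + 1) u' ->
  mdist u z < 3 * alpha ^ (- n) -> mdist u' z < 3 * alpha ^ (- (n + 1)) ->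
  adjacent S (u, n) (u', n + 1).
Proof.
move=> Su Su' uz u'z; apply: (adjacent_common z) => //; last first.
  by rewrite opprD addrA subrr add0r.
by case=> _ /eqP; rewrite -subr_eq0 opprD addrA subrr add0r.
Qed.

Lemma adjacent_dist (v w : Z * int) : adjacent S v w ->
  mdist v.1 w.1 <= tau * (1 + alpha) * alpha ^ (- v.2).
Proof.
case=> _ _ _ hvw [z []]; rewrite /vertex_ball !ballEmdist /= => vz wz.
apply: (le_trans (metric_triangle _ z _)); rewrite (metric_sym z).
apply: (le_trans (lerD (ltW vz) (ltW wz))).
rewrite mulrDr mulr1 mulrDl lerD2l -mulrA ler_wpM2l//.
  by rewrite ltW// (lt_trans _ tau_gt3).
rewrite -{2}(expr1z alpha) -scaleD scale_le//; lia.
Qed.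

Lemma graph_eq (x y : graph S) : coord x = coord y -> x = y.
Proof.
case: x y => [x Px] [y Py] /= xy; subst y; congr Point; exact: Prop_irrelevance.
Qed.

Lemma vertexE v : is_vertex S v -> coord (vertex S v) = bary v v 0.
Proof.
move=> Sv; have xP : is_point S (bary v v 0) by left; exists v.
have : exists x : graph S, coord x = bary v v 0 by exists (Point xP).
exact: xgetPex.
Qed.

Lemma edge0 v w : adjacent S v w -> edge S v w 0 = vertex S v.
Proof.
move=> vw; have [Sv _ _ _ _] := vw; apply: graph_eq.
rewrite vertexE// edgeE ?in_itv/= ?lexx ?ler01//.
by apply/funext => u; rewrite /bary !mul0r.
Qed.

Lemma edge1 v w : adjacent S v w -> edge S v w 1 = vertex S w.
Proof.
move=> vw; have [_ Sw _ _ _] := vw; apply: graph_eq.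
rewrite vertexE// edgeE ?in_itv/= ?lexx ?ler01//.
by apply/funext => u; rewrite /bary subrr subr0 !mul0r !mul1r add0r addr0.
Qed.

Lemma vertex_adjacent v : is_vertex S v -> exists w, adjacent S v w.
Proof.
case: v => u n Sv; have [Su uz] := anchorP (n + 1) u.
exists (anchor (n + 1) u, n + 1).
apply: (adjacent_up u) => //; first by rewrite mdistxx mulr_gt0// scale_gt0.
by rewrite (lt_trans uz)// ltr_pMl ?scale_gt0//; lra.
Qed.

Lemma graph_pointE (x : graph S) : exists v w t,
  [/\ adjacent S v w, t \in `[0, 1] & x = edge S v w t].
Proof.
case: (coordP x) => [[v Sv xE]|[v [w [t [vw t01 xE]]]]]; last first.
  by exists v, w, t; split => //; apply: graph_eq; rewrite edgeE.
have [w vw] := vertex_adjacent v Sv; exists v, w, 0.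
rewrite in_itv/= lexx ler01; split => //.
by apply: graph_eq; rewrite edge0// vertexE.
Qed.

Section Extension.
Variable phi : Z * int -> R.

(** The extension of a function on the vertices that is affine on every edge. Such functions are the
    test functions in the lower bounds for [dist_rho]. *)
Definition ext (x : graph S) : R :=
  \sum_(v \in [set: Z * int]) coord x v * phi v.

Lemma extE v w t : adjacent S v w -> t \in `[0, 1] ->
  ext (edge S v w t) = (1 - t) * phi v + t * phi w.
Proof.
move=> vw t01; rewrite /ext edgeE//; have [_ _ vDw _ _] := vw.
rewrite -(fsbig_widen [set v; w])//=; last first.
  by move=> u [_ /not_orP[/eqP/negbTE uv /eqP/negbTE uw]] /=;
    rewrite /bary uv uw !mulr0 addr0 mul0r.
rewrite fsbigU//=; last by move=> u [-> /vDw].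
rewrite !fsbig_set1 /bary !eqxx.
have /eqP/negbTE vw0 := vDw; rewrite vw0 eq_sym vw0.
by rewrite !mulr0 !mulr1 addr0 add0r.
Qed.

End Extension.

Lemma height_edge v w t : adjacent S v w -> t \in `[0, 1] ->
  height (edge S v w t) = (1 - t) * v.2%:~R + t * w.2%:~R.
Proof. exact: heightE. Qed.

Lemma rho_gt0 (x : graph S) : 0 < rho x.
Proof. exact: powR_gt0. Qed.

Lemma rho_le_height (x y : graph S) (l : R) : height x - l <= height y ->
  rho y <= rho x * alpha `^ l.
Proof.
move=> h; rewrite /rho -powR_add.
by apply: ler_powR; [exact: ltW|lra].
Qed.

Lemma adjacent_level v w : adjacent S v w ->
  `|v.2%:~R - w.2%:~R : R| <= 1.
Proof. by case=> _ _ _ h _; rewrite -intrB -intr_norm -[1]/(1%:~R) ler_int. Qed.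

Lemma rho_edge_ge v w t : adjacent S v w -> t \in `[0, 1] ->
  alpha ^ (- v.2) <= alpha * rho (edge S v w t).
Proof.
move=> vw t01; rewrite -powR_int -[X in X * _](powRr1 (ltW alpha_gt0)).
rewrite /rho -powR_add ler_powR ?(ltW alpha_gt1)//.
rewrite height_edge// mulrNz.
have := adjacent_level v w vw; rewrite ler_norml => /andP[].
by move: t01; rewrite in_itv/= => /andP[t0 t1]; nra.
Qed.

Lemma rho_edge_le v w t (k : int) : adjacent S v w -> t \in `[0, 1] ->
  k <= v.2 -> k <= w.2 -> rho (edge S v w t) <= alpha ^ (- k).
Proof.
move=> vw t01 kv kw; rewrite -powR_int /rho ler_powR ?(ltW alpha_gt1)//.
rewrite height_edge// mulrNz lerN2.
move: kv kw; rewrite -(ler_int R) -(ler_int R k w.2).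
by move: t01; rewrite in_itv/= => /andP[t0 t1]; nra.
Qed.

Local Notation chain := (@chain R alpha tau Z S).

Lemma chain_trans x y z l l' : chain x y l -> chain y z l' ->
  chain x z (l + l').
Proof.
elim=> [{}x|v w s t {}y {}l vw s01 t01 _ IH] yz; first by rewrite add0r.
by rewrite -addrA; apply: chain_cons => //; exact: IH.
Qed.

Lemma chain_edge v w s t : adjacent S v w -> s \in `[0, 1] -> t \in `[0, 1] ->
  chain (edge S v w s) (edge S v w t) `|s - t|.
Proof.
by move=> *; rewrite -[X in chain _ _ X]addr0; apply: chain_cons => //; exact: chain_nil.
Qed.

Lemma chain_sym x y l : chain x y l -> chain y x l.
Proof.
elim=> [{}x|v w s t {}y {}l vw s01 t01 _ IH]; first exact: chain_nil.
rewrite addrC; apply: chain_trans IH _; rewrite distrC; exact: chain_edge.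
Qed.

Lemma chain_height x y l : chain x y l -> `|height x - height y| <= l.
Proof.
elim=> [{}x|v w s t {}y {}l vw s01 t01 _ IH]; first by rewrite subrr normr0.
rewrite -(subrKA (height (edge S v w t))) (le_trans (ler_normD _ _))// lerD//.
rewrite !height_edge//.
have -> : (1 - s) * v.2%:~R + s * w.2%:~R - ((1 - t) * v.2%:~R + t * w.2%:~R)
  = (s - t) * (w.2%:~R - v.2%:~R) :> R by ring.
by rewrite normrM ler_piMr// distrC; exact: adjacent_level.
Qed.

(** On one edge, [phi] varies at rate [K * alpha ^ (- v.2)], at most [K * alpha * rho]. Along a
    chain of length [l] the height drops by at most [l], so [rho] grows at most by the factor
    [alpha ^ l]. *)
Lemma chain_ext phi (K : R) x y l : 0 <= K ->
  (forall v w, adjacent S v w -> `|phi v - phi w| <= K * alpha ^ (- v.2)) ->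
  chain x y l ->
  `|ext phi x - ext phi y| <= K * alpha * rho x * alpha `^ l * l.
Proof.
move=> K0 phiK; elim=> [{}x|v w s t {}y {}l vw s01 t01 xyl IH].
  by rewrite subrr normr0 mulr0.
rewrite -(subrKA (ext phi (edge S v w t))) (le_trans (ler_normD _ _))//.
set p := edge S v w s; set q' := edge S v w t.
have l0 := chain_ge0 xyl.
have C1 : `|ext phi p - ext phi q'| <= K * alpha * rho p * `|s - t|.
  rewrite !extE//.
  have -> : (1 - s) * phi v + s * phi w - ((1 - t) * phi v + t * phi w)
    = (s - t) * (phi w - phi v) by ring.
  rewrite normrM mulrC ler_wpM2r// distrC (le_trans (phiK _ _ vw))//.
  by rewrite -mulrA ler_wpM2l//; exact: rho_edge_ge.
have a1 r : 0 <= r -> 1 <= alpha `^ r.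
  by move=> r0; rewrite -[leLHS](powRr0 alpha) ler_powR// ltW.
have rp' : rho q' <= rho p * alpha `^ `|s - t|.
  apply: rho_le_height; have := chain_height _ _ _ (chain_edge _ _ _ _ vw s01 t01).
  by rewrite -/p -/q' ler_norml; lra.
set B := K * alpha * rho p.
have B0 : 0 <= B by rewrite !mulr_ge0// ltW// rho_gt0.
have C2 : K * alpha * rho q' * alpha `^ l * l <= B * alpha `^ (`|s - t| + l) * l.
  rewrite ler_wpM2r// powR_add mulrA ler_wpM2r ?powR_ge0//.
  by rewrite /B -[leRHS]mulrA ler_wpM2l// mulr_ge0// ltW.
rewrite mulrDr; apply: lerD; last exact: le_trans IH C2.
apply: (le_trans C1); rewrite -/B ler_wpM2r// ler_peMr// a1// addr_ge0//.
Qed.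

Lemma chain_vertex v w : adjacent S v w -> chain (vertex S v) (vertex S w) 1.
Proof.
move=> vw; rewrite -(edge0 _ _ vw) -(edge1 _ _ vw).
have := chain_edge _ _ 0 1 vw; rewrite sub0r normrN1.
by apply; rewrite in_itv/= ?lexx ler01.
Qed.

Lemma chain_up z u n (j : nat) : net S n u -> mdist u z < alpha ^ (- n) ->
  exists w l, [/\ net S (n - j%:Z) w, mdist w z < alpha ^ (- (n - j%:Z)) &
    chain (vertex S (u, n)) (vertex S (w, n - j%:Z)) l].
Proof.
have sm (m : int) r : r < alpha ^ m -> r < 3 * alpha ^ m.
  by move=> rm; rewrite (lt_trans rm)// ltr_pMl ?scale_gt0//; lra.
move=> Su uz; elim: j => [|j [w [l [Sw wz c]]]].
  by rewrite subr0; exists u, 0; split => //; exact: chain_nil.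
have [Sw' w'z] := anchorP (n - j.+1%:Z) z.
exists (anchor (n - j.+1%:Z) z), (l + 1); split => //.
apply: chain_trans c _; apply/chain_vertex/adjacentC.
have E : n - j%:Z = n - j.+1%:Z + 1 by lia.
rewrite E in Sw wz *; apply: (adjacent_up z) => //; exact: sm.
Qed.

(** Both vertices are led to a coarse level [m] at which [mdist u u' < alpha ^ (- m)]; the vertices
    reached there coincide or have [u] in both balls. *)
Lemma chain_exists_vertex v w : is_vertex S v -> is_vertex S w ->
  exists l, chain (vertex S v) (vertex S w) l.
Proof.
case: v w => [u n] [u' n'] Su Su'.
have [m [mn mn' dm]] : exists m : int, [/\ m <= n, m <= n' & mdist u u' < alpha ^ (- m)].
  have [k kd] := scale_unbounded (mdist u u').
  exists (Num.min (- k%:Z) (Num.min n n')); split.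
  - by rewrite !ge_min lexx !orbT.
  - by rewrite !ge_min lexx !orbT.
  - apply: (lt_le_trans kd); rewrite scale_le//.
    by rewrite lerNr ge_min lexx.
have e1 : n - `|n - m|%N%:Z = m by lia.
have e2 : n' - `|n' - m|%N%:Z = m by lia.
have [] := chain_up u u n `|n - m|%N Su; first by rewrite mdistxx scale_gt0.
move=> w [l []]; rewrite e1 => Sw wu c.
have [] := chain_up u' u' n' `|n' - m|%N Su'; first by rewrite mdistxx scale_gt0.
move=> w' [l' []]; rewrite e2 => Sw' w'u' c'.
have [ww'|ww'] := pselect (w = w').
  by exists (l + l'); apply: chain_trans c _; apply: chain_sym; rewrite ww'.
exists (l + (1 + l')); apply: chain_trans c _.
apply: chain_trans (chain_sym _ _ _ c').
apply: chain_vertex; apply: (adjacent_common u) => //.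
- by case.
- by rewrite subrr normr0.
- by rewrite (lt_trans wu)// ltr_pMl ?scale_gt0//; lra.
- apply: (le_lt_trans (metric_triangle _ u' _)); rewrite (metric_sym u').
  by apply: (lt_trans (ltrD w'u' dm)); have := scale_gt0 (- m); lra.
Qed.

Lemma chain_exists x y : exists l, chain x y l.
Proof.
have toV z : exists v l, is_vertex S v /\ chain z (vertex S v) l.
  have [v [w [t [vw t01 ->]]]] := graph_pointE z.
  exists v, `|t - 0|; split; first by case: vw.
  by rewrite -(edge0 _ _ vw); apply: chain_edge => //; rewrite in_itv/= lexx ler01.
have [v [l [Sv c]]] := toV x; have [w [l' [Sw c']]] := toV y.
have [l'' c''] := chain_exists_vertex v w Sv Sw.
by exists (l + (l'' + l')); apply: chain_trans c (chain_trans _ _ _ _ _ c'' (chain_sym _ _ _ c')).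
Qed.

Lemma graph_dist_le x y l : chain x y l -> graph_dist x y <= l.
Proof. by move=> c; apply: ge_inf => //; exists 0 => r; exact: chain_ge0. Qed.

Lemma graph_dist_adherent (x y : graph S) e : 0 < e ->
  exists2 l, chain x y l & l < graph_dist x y + e.
Proof.
move=> e0; have [l c] := chain_exists x y.
have hi : has_inf [set l | chain x y l].
  by split; [exists l|exists 0 => r; exact: chain_ge0].
by have [r cr rl] := inf_adherent e0 hi; exists r.
Qed.

(** Connectedness is essential: an infimum over an empty set of chains would be 0, which would break
    the triangle inequality. *)
Lemma graph_dist_pseudodist : pseudodist (@graph_dist R alpha tau Z S).
Proof.
have ge0 (x y : graph S) : 0 <= graph_dist x y.
  have [l c] := chain_exists x y.
  by apply: lb_le_inf; [exists l|move=> r; exact: chain_ge0].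
split.
- by move=> x; apply/eqP; rewrite eq_le ge0 andbT; apply/graph_dist_le/chain_nil.
- have sym (x y : graph S) : graph_dist x y <= graph_dist y x.
    apply/ler_addgt0Pr => e e0; have [l c /ltW le] := graph_dist_adherent y x e e0.
    by apply: le_trans le; apply/graph_dist_le/chain_sym.
  by move=> x y; apply/eqP; rewrite eq_le !sym.
- move=> x y z; apply/ler_addgt0Pr => e e0.
  have e20 : 0 < e / 2 by rewrite divr_gt0.
  have [l c le] := graph_dist_adherent x y _ e20.
  have [l' c' le'] := graph_dist_adherent y z _ e20.
  by have := graph_dist_le _ _ _ (chain_trans _ _ _ _ _ c c'); lra.
Qed.

Lemma graph_dist_height (x y : graph S) : `|height x - height y| <= graph_dist x y.
Proof.
apply/ler_addgt0Pr => e e0; have [l c /ltW le] := graph_dist_adherent x y e e0.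
exact: le_trans (chain_height _ _ _ c) le.
Qed.

(** At distance below 1 a nearly shortest chain has length [l <= 1], so the factor [alpha ^ l] of
    [chain_ext] is at most [alpha]. *)
Lemma graph_dist_ext phi (K : R) (x y : graph S) : 0 <= K ->
  (forall v w, adjacent S v w -> `|phi v - phi w| <= K * alpha ^ (- v.2)) ->
  graph_dist x y < 1 ->
  `|ext phi x - ext phi y| <= K * alpha ^+ 2 * rho x * graph_dist x y.
Proof.
move=> K0 phiK xy1; set B := K * alpha ^+ 2 * rho x.
have B0 : 0 <= B by rewrite !mulr_ge0// ?exprn_ge0 ?ltW// rho_gt0.
apply/ler_addgt0Pr => e e0.
(* The first entry of the minimum keeps the chain no longer than 1, the second absorbs the error
   multiplied by [B]. *)
have e'0 : 0 < Num.min (1 - graph_dist x y) (e / (B + 1)).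
  by rewrite lt_min subr_gt0 xy1 divr_gt0// ltr_wpDl.
have [l c le] := graph_dist_adherent x y _ e'0.
have l1 : l <= 1.
  apply/ltW/(lt_le_trans le); rewrite -lerBrDl.
  by rewrite ge_min lexx.
have l0 := chain_ge0 c.
apply: (le_trans (chain_ext _ _ _ _ _ K0 phiK c)).
apply: (@le_trans _ _ (B * l)).
  rewrite ler_wpM2r// /B expr2 mulrA -[leRHS]mulrA [alpha * rho x]mulrC mulrA.
  rewrite ler_wpM2l// ?mulr_ge0 ?(ltW alpha_gt0)// ?(ltW (rho_gt0 x))//.
  by rewrite -[leRHS](powRr1 (ltW alpha_gt0)) ler_powR// ltW.
have : l <= graph_dist x y + e / (B + 1).
  by apply: (le_trans (ltW le)); rewrite lerD2l ge_min lexx orbT.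
move/(ler_wpM2l B0)/le_trans; apply; rewrite mulrDr lerD2l mulrCA ger_pMr//.
by rewrite ler_pdivrMr ?ltr_wpDl// mul1r lerDl.
Qed.

End Graph.

Section Gluing.
Context {R : realType} {T : Type} (d : T -> T -> R).

Lemma lipschitz_on_glue (g1 g2 : R -> T) (a b c : R) : pseudodist d ->
  lipschitz_on d g1 a b -> lipschitz_on d g2 b c -> g1 b = g2 b ->
  lipschitz_on d (fun t => if t <= b then g1 t else g2 t) a c.
Proof.
move=> [_ _ dt] l1 l2 E s t as_ st tc.
have [tb|bt] := leP t b; first by rewrite (le_trans st tb) l1.
have [sb|bs] := leP s b; last by rewrite l2// ltW.
apply: (le_trans (dt _ (g1 b) _)).
have h1 := l1 s b as_ sb (lexx b).
have := l2 b t (lexx b) (ltW bt) tc; rewrite -E; lra.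
Qed.

Lemma lipschitz_on_shift (g : R -> T) (a b c : R) : lipschitz_on d g a b ->
  lipschitz_on d (fun t => g (t - c)) (a + c) (b + c).
Proof.
move=> l s t as_ st tc.
have -> : t - s = (t - c) - (s - c) by ring.
by apply: l; lra.
Qed.

End Gluing.

(** * Bounds for the uniformized distance by curves and by test functions *)

Section GraphDistance.
Context {R : realType} {alpha tau : R} {Z : completeMetricType R}.
Context (S : filling alpha tau Z).
Hypothesis alpha_gt1 : 1 < alpha.
Hypothesis tau_gt3 : 3 < tau.

Let alpha_gt0 : 0 < alpha. Proof. exact: lt_trans alpha_gt1. Qed.
Notation gd := (@graph_dist R alpha tau Z S).
Notation lam := (@lebesgue_measure R).

Let gdP : pseudodist gd. Proof. exact: graph_dist_pseudodist. Qed.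

(** Any two points are thus joined by a rectifiable curve. This matters for lower bounds: if the
    infimum in [dist_rho] were infinite, [fine] would turn it into 0. *)
Lemma chain_curve (x y : graph S) l : chain x y l -> exists gamma,
  [/\ lipschitz_on gd gamma 0 l, gamma 0 = x & gamma l = y].
Proof.
have [gd0 _ _] := gdP.
elim=> [{}x|v w s t {}y {}l vw s01 t01 c [gamma [lip g0 gl]]].
  by exists (fun=> x); split => // s t; rewrite gd0; lra.
pose sg : R := if s <= t then 1 else -1.
have sgE : s + sg * `|s - t| = t.
  rewrite /sg; case: leP => st; first by rewrite ler0_norm ?subr_le0//; ring.
  by rewrite gtr0_norm ?subr_gt0//; ring.
have st0 : 0 <= `|s - t| by [].
have l0 := chain_ge0 c.
exists (fun u => if u <= `|s - t| then edge S v w (s + sg * u)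
  else gamma (u - `|s - t|)); split.
- apply: lipschitz_on_glue => //.
  + move=> u u' u0 uu' u't.
    have in01 (r : R) : 0 <= r -> r <= `|s - t| -> s + sg * r \in `[0, 1].
      move: s01 t01; rewrite !in_itv/= /sg => /andP[s0 s1] /andP[t0 t1].
      case: (leP s t) => st r0 rst.
        have : r <= t - s by move: rst; rewrite ler0_norm ?subr_le0// opprB.
        lra.
      have : r <= s - t by move: rst; rewrite gtr0_norm ?subr_gt0.
      lra.
    apply: (le_trans (graph_dist_edge vw _ _)); [apply: in01; lra..|].
    have -> : s + sg * u - (s + sg * u') = sg * (u - u') by ring.
    rewrite normrM distrC (ger0_norm (_ : 0 <= u' - u)) ?subr_ge0//.
    by rewrite /sg; case: ifP => _; rewrite ?normrN1 ?normr1 mul1r.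
  + have := lipschitz_on_shift _ _ _ _ `|s - t| lip.
    by rewrite add0r (addrC l).
  + by rewrite sgE subrr g0.
- by rewrite st0 mulr0 addr0.
- case: ifPn => [|_]; last by rewrite addrAC subrr add0r.
  rewrite gerDl => l0'; have E : l = 0 by apply/eqP; rewrite eq_le l0 l0'.
  by rewrite E addr0 sgE -g0 -E gl.
Qed.

Lemma curve_integral_rho_le (gamma : R -> graph S) (a b M : R) : a <= b ->
  0 <= M -> lipschitz_on gd gamma a b ->
  (forall t, t \in `[a, b] -> rho (gamma t) <= M) ->
  (curve_integral gd (EFin \o @rho R alpha tau Z S) gamma a b <= (M * (b - a))%:E)%E.
Proof.
move=> ab M0 lip rhoM; rewrite /curve_integral; set L := fine _.
have rect := lipschitz_on_rectifiable gd gamma gdP a b ab lip.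
have fin := curve_length_sub_fin gd gamma gdP a b rect a b (lexx a) ab (lexx b).
have L0 : L <= b - a.
  by rewrite -lee_fin fineK//; exact: curve_length_lipschitz.
have Lge0 : 0 <= L by rewrite fine_ge0// (curve_length_ge0 _ _ gdP).
apply: (@le_trans _ _ (\int[lam]_(s in `[0%R, L]) M%:E)%E).
  apply: ge0_le_integral_nomeas => s /= sL; first by rewrite lee_fin ltW// rho_gt0.
  rewrite lee_fin; move: sL; rewrite in_itv/= => /andP[s0 sL].
  have [t [tab _ ->]] := arclength_paramP gd gamma gdP a b rect s s0 sL.
  exact: rhoM.
rewrite integral_cst//= lebesgue_measure_itv/= lte_fin.
case: ifPn => [Lp|_]; last by rewrite mule0 lee_fin mulr_ge0// subr_ge0.
by rewrite -EFinD -EFinM lee_fin subr0 ler_wpM2l.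
Qed.

Lemma dist_rho_le (x y : graph S) (gamma : R -> graph S) (a b r : R) :
  rectifiable_curve gd gamma a b -> gamma a = x -> gamma b = y ->
  (curve_integral gd (EFin \o @rho R alpha tau Z S) gamma a b <= r%:E)%E ->
  dist_rho x y <= r.
Proof.
move=> rect gax gby int_le; rewrite /dist_rho; set I := ereal_inf _.
have I0 : (0 <= I)%E.
  apply: le_ereal_inf_tmp => _ [g [a' [b' [_ _ _ ->]]]].
  by apply: integral_ge0 => s _; rewrite lee_fin ltW// rho_gt0.
have : (I <= r%:E)%E.
  by apply: le_trans int_le; apply: ereal_inf_lbound; exists gamma, a, b.
by case: I I0 => //=.
Qed.

Lemma dist_rho_edge_le v w (k : int) s t : adjacent S v w -> k <= v.2 ->
  k <= w.2 -> 0 <= s -> s <= t -> t <= 1 ->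
  dist_rho (edge S v w s) (edge S v w t) <= alpha ^ (- k) * (t - s).
Proof.
move=> vw kv kw s0 st t1.
have lip : lipschitz_on gd (edge S v w) s t.
  move=> x y sx xy yt; apply: (le_trans (graph_dist_edge vw _ _)).
  - by rewrite in_itv/=; lra.
  - by rewrite in_itv/=; lra.
  - by rewrite ler0_norm ?subr_le0// opprB.
apply: (dist_rho_le _ _ (edge S v w) s t) => //.
  exact: lipschitz_on_rectifiable.
apply: curve_integral_rho_le => //; first exact/ltW/scale_gt0.
move=> x xst; apply: rho_edge_le => //.
by move: xst; rewrite !in_itv/=; lra.
Qed.

(** In arclength, the curve is cut into pieces shorter than 1, where [graph_dist_ext] applies with
    the constant [K * alpha ^+ 2]. On such a piece [rho] stays above [rho] at its start divided by
    [alpha], which gives the third power. *)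
Lemma curve_integral_rho_ge phi (K : R) (gamma : R -> graph S) (a b : R) :
  0 <= K ->
  (forall v w, adjacent S v w -> `|phi v - phi w| <= K * alpha ^ (- v.2)) ->
  rectifiable_curve gd gamma a b ->
  (`|ext S phi (gamma a) - ext S phi (gamma b)|%:E <=
   (K * alpha ^+ 3)%:E * curve_integral gd (EFin \o @rho R alpha tau Z S) gamma a b)%E.
Proof.
move=> K0 phiK rect; rewrite /curve_integral; set L := fine _.
have ab : a <= b by case: rect.
set gt := arclength_param gd gamma a b.
have L0 : 0 <= L by rewrite fine_ge0// (curve_length_ge0 _ _ gdP).
have gt_lip : lipschitz_on gd gt 0 L by exact: arclength_param_lipschitz.
have gt_lip' s t : s \in `[0, L] -> t \in `[0, L] -> gd (gt s) (gt t) <= `|s - t|.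
  have [_ gds _] := gdP.
  rewrite !in_itv/= => /andP[s0 sL] /andP[t0 tL].
  have [st|/ltW ts] := leP s t; first by rewrite ler0_norm ?subr_le0// opprB gt_lip.
  by rewrite gds ger0_norm ?subr_ge0// gt_lip.
pose I s := (\int[lam]_(r in `[0%R, s]) (rho (gt r))%:E)%E.
have mrho s : s <= L -> measurable_fun `[0, s] (fun r => (rho (gt r))%:E).
  move=> sL; apply/measurable_EFinP.
  apply: (@measurableT_comp _ _ _ _ _ _ (powR alpha)); first exact: measurable_powRr.
  apply: measurableT_comp => //.
  apply: (lip_on_measurable _ _ _ 1) => // r r' r0 r's; rewrite mul1r.
  apply: le_trans (gt_lip' _ _ _ _); first exact: graph_dist_height.
    by move: r0; rewrite !in_itv/= => /andP[-> h]; rewrite (le_trans h).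
  by move: r's; rewrite !in_itv/= => /andP[-> h]; rewrite (le_trans h).
have rho0 r : (0 <= (rho (gt r))%:E)%E by rewrite lee_fin ltW// rho_gt0.
have ext0 x y : gd x y = 0 -> ext S phi x = ext S phi y.
  move=> xy; have := graph_dist_ext S alpha_gt1 tau_gt3 phi K x y K0 phiK.
  by rewrite xy mulr0 ltr01 normr_le0 subr_eq0 => /(_ isT)/eqP.
have step s t : 0 <= s -> s <= t -> t <= L -> t - s < 1 ->
    (`|ext S phi (gt s) - ext S phi (gt t)|%:E <=
     (K * alpha ^+ 3)%:E * \int[lam]_(r in `]s, t]) (rho (gt r))%:E)%E.
  move=> s0 st tL ts1.
  have dst : gd (gt s) (gt t) <= t - s by exact: gt_lip.
  have C : `|ext S phi (gt s) - ext S phi (gt t)| <=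
      K * alpha ^+ 3 * (rho (gt s) / alpha * (t - s)).
    apply: (le_trans (graph_dist_ext S alpha_gt1 tau_gt3 phi K _ _ K0 phiK _)).
      exact: le_lt_trans ts1.
    have -> : K * alpha ^+ 3 * (rho (gt s) / alpha * (t - s)) =
       K * alpha ^+ 2 * rho (gt s) * (t - s) by field; rewrite gt_eqF.
    by rewrite ler_wpM2l// !mulr_ge0 ?exprn_ge0// ltW// rho_gt0.
  rewrite -lee_fin in C; apply: (le_trans C); rewrite EFinM.
  rewrite lee_wpmul2l ?lee_fin ?mulr_ge0 ?exprn_ge0 ?(ltW alpha_gt0)//.
  apply: (@le_trans _ _ (\int[lam]_(r in `]s, t]) (rho (gt s) / alpha)%:E)%E).
    rewrite integral_cst//= lebesgue_measure_itv/= lte_fin.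
    case: ltP => [_|ts]; first by rewrite -EFinD -EFinM.
    by rewrite mule0 lee_fin mulr_ge0_le0 ?subr_le0// divr_ge0// ltW// rho_gt0.
  apply: ge0_le_integral_nomeas => r /=; rewrite in_itv/= => /andP[sr rt].
    by rewrite lee_fin divr_ge0// ltW// rho_gt0.
  rewrite lee_fin ler_pdivrMr// -[X in _ * X](powRr1 (ltW alpha_gt0)).
  apply: rho_le_height => //.
  have := graph_dist_height S alpha_gt1 tau_gt3 (gt s) (gt r).
  have : gd (gt s) (gt r) <= r - s by apply: gt_lip; lra.
  rewrite ler_norml; lra.
(* Induction on the number of pieces of length at most [1 / 2]. *)
have main n s : 0 <= s -> s <= L -> s <= n%:R / 2 ->
    (`|ext S phi (gt 0) - ext S phi (gt s)|%:E <= (K * alpha ^+ 3)%:E * I s)%E.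
  have KI r : (0 <= (K * alpha ^+ 3)%:E * I r)%E.
    rewrite mule_ge0 ?lee_fin ?mulr_ge0 ?exprn_ge0 ?(ltW alpha_gt0)//.
    by apply: integral_ge0 => x _.
  elim: n s => [|n IH] s s0 sL sn.
    have -> : s = 0 by apply/eqP; rewrite eq_le s0 andbT -(mul0r (2^-1)).
    by rewrite subrr normr0.
  have [s12|s12] := leP s (n%:R / 2); first exact: IH.
  have n20 : (0 : R) <= n%:R / 2 by rewrite divr_ge0.
  have n2L : n%:R / 2 <= L by rewrite (le_trans (ltW s12)).
  have := IH _ n20 n2L (lexx _).
  have /step := n20; move=> /(_ s (ltW s12) sL).
  have -> : s - n%:R / 2 < 1 by rewrite -natr1 in sn; lra.
  move=> /(_ isT) h2 h1; have := leeD h1 h2.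
  rewrite -ge0_muleDr; last 2 first.
  - by apply: integral_ge0 => x _.
  - by apply: integral_ge0 => x _.
  rewrite -ge0_integral_setU//=; last 2 first.
  - rewrite -itv_bndbnd_setU ?bnd_simp//; last exact: ltW.
    exact: mrho.
  - apply/disj_setPS => x [] /=; rewrite !in_itv/= => /andP[_ h] /andP[h' _].
    by move: h'; rewrite ltNge h.
  rewrite -itv_bndbnd_setU ?bnd_simp//; last exact: ltW.
  apply: le_trans; rewrite -EFinD lee_fin -(subrKA (ext S phi (gt (n%:R / 2)))).
  exact: ler_normD.
have [N LN] : exists N : nat, L <= N%:R / 2.
  exists (Num.truncn (L * 2)).+1; rewrite ler_pdivlMr//.
  exact/ltW/truncnS_gt.
have := main N L L0 (lexx L) LN.
have [t0 [t0ab t0E g0E]] := arclength_paramP gd gamma gdP a b rect 0 (lexx 0) L0.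
have [t1 [t1ab t1E g1E]] := arclength_paramP gd gamma gdP a b rect L L0 (lexx L).
have -> : gt 0 = gamma t0 := g0E.
have -> : gt L = gamma t1 := g1E.
move: t0ab t1ab; rewrite !in_itv/= => /andP[at0 t0b] /andP[at1 t1b].
have finV s t : a <= s -> s <= t -> t <= b -> curve_length gd gamma s t \is a fin_num.
  exact: (curve_length_sub_fin gd gamma gdP a b rect).
(* The times selected at arclength 0 and [L] need not be [a] and [b], and [graph_dist] has not been
   shown to separate points. But [ext] takes equal values at points of distance 0. *)
have -> : ext S phi (gamma t0) = ext S phi (gamma a).
  apply: ext0; have [_ gds _] := gdP; rewrite gds.
  apply/eqP; rewrite eq_le (pseudodist_ge0 _ gdP) andbT -lee_fin -t0E.
  exact: curve_length_dist.
have -> // : ext S phi (gamma t1) = ext S phi (gamma b).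
apply: ext0; apply/eqP; rewrite eq_le (pseudodist_ge0 _ gdP) andbT -lee_fin.
apply: (le_trans (curve_length_dist _ _ gdP _ _ t1b)).
have := curve_length_add gd gamma gdP a t1 b at1 t1b.
rewrite t1E /L; have := finV _ _ (lexx a) ab (lexx b); have := finV _ _ at1 t1b (lexx b).
case: (curve_length gd gamma a b) => // r1; case: (curve_length gd gamma t1 b) => // r2.
by move=> _ _ /= [] /eqP; rewrite -subr_eq0 opprD addrA subrr add0r oppr_eq0 => /eqP ->.
Qed.

Lemma dist_rho_ge phi (K : R) (x y : graph S) : 0 <= K ->
  (forall v w, adjacent S v w -> `|phi v - phi w| <= K * alpha ^ (- v.2)) ->
  `|ext S phi x - ext S phi y| <= K * alpha ^+ 3 * dist_rho x y.
Proof.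
move=> K0 phiK; set D := `|_|.
have KA0 : 0 <= K * alpha ^+ 3 by rewrite mulr_ge0 ?exprn_ge0 ?(ltW alpha_gt0).
rewrite /dist_rho; set A := [set r | _]; set I := ereal_inf A.
have [r rA] : exists r, A r%:E.
  have [l c] := chain_exists S alpha_gt1 tau_gt3 x y.
  have [gamma [lip g0 gl]] := chain_curve x y l c.
  have l0 := chain_ge0 c.
  set J := curve_integral gd (EFin \o @rho R alpha tau Z S) gamma 0 l.
  have J0 : (0 <= J)%E.
    by apply: integral_ge0 => s _; rewrite lee_fin ltW// rho_gt0.
  have Jfin : (J <= (rho x * alpha `^ l * (l - 0))%:E)%E.
    apply: curve_integral_rho_le => //.
      by rewrite mulr_ge0 ?powR_ge0// ltW// rho_gt0.
    move=> t; rewrite in_itv/= => /andP[t0 tl].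
    apply: rho_le_height => //; rewrite -g0.
    have := graph_dist_height S alpha_gt1 tau_gt3 (gamma 0) (gamma t).
    have := lip 0 t (lexx 0) t0 tl; rewrite subr0 ler_norml; lra.
  exists (fine J), gamma, 0, l; split => //.
    exact: lipschitz_on_rectifiable.
  by rewrite fineK// ge0_fin_numE// (le_lt_trans Jfin)// ltry.
have lower : (D%:E <= (K * alpha ^+ 3)%:E * I)%E.
  (* For a positive constant the curvewise bounds can be divided by it and passed to the infimum. If
     it vanishes, one curve suffices. *)
  have [KA|KA] := eqVneq (K * alpha ^+ 3) 0.
    have [g [a [b [rect ga gb _]]]] := rA.
    have := curve_integral_rho_ge phi K g a b K0 phiK rect.
    by rewrite ga gb KA !mul0e.
  have KAp : 0 < K * alpha ^+ 3 by rewrite lt_neqAle eq_sym KA.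
  rewrite muleC -lee_pdivrMr// -EFinM.
  apply: le_ereal_inf_tmp => _ [g [a [b [rect ga gb ->]]]].
  rewrite EFinM lee_pdivrMr// muleC /D -ga -gb.
  exact: curve_integral_rho_ge.
have Ir : (I <= r%:E)%E by exact: ereal_inf_lbound.
have I0 : (0 <= I)%E.
  apply: le_ereal_inf_tmp => _ [g [a [b [_ _ _ ->]]]].
  by apply: integral_ge0 => s _; rewrite lee_fin ltW// rho_gt0.
have Ifin : I \is a fin_num by rewrite ge0_fin_numE// (le_lt_trans Ir)// ltry.
by rewrite -(fineK Ifin) -EFinM lee_fin in lower.
Qed.

End GraphDistance.

(** * The boundary and the vertical rays *)

Section Boundary.
Context {R : realType} {alpha tau : R} {Z : completeMetricType R}.
Context {S : filling alpha tau Z} (X : completion S).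
Hypothesis alpha_gt1 : 1 < alpha.

Let alpha_gt0 : 0 < alpha. Proof. exact: lt_trans alpha_gt1. Qed.
Let alphaB1_gt0 : 0 < alpha - 1. Proof. by rewrite subr_gt0. Qed.
Let gt0 (n : int) : 0 < alpha ^ n. Proof. exact: scale_gt0. Qed.
Notation lam := (@lebesgue_measure R).

(* [tail k] is the [dist_rho]-length of a vertical ray from level [k] to the
   boundary, up to a constant: the sum of [alpha ^ (- j)] over [j >= k]. *)
Definition tail (k : int) : R := alpha ^ (- k) * (alpha / (alpha - 1)).

Lemma tail_gt0 k : 0 < tail k.
Proof. by rewrite mulr_gt0// divr_gt0. Qed.

Lemma scaleS k : alpha ^ (- k) = alpha * alpha ^ (- (k + 1)).
Proof. by rewrite -[X in X * _](expr1z alpha) -scaleD//; congr (_ ^ _); lia. Qed.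

Lemma tailB k : tail k - tail (k + 1) = alpha ^ (- k).
Proof. by rewrite /tail scaleS; field; rewrite gt_eqF. Qed.

Lemma tail_lt k l : k < l -> tail l < tail k.
Proof.
move=> kl; rewrite /tail ltr_pM2r ?divr_gt0//.
by apply: scale_lt => //; rewrite ltrN2.
Qed.

Lemma tail_le k l : k <= l -> tail l <= tail k.
Proof. by rewrite le_eqVlt => /predU1P[->//|/tail_lt/ltW]. Qed.

Lemma scale_le_tail k : alpha ^ (- k) <= tail k.
Proof. by rewrite -tailB gerBl ltW// tail_gt0. Qed.

Lemma tail_small e : 0 < e -> exists n : nat, tail n%:Z < e.
Proof.
move=> e0; have [n] := scale_unbounded alpha_gt1 (alpha / (alpha - 1) / e).
rewrite ltr_pdivrMr// => h; exists n; rewrite /tail -invr_expz mulrC.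
by rewrite ltr_pdivrMr ?gt0// [ltRHS]mulrC.
Qed.

(** The factor 2, against 1 for anchors, allows a vertex of the ray to be replaced by the anchor of
    another point within [alpha ^ (- k)] of [z]. *)
Definition is_ray (z : Z) (u : int -> Z) : Prop :=
  forall k, net S k (u k) /\ mdist (u k) z < 2 * alpha ^ (- k).

Lemma anchor_ray z : is_ray z (fun k => anchor S k z).
Proof.
move=> k; have [Sk kz] := anchorP S alpha_gt1 k z; split => //.
by apply: (lt_trans kz); have := gt0 (- k); lra.
Qed.

Hypothesis tau_gt3 : 3 < tau.

Lemma ray_adjacent z u u' k : is_ray z u -> is_ray z u' ->
  adjacent S (u k, k) (u' (k + 1), k + 1).
Proof.
move=> ru ru'; have [Su uz] := ru k; have [Su' u'z] := ru' (k + 1).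
apply: (adjacent_up S alpha_gt1 tau_gt3 z) => //.
  by apply: (lt_trans uz); have := gt0 (- k); lra.
by apply: (lt_trans u'z); have := gt0 (- (k + 1)); lra.
Qed.

Notation vx u k := (emb X (vertex S (u k, k))).

Lemma emb_edge_le v w (k : int) s t : adjacent S v w -> k <= v.2 ->
  k <= w.2 -> s \in `[0, 1] -> t \in `[0, 1] ->
  mdist (emb X (edge S v w s)) (emb X (edge S v w t)) <=
    alpha ^ (- k) * `|s - t|.
Proof.
move=> vw kv kw; rewrite !in_itv/= => /andP[s0 s1] /andP[t0 t1].
have [st|/ltW ts] := leP s t.
  by rewrite ler0_norm ?subr_le0// opprB emb_isometry dist_rho_edge_le.
by rewrite metric_sym ger0_norm ?subr_ge0// emb_isometry dist_rho_edge_le.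
Qed.

Lemma ray_step z u u' k : is_ray z u -> is_ray z u' ->
  mdist (vx u k) (vx u' (k + 1)) <= alpha ^ (- k).
Proof.
move=> ru ru'; have uu' := ray_adjacent z u u' k ru ru'.
rewrite -(edge0 _ _ _ uu') -(edge1 _ _ _ uu').
apply: (le_trans (emb_edge_le _ _ k _ _ uu' _ _ _ _)) => //=.
- by rewrite lerDl.
- by rewrite in_itv/= lexx ler01.
- by rewrite in_itv/= lexx ler01.
- by rewrite sub0r normrN1 mulr1.
Qed.

Lemma ray_tail z u k (j : nat) : is_ray z u ->
  mdist (vx u k) (vx u (k + j%:Z)) <= tail k - tail (k + j%:Z).
Proof.
move=> ru; elim: j => [|j IH]; first by rewrite addr0 mdistxx subrr.
have -> : k + j.+1%:Z = k + j%:Z + 1 by lia.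
apply: (le_trans (metric_triangle _ (vx u (k + j%:Z)) _)).
have := ray_step z u u (k + j%:Z) ru ru; rewrite -tailB; lra.
Qed.

(** By [ray_tail], the vertices of a ray move by at most differences of [tail], so they form a
    Cauchy sequence in the complete space [X]. *)
Lemma ray_limit z : exists x : X, forall e, 0 < e -> exists n : nat, forall m : nat,
  (n <= m)%N -> mdist x (vx (fun k => anchor S k z) m%:Z) < e.
Proof.
set u := fun k => anchor S k z; have ru : is_ray z u := anchor_ray z.
pose s (n : nat) : X := vx u n%:Z.
have : cvg (s n @[n --> \oo]).
  apply: cauchy_cvg; apply: cauchy_exP => e e0.
  have [n ne] := tail_small e e0; exists (s n); exists n => // m /= nm.
  rewrite ballEmdist /= /s; have := ray_tail z u n%:Z (m - n)%N ru.
  have -> : n%:Z + (m - n)%N%:Z = m%:Z by lia.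
  by move/le_lt_trans; apply; have := tail_gt0 m%:Z; lra.
move=> /metricType_numDomainType.cvgrPdist_lt H; exists (lim (s n @[n --> \oo])).
by move=> e /H [n _ nP]; exists n => m nm; exact: nP.
Qed.

(** [boundary_point] is chosen by [get], so it must be shown that some point is the limit for every
    admissible sequence. The limit along the anchors is. *)
Lemma boundary_point_cvg z e : 0 < e -> exists n : nat, forall m : nat,
  (n <= m)%N -> mdist (boundary_point X z) (vx (fun k => anchor S k z) m%:Z) < e.
Proof.
set P := [set x : X | forall u : nat -> Z,
    (forall n, net S n%:Z (u n) /\ mdist (u n) z < alpha ^ (- n%:Z)) ->
    emb X (vertex S (u n, n%:Z)) @[n --> \oo] --> x].
have P0 : exists x, P x.
  have [x xP] := ray_limit z; exists x => u uP.
  apply/metricType_numDomainType.cvgrPdist_lt => d d0.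
  have d20 : 0 < d / 2 by rewrite divr_gt0.
  have [n1 n1P] := xP _ d20; have [n2 n2P] := tail_small _ d20.
  exists (maxn n1 n2) => // m /=; rewrite geq_max => /andP[n1m n2m].
  apply: (le_lt_trans (metric_triangle _ (vx (fun k => anchor S k z) m.+1%:Z) _)).
  have := n1P m.+1 (leqW n1m).
  (* Changing the anchors at level [m] alone leaves a ray, so [ray_step] compares [u m] with the
     anchor at level [m + 1]. At level [m] itself the two vertices could coincide and would then not
     be adjacent. *)
  pose u' (k : int) := if k == m%:Z then u m else anchor S k z.
  have ru' : is_ray z u'.
    move=> k; rewrite /u'; case: eqP => [->|_]; last exact: anchor_ray.
    have [Su uz] := uP m; split => //.
    by apply: (lt_trans uz); have := gt0 (- m%:Z); lra.
  have := ray_step z u' _ m%:Z ru' (anchor_ray z).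
  rewrite /u' eqxx /= (metric_sym (emb X (vertex S (u m, m%:Z)))).
  have -> : m%:Z + 1 = m.+1%:Z by lia.
  have := scale_le_tail m%:Z; have := tail_le n2%:Z m%:Z; rewrite lez_nat => /(_ n2m).
  move=> /=; lra.
have := @xgetPex _ point P P0; rewrite -[xget _ _]/(boundary_point X z) => H e0.
have := H (fun n => anchor S n%:Z z) (fun n => anchorP S alpha_gt1 n%:Z z).
move=> /metricType_numDomainType.cvgrPdist_lt /(_ e e0) [n _ nP].
by exists n => m nm; exact: nP.
Qed.

(** From level [k] to a deep level [m] the ray costs [tail k - tail m]. The step onto the anchor of
    level [m + 1] costs [alpha ^ (- m)], at most [tail m]. *)
Lemma boundary_ray_le z u k : is_ray z u ->
  mdist (boundary_point X z) (vx u k) <= tail k.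
Proof.
move=> ru; apply/ler_addgt0Pr => e e0.
have [n nP] := boundary_point_cvg z e e0.
pose m : nat := maxn n `|k|.
pose j : nat := `|m%:Z - k|%N.
have kj : k + j%:Z = m%:Z by rewrite /j /m; lia.
have h1 := nP m.+1 (leqW (leq_maxl _ _)).
have h2 := ray_step z u _ m%:Z ru (anchor_ray z).
have h3 := ray_tail z u k j ru; rewrite kj in h3.
have E : m%:Z + 1 = m.+1%:Z by lia.
rewrite E in h2.
apply: (le_trans (metric_triangle _ (vx (fun k => anchor S k z) m.+1%:Z) _)).
have := metric_triangle (vx (fun k => anchor S k z) m.+1%:Z) (vx u m%:Z) (vx u k).
rewrite (metric_sym _ (vx u m%:Z)) (metric_sym (vx u m%:Z) (vx u k)).
have := scale_le_tail m%:Z; lra.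
Qed.

Lemma emb_vertex_ge (phi : Z * int -> R) (K : R) v w : 0 <= K ->
  (forall v w, adjacent S v w -> `|phi v - phi w| <= K * alpha ^ (- v.2)) ->
  is_vertex S v -> is_vertex S w ->
  `|phi v - phi w| <= K * alpha ^+ 3 * mdist (emb X (vertex S v)) (emb X (vertex S w)).
Proof.
move=> K0 phiK Sv Sw.
have extV v' : is_vertex S v' -> ext S phi (vertex S v') = phi v'.
  move=> Sv'; have [w' vw'] := vertex_adjacent S alpha_gt1 tau_gt3 v' Sv'.
  rewrite -(edge0 _ _ _ vw') extE// ?in_itv/= ?lexx ?ler01//.
  by rewrite subr0 mul1r mul0r addr0.
by rewrite -{1}(extV v Sv) -{1}(extV w Sw) emb_isometry; exact: dist_rho_ge.
Qed.

(** The test function [alpha ^ (- h)] separates consecutive levels. This makes the curves of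
    [rays_curve] nonconstant even if both endpoints are the same point. *)
Lemma emb_ray_neq z u k : is_ray z u -> vx u k <> vx u (k + 1).
Proof.
move=> ru E; pose phi (v : Z * int) : R := alpha ^ (- v.2).
have phiK v w : adjacent S v w -> `|phi v - phi w| <= (1 + alpha) * alpha ^ (- v.2).
  case=> _ _ _ hvw _; rewrite /phi.
  have : alpha ^ (- w.2) <= alpha * alpha ^ (- v.2).
    by rewrite -[X in X * _](expr1z alpha) -scaleD// scale_le//; lia.
  by have := gt0 (- w.2); have := gt0 (- v.2); rewrite ler_norml => *; apply/andP; split; lra.
have := emb_vertex_ge phi (1 + alpha) (u k, k) (u (k + 1), k + 1) _ phiK.
rewrite E mdistxx mulr0 normr_le0 subr_eq0 /phi /=.
have [Su _] := ru k; have [Su' _] := ru (k + 1).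
move=> /(_ _ Su Su'); rewrite addr_ge0 ?(ltW alpha_gt0)// => /(_ isT)/eqP.
by apply/eqP; rewrite gt_eqF//; apply: scale_lt => //; lia.
Qed.

(** The test function is the distance of the base point of a vertex to [x], whose variation along
    edges is bounded by [adjacent_dist]. It is evaluated at deep vertices of rays to [x] and to
    [y]. *)
Lemma boundary_dist_ge (x y : Z) :
  mdist x y <= tau * (1 + alpha) * alpha ^+ 3 * boundary_dist X x y.
Proof.
set K := tau * (1 + alpha); pose phi (v : Z * int) := mdist v.1 x.
have K0 : 0 <= K by rewrite mulr_ge0//; have := tau_gt3; have := alpha_gt0; lra.
have phiK v w : adjacent S v w -> `|phi v - phi w| <= K * alpha ^ (- v.2).
  move=> vw; apply: le_trans (adjacent_dist S alpha_gt1 tau_gt3 _ _ vw).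
  rewrite ler_norml /phi; have := metric_triangle v.1 w.1 x.
  have := metric_triangle w.1 v.1 x; rewrite (metric_sym w.1 v.1) => h1 h2.
  by apply/andP; split; lra.
set K' := K * alpha ^+ 3.
have K'0 : 0 <= K' by rewrite mulr_ge0// exprn_ge0// ltW.
apply/ler_addgt0Pr => e e0.
(* The total error is [2 * K' * tail n] from the vertices replacing boundary points and at most
   [2 * tail n] from the base points replacing [x] and [y]. *)
have e'0 : 0 < e / (2 * (K' + 1)) by rewrite divr_gt0// mulr_gt0//; lra.
have [n nT] := tail_small _ e'0.
pose u k := anchor S k x; pose w k := anchor S k y.
have ru : is_ray x u := anchor_ray x.
have rw : is_ray y w := anchor_ray y.
have [Su ux] := anchorP S alpha_gt1 n%:Z x.
have [Sw wy] := anchorP S alpha_gt1 n%:Z y.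
have := emb_vertex_ge phi K (u n%:Z, n%:Z) (w n%:Z, n%:Z) K0 phiK Su Sw.
rewrite /phi /= -/K' => h.
have hb : mdist (vx u n%:Z) (vx w n%:Z) <= boundary_dist X x y + 2 * tail n%:Z.
  have h1 := boundary_ray_le x u n%:Z ru; have h2 := boundary_ray_le y w n%:Z rw.
  apply: (le_trans (metric_triangle _ (boundary_point X x) _)).
  rewrite metric_sym.
  have := metric_triangle (boundary_point X x) (boundary_point X y) (vx w n%:Z).
  by rewrite -/(boundary_dist X x y); lra.
have {}h : mdist (w n%:Z) x <= mdist (u n%:Z) x +
    K' * (boundary_dist X x y + 2 * tail n%:Z).
  have := ler_wpM2l K'0 hb; move: h; rewrite ler_norml => /andP[]; lra.
have := metric_triangle x (w n%:Z) y; rewrite (metric_sym x (w n%:Z)).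
have := scale_le_tail n%:Z.
have : (K' + 1) * (2 * tail n%:Z) <= e.
  move: nT; rewrite ltr_pdivlMr; last by rewrite mulr_gt0//; lra.
  by rewrite [X in X < _ -> _]mulrC -mulrA [X in _ -> X <= _]mulrCA => /ltW.
by rewrite /u /w in ux wy h *; lra.
Qed.

End Boundary.

Section RayCurve.
Context {R : realType} {alpha tau : R} {Z : completeMetricType R}.
Context {S : filling alpha tau Z} (X : completion S).
Hypothesis alpha_gt1 : 1 < alpha.

Let alpha_gt0 : 0 < alpha. Proof. exact: lt_trans alpha_gt1. Qed.
Let gt0 (n : int) : 0 < alpha ^ n. Proof. exact: scale_gt0. Qed.
Let scaleNK k : alpha ^ (- k) * alpha ^ k = 1.
Proof. by rewrite -scaleD// addNr expr0z. Qed.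
Notation lam := (@lebesgue_measure R).
Notation vx u k := (emb X (vertex S (u k, k))).
Notation tail := (@tail R alpha).
Notation is_ray := (@is_ray R alpha tau Z S).

Lemma tail_level t : 0 < t -> exists k, tail (k + 1) < t <= tail k.
Proof.
move=> t0; have [n nt] := tail_small alpha_gt1 t t0.
have [m mt] : exists m : nat, t <= tail (- m%:Z).
  have [m] := scale_unbounded alpha_gt1 t; exists m; apply/ltW.
  apply: (lt_le_trans p); have := scale_le_tail alpha_gt1 (- m%:Z).
  by rewrite opprK.
(* The least level with tail below [t] is searched among the naturals, shifted by [m]; at level
   [- m] the tail is still at least [t]. *)
pose P (j : nat) := tail (j%:Z - m%:Z) < t.
have exP : exists j, P j.
  by exists (n + m)%N; rewrite /P PoszD addrK.
have [j Pj jmin] := ex_minnP exP.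
case: j Pj jmin => [|j] Pj jmin.
  by move: Pj; rewrite /P sub0r ltNge mt.
exists (j%:Z - m%:Z); apply/andP; split.
  by have -> : j%:Z - m%:Z + 1 = j.+1%:Z - m%:Z by lia.
rewrite leNgt; apply/negP => Pj'.
by have := jmin j Pj'; rewrite ltnn.
Qed.

Definition level (t : R) : int := xget 0 [set k | tail (k + 1) < t <= tail k].

Lemma levelP t : 0 < t -> tail (level t + 1) < t <= tail (level t).
Proof. by move=> /tail_level H; exact: (@xgetPex _ 0 [set k | _] H). Qed.

Hypothesis tau_gt3 : 3 < tau.

Section OneRay.
Variables (z : Z) (u : int -> Z).
Hypothesis ru : is_ray z u.

Definition ray_edge (k : int) (t : R) : X :=
  emb X (edge S (u k, k) (u (k + 1), k + 1) t).

Let adj k : adjacent S (u k, k) (u (k + 1), k + 1).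
Proof. exact: ray_adjacent ru ru. Qed.

Let ray_edge0 k : ray_edge k 0 = vx u k.
Proof. by rewrite /ray_edge edge0//; exact: adj. Qed.

Let ray_edge1 k : ray_edge k 1 = vx u (k + 1).
Proof. by rewrite /ray_edge edge1//; exact: adj. Qed.

(* The vertical ray ending at [z], parametrized by the tail that remains: the
   [k]-th edge is run through, from top to bottom, on [[tail (k + 1), tail k]],
   at a speed which makes the parametrization 1-Lipschitz. *)
Definition ray_curve (t : R) : X :=
  if t <= 0 then boundary_point X z
  else ray_edge (level t) ((tail (level t) - t) * alpha ^ (level t)).

Lemma ray_curve0 : ray_curve 0 = boundary_point X z.
Proof. by rewrite /ray_curve lexx. Qed.

(** Valid on the closed interval: at the breakpoint [tail (k + 1)] the bottom of edge [k] is the top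
    of edge [k + 1]. *)
Lemma ray_curveE k t : tail (k + 1) <= t -> t <= tail k ->
  ray_curve t = ray_edge k ((tail k - t) * alpha ^ k).
Proof.
move=> kt tk; have t0 : 0 < t by apply: lt_le_trans kt; exact: tail_gt0.
rewrite /ray_curve leNgt t0 /=.
have /andP[lt tl] := levelP t t0; set l := level t in lt tl *.
have lk : k <= l.
  rewrite leNgt; apply/negP => lk.
  have : tail k <= tail (l + 1) by apply: tail_le => //; lia.
  by move/(le_trans tk); rewrite leNgt lt.
have lk1 : l <= k + 1.
  rewrite leNgt; apply/negP => kl.
  have : tail l < tail (k + 1) by exact: tail_lt.
  by move/(le_lt_trans tl); rewrite ltNge kt.
have [->//|lDk] := eqVneq l k.
have lE : l = k + 1 by lia.
have tE : t = tail (k + 1) by apply/eqP; rewrite eq_le kt -lE tl.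
by rewrite lE tE subrr mul0r ray_edge0 tailB// scaleNK ray_edge1.
Qed.

Lemma ray_curve_tail k : ray_curve (tail k) = vx u k.
Proof.
rewrite (ray_curveE k)//; last by apply: tail_le => //; lia.
by rewrite subrr mul0r ray_edge0.
Qed.

Lemma ray_curve_edge k t : t \in `[0, 1] ->
  ray_curve (tail k - alpha ^ (- k) * t) = ray_edge k t.
Proof.
rewrite in_itv/= => /andP[t0 t1].
have a0 := gt0 (- k).
rewrite (ray_curveE k).
- have -> : (tail k - (tail k - alpha ^ (- k) * t)) * alpha ^ k =
    alpha ^ (- k) * alpha ^ k * t by ring.
  by rewrite scaleNK mul1r.
- by have := tailB alpha_gt1 k; nra.
- by nra.
Qed.

Let piece_le k s t : tail (k + 1) <= s -> s <= t -> t <= tail k ->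
  mdist (ray_curve s) (ray_curve t) <= t - s.
Proof.
move=> ks st tk.
have in01 r : tail (k + 1) <= r -> r <= tail k -> (tail k - r) * alpha ^ k \in `[0, 1].
  move=> kr rk; rewrite in_itv/= mulr_ge0 ?subr_ge0 ?(ltW (gt0 k))//=.
  by rewrite -(scaleNK k) ler_wpM2r ?(ltW (gt0 k))// -tailB//; lra.
rewrite !(ray_curveE k)// ?(le_trans st)// ?(le_trans ks)//.
apply: (le_trans (emb_edge_le X alpha_gt1 tau_gt3 _ _ k _ _ (adj k) _ _ _ _)) => //=.
- by rewrite lerDl.
- by apply: in01; lra.
- by apply: in01; lra.
rewrite -mulrBl normrM mulrCA (gtr0_norm (gt0 k)) scaleNK mulr1.
have -> : tail k - s - (tail k - t) = t - s by ring.
by rewrite ger0_norm// subr_ge0.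
Qed.

(** The breakpoints accumulate at 0, so the pieces cannot be glued one by one. Times on different
    edges are compared through the vertices below the later and above the earlier one, with
    [ray_tail] in between; the boundary point is handled by [boundary_ray_le]. *)
Lemma ray_curve_lipschitz b : lipschitz_on mdist ray_curve 0 b.
Proof.
move=> s t s0 st _.
have [t0|t0] := leP t 0.
  have -> : s = 0 by lra.
  have -> : t = 0 by lra.
  by rewrite mdistxx subrr.
have /andP[kt tk] := levelP t t0; set k := level t in kt tk.
have hk : mdist (vx u (k + 1)) (ray_curve t) <= t - tail (k + 1).
  by rewrite -ray_curve_tail; apply: (piece_le k) => //; exact: ltW.
move: s0; rewrite le_eqVlt => /predU1P[<-|s0].
  rewrite ray_curve0 subr0.
  apply: (le_trans (metric_triangle _ (vx u (k + 1)) _)).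
  have := boundary_ray_le X alpha_gt1 tau_gt3 z u (k + 1) ru.
  lra.
have /andP[js sj] := levelP s s0; set j := level s in js sj.
have [jk|jk] := ltP j (k + 1); last first.
  have hj : mdist (ray_curve s) (vx u j) <= tail j - s.
    by rewrite -ray_curve_tail; apply: (piece_le j) => //; exact: ltW.
  have [n jE] : exists n : nat, j = k + 1 + n%:Z.
    by exists `|(j - (k + 1))%R|%N; lia.
  have := ray_tail X alpha_gt1 tau_gt3 z u (k + 1) n ru; rewrite -jE metric_sym => h.
  apply: (le_trans (metric_triangle _ (vx u j) _)).
  have := metric_triangle (vx u j) (vx u (k + 1)) (ray_curve t).
  lra.
apply: (piece_le k) => //.
apply: (le_trans _ (ltW js)); apply: tail_le => //.
by lia.
Qed.

End OneRay.

(** One ray is followed from [x] to the common vertex of level [n] during [[0, T]], the other back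
    to [y] during [[T, 2 * T]]. *)
Lemma rays_curve (g : X -> \bar R) x y u w n :
  (forall x, (0 <= g x)%E) ->
  measurable_fun [set: borel_completion X] (g : borel_completion X -> \bar R) ->
  is_ray x u -> is_ray y w -> u n = w n ->
  exists gamma b, [/\ rectifiable_curve mdist gamma 0 b,
    exists2 t, t \in `[0, b] & gamma t <> gamma 0,
    gamma 0 = boundary_point X x, gamma b = boundary_point X y &
    (curve_integral mdist g gamma 0 b <=
      \sum_(j <oo) (alpha ^ (- (n + j%:Z)))%:E *
        (\int[lam]_(t in `[0%R, 1%R]) g (ray_edge u (n + j%:Z) t) +
         \int[lam]_(t in `[0%R, 1%R]) g (ray_edge w (n + j%:Z) t)))%E].
Proof.
move=> g0 mg ru rw uw; pose T := tail n; have T0 : 0 < T by exact: tail_gt0.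
pose gamma t := if t <= T then ray_curve x u t else ray_curve y w (2 * T - t).
have gammaE2 t : T <= t -> gamma t = ray_curve y w (2 * T - t).
  rewrite le_eqVlt /gamma => /predU1P[<-|Tt]; last by rewrite leNgt Tt.
  rewrite lexx; have -> : 2 * T - T = T by ring.
  by rewrite !ray_curve_tail// uw.
have lip : lipschitz_on mdist gamma 0 (2 * T).
  apply: (@lipschitz_on_glue _ _ _ _ _ _ T).
  - exact: mdist_pseudodist.
  - exact: ray_curve_lipschitz.
  - move=> s t Ts st tT; rewrite metric_sym.
    have -> : t - s = (2 * T - s) - (2 * T - t) by ring.
    by apply: (ray_curve_lipschitz y w rw (2 * T)); lra.
  - have -> : 2 * T - T = T by ring.
    by rewrite !ray_curve_tail// uw.
have gamma0 : gamma 0 = boundary_point X x by rewrite /gamma (ltW T0) ray_curve0.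
have gammaT : gamma (2 * T) = boundary_point X y.
  by rewrite gammaE2 ?subrr ?ray_curve0//; lra.
exists gamma, (2 * T); split => //.
- apply: lipschitz_on_rectifiable => //; [exact: mdist_pseudodist|lra].
- apply: contrapT => H.
  have E t : t \in `[0, 2 * T] -> gamma t = gamma 0.
    by move=> tT; apply: contrapT => tE; apply: H; exists t.
  have T1 : tail (n + 1) < T by apply: tail_lt => //; lia.
  have T10 : 0 < tail (n + 1) by exact: tail_gt0.
  apply: (emb_ray_neq X alpha_gt1 tau_gt3 x u n ru).
  rewrite -!(ray_curve_tail x u ru).
  have -> : ray_curve x u (tail n) = gamma T by rewrite /gamma lexx.
  have -> : ray_curve x u (tail (n + 1)) = gamma (tail (n + 1)).
    by rewrite /gamma (ltW T1).
  by rewrite !E// in_itv/=; lra.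
(* The time at which the ray passes the point [t] of edge [k], so that [alpha ^ (- k)] becomes the
   Lipschitz constant of the piece. *)
pose L (k : int) t := tail k - alpha ^ (- k) * t.
have Lle k t : n <= k -> t \in `[0, 1] -> 0 < L k t <= T.
  rewrite in_itv/= /L => nk /andP[t0 t1].
  have := tailB alpha_gt1 k; have := tail_gt0 alpha_gt1 (k + 1).
  have := tail_le alpha_gt1 _ _ nk; have := gt0 (- k); rewrite -/T.
  by move=> h1 h2 h3 h4; apply/andP; split; nra.
have Llip k : lip_on (L k) 0 1 (alpha ^ (- k)).
  move=> s t _ _; rewrite /L.
  have -> : tail k - alpha ^ (- k) * s - (tail k - alpha ^ (- k) * t) =
     alpha ^ (- k) * (t - s) by ring.
  by rewrite normrM (gtr0_norm (gt0 _)) distrC.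
have nj (j : nat) : n <= n + j%:Z by rewrite lerDl.
have Lonto r : 0 < r -> r <= T -> exists j : nat, (L (n + j%:Z) @` `[0, 1]) r.
  move=> r0 rT; have /andP[kr rk] := levelP r r0; set k := level r in kr rk.
  have nk : n <= k.
    rewrite leNgt; apply/negP => kn.
    have : tail n <= tail (k + 1) by apply: tail_le => //; lia.
    by rewrite leNgt (lt_le_trans kr).
  exists `|k - n|%N; have -> : n + `|k - n|%N%:Z = k by lia.
  exists ((tail k - r) / alpha ^ (- k)).
    rewrite /= in_itv/= divr_ge0 ?subr_ge0 ?(ltW (gt0 _))//=.
    by rewrite ler_pdivrMr// mul1r -tailB//; lra.
  by rewrite /L mulrC divfK ?gt_eqF//; ring.
have := @curve_integral_le _ _ g gamma 0 (2 * T)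
  (fun j => L (n + j%:Z)) (fun j t => 2 * T - L (n + j%:Z) t)
  (fun j => alpha ^ (- (n + j%:Z))) g0 mg.
move=> H; apply: le_trans (H _ _ _ _ _ _ _ _) _ => //.
- lra.
- by move=> j; exact/ltW/gt0.
- move=> j s t s01 t01 /=.
  have -> : 2 * T - L (n + j%:Z) s - (2 * T - L (n + j%:Z) t) =
    L (n + j%:Z) t - L (n + j%:Z) s by ring.
  by rewrite distrC; exact: Llip.
- by move=> j t t01; have := Lle _ t (nj j) t01; rewrite in_itv/=; lra.
- by move=> j t t01; have := Lle _ t (nj j) t01; rewrite in_itv/=; lra.
- move=> r; rewrite in_itv/= => /andP[r0 rT].
  have [rT'|Tr] := leP r T.
    by have [j jr] := Lonto r r0 rT'; exists j; left.
  have [||j [t t01 tr]] := Lonto (2 * T - r); [lra|lra|].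
  by exists j; right; exists t => //; rewrite tr; ring.
apply: lee_nneseries => [j _ _|j _].
  by rewrite mule_ge0 ?lee_fin ?(ltW (gt0 _))// adde_ge0// integral_ge0.
rewrite lee_wpmul2l ?lee_fin ?(ltW (gt0 _))// leeD// ge0_le_integral_nomeas// => t /= t01.
  have /andP[_ Lt] := Lle _ t (nj j) t01.
  by rewrite /gamma Lt /L ray_curve_edge.
have /andP[_ Lt] := Lle _ t (nj j) t01.
rewrite gammaE2; last by lra.
have -> : 2 * T - (2 * T - L (n + j%:Z) t) = L (n + j%:Z) t by ring.
by rewrite /L ray_curve_edge.
Qed.

End RayCurve.

(** * Oscillation and energy *)

Section Series.
Local Open Scope ereal_scope.
Context {R : realType}.
Notation lam := (@lebesgue_measure R).

Lemma nneseries_geometric (q : R) : (0 <= q)%R -> (q < 1)%R ->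
  \sum_(j <oo) (q ^+ j)%:E = ((1 - q)^-1)%:E.
Proof.
move=> q0 q1.
have qn : (`|q| < 1)%R by rewrite ger0_norm.
have := @cvg_geometric_series R 1 q qn; rewrite div1r => H.
have : (series (geometric 1%R q) n)%:E @[n --> \oo] --> ((1 - q)^-1)%:E.
  by apply: cvg_EFin; [exact: nearW|exact: H].
move=> /cvg_lim <- //; congr (limn _); apply/funext => n.
by rewrite /series /= -sumEFin; apply: eq_bigr => i _; rewrite /geometric /= mul1r.
Qed.

Lemma lee_poweR (x y : \bar R) (r : R) : (0 <= r)%R -> 0 <= x -> x <= y ->
  x `^ r <= y `^ r.
Proof.
move=> r0 x0 xy; apply: gt0_ler_poweR => //; rewrite in_itv/= ?x0 ?leey//.
by rewrite (le_trans x0 xy) ?leey.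
Qed.

Lemma poweRK (x : \bar R) (p : R) : (0 < p)%R -> 0 <= x ->
  (x `^ p^-1) `^ p = x.
Proof. by move=> p0 x0; rewrite -poweRrM mulVf ?gt_eqF// poweRe1. Qed.

(* For every [c > 0] one has [F <= c + c ^ (1 - p) * F ^ p]; take for [c] the
   [L^p] norm of [F]. *)
Lemma integral01_le_Lp (F : R -> \bar R) (p : R) : (1 <= p)%R ->
  (forall t, 0 <= F t) -> measurable_fun `[(0 : R)%R, (1 : R)%R] F ->
  \int[lam]_(t in `[0%R, 1%R]) F t <=
  2%:E * (\int[lam]_(t in `[0%R, 1%R]) F t `^ p) `^ p^-1.
Proof.
move=> p1 F0 mF; have p0 : (0 < p)%R by lra.
set J := \int[lam]_(t in _) (F t `^ p).
have J0 : 0 <= J by apply: integral_ge0 => t _; exact: poweR_ge0.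
have mFp : measurable_fun `[(0 : R)%R, (1 : R)%R] (fun t => F t `^ p).
  exact: (measurableT_comp (measurable_poweR _)).
have main (c : R) : (0 < c)%R ->
    \int[lam]_(t in `[0%R, 1%R]) F t <= c%:E + (c `^ (1 - p))%:E * J.
  move=> c0; have cp : (0 < c `^ (1 - p))%R by exact: powR_gt0.
  apply: (@le_trans _ _ (\int[lam]_(t in `[0%R, 1%R])
      (c%:E + (c `^ (1 - p))%:E * F t `^ p))).
    apply: ge0_le_integral_nomeas => // t _.
    have [tc|ct] := leP (F t) c%:E.
      by rewrite (le_trans tc)// leeDl// mule_ge0 ?poweR_ge0// lee_fin ltW.
    have := F0 t; case: (F t) ct => [r|_ _|//].
    + rewrite lte_fin lee_fin => cr r0; rewrite poweR_EFin -EFinM -EFinD lee_fin.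
      apply: (@le_trans _ _ (c `^ (1 - p) * r `^ p)%R); last by rewrite lerDr ltW.
      have r0' : (0 < r)%R by exact: lt_trans cr.
      have -> : (r `^ p = r * r `^ (p - 1))%R.
        rewrite -[X in (X * _)%R](powRr1 (ltW r0')) -powRD ?subrKC//.
        by rewrite (gt_eqF r0') implybT.
      rewrite mulrCA ler_peMr//.
      have -> : (1 - p = - (p - 1))%R by ring.
      rewrite powRN mulrC ler_pdivlMr ?powR_gt0// mul1r.
      by apply: ge0_ler_powR; rewrite ?nnegrE ?subr_ge0//; exact: ltW.
    + by rewrite poweRyr ?gt_eqF// gt0_muley ?lte_fin// addey// leey.
  rewrite ge0_integralD//; last 3 first.
  - by move=> t _; rewrite lee_fin ltW.
  - by move=> t _; rewrite mule_ge0 ?poweR_ge0// lee_fin ltW.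
  - exact: measurable_funeM.
  rewrite integral_cst//= lebesgue_measure_itv/= lte_fin ltr01 -EFinD subr0 mule1.
  rewrite leeD2l// ge0_integralZl_EFin// ?(ltW cp)// => t _.
  exact: poweR_ge0.
case: J J0 main => [J|_ _|//]; last first.
  by rewrite poweRyr ?gt_eqF ?invr_gt0// gt0_muley ?lte_fin// leey.
rewrite lee_fin le_eqVlt => /predU1P[<-|J0] main.
  rewrite poweR_EFin powR0 ?gt_eqF ?invr_gt0// mule0.
  apply/lee_addgt0Pr => e e0; rewrite add0e.
  by apply: le_trans (main e e0) _; rewrite mule0 adde0.
apply: le_trans (main (J `^ p^-1)%R _) _; first exact: powR_gt0.
rewrite poweR_EFin -!EFinM -EFinD lee_fin.
have -> : ((J `^ p^-1) `^ (1 - p) * J = J `^ p^-1)%R; last by lra.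
rewrite -powRrM -[X in (_ * X)%R](powRr1 (ltW J0)) -powRD; last first.
  by rewrite (gt_eqF J0) implybT.
by congr (_ `^ _)%R; field; rewrite gt_eqF.
Qed.

(** No Hölder inequality: a single term of the series [Q] is at most [Q], so [(J j) ^ (1 / p)] is at
    most [alpha ^ ((n + j) (1 - delta)) * Q ^ (1 / p)]. What remains is geometric with ratio
    [alpha ^ (- delta)]. The constant 4 collects the factor 2 of each of the two rays. *)
Lemma ray_series_le (alpha p delta : R) (n : int) (I I' J J' : nat -> \bar R) :
  (1 < alpha)%R -> (0 < p)%R -> (0 < delta)%R ->
  (forall j, 0 <= J j) -> (forall j, 0 <= J' j) ->
  (forall j, 0 <= I j <= 2%:E * (J j) `^ p^-1) ->
  (forall j, 0 <= I' j <= 2%:E * (J' j) `^ p^-1) ->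
  \sum_(j <oo) (alpha ^ (- (n + j%:Z)))%:E * (I j + I' j) <=
  (4 / (1 - alpha `^ (- delta)) * alpha `^ (- n%:~R * delta))%:E *
  (\sum_(j <oo) (alpha `^ (- (n + j%:Z)%:~R * ((1 - delta) * p)))%:E *
     (J j + J' j)) `^ p^-1.
Proof.
move=> a1 p0 d0 J0 J'0 IJ I'J'; have a0 : (0 < alpha)%R by lra.
set Q := \sum_(j <oo) _ * (J j + J' j).
have term0 j : 0 <= (alpha `^ (- (n + j%:Z)%:~R * ((1 - delta) * p)))%:E * (J j + J' j).
  by rewrite mule_ge0 ?lee_fin ?powR_ge0// adde_ge0.
have Q0 : 0 <= Q by apply: nneseries_ge0.
have bound (K : nat -> \bar R) j : 0 <= K j -> K j <= J j + J' j ->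
    (K j) `^ p^-1 <= (alpha `^ ((n + j%:Z)%:~R * (1 - delta)))%:E * Q `^ p^-1.
  move=> K0 KJ.
  have KQ : K j <= (alpha `^ ((n + j%:Z)%:~R * ((1 - delta) * p)))%:E * Q.
    rewrite -lee_pdivrMl ?powR_gt0//; apply: (@le_trans _ _
      ((alpha `^ (- (n + j%:Z)%:~R * ((1 - delta) * p)))%:E * (J j + J' j))).
      by rewrite mulNr powRN lee_wpmul2l// lee_fin invr_ge0 powR_ge0.
    by rewrite /Q (nneseriesD1 (n := j))// leeDl// nneseries_ge0.
  apply: (le_trans (lee_poweR _ _ p^-1 _ K0 KQ)); first by rewrite invr_ge0 ltW.
  rewrite poweRM ?lee_fin ?powR_ge0// poweR_EFin -powRrM.
  by rewrite mulrA mulfK ?gt_eqF.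
have ad : (alpha `^ (- delta) < 1)%R.
  rewrite /powR gt_eqF// -expR0 ltr_expR mulNr oppr_lt0 mulr_gt0//.
  by rewrite ln_gt0.
have C0 : (0 < 4 / (1 - alpha `^ (- delta)) * alpha `^ (- n%:~R * delta))%R.
  by rewrite mulr_gt0 ?powR_gt0// divr_gt0// subr_gt0.
have [Qoo|Qfin] := eqVneq Q +oo.
  by rewrite Qoo poweRyr ?gt_eqF ?invr_gt0// gt0_muley ?lte_fin// leey.
apply: (@le_trans _ _ (\sum_(j <oo) ((4 * alpha `^ (- n%:~R * delta))%:E *
    Q `^ p^-1 * ((alpha `^ (- delta)) ^+ j)%:E))).
  apply: lee_nneseries => [j _ _|j _].
    have /andP[Ij _] := IJ j; have /andP[I'j _] := I'J' j.
    by rewrite mule_ge0 ?adde_ge0// lee_fin ltW// exprz_gt0.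
  have /andP[_ Ij] := IJ j; have /andP[_ I'j] := I'J' j.
  have h := leeD (le_trans Ij (lee_wpmul2l _ (bound J j (J0 j) _)))
    (le_trans I'j (lee_wpmul2l _ (bound J' j (J'0 j) _))).
  apply: le_trans (lee_wpmul2l _ (h _ _ _ _)) _.
  - by rewrite lee_fin ltW// exprz_gt0.
  - by rewrite lee_fin.
  - by rewrite leeDl.
  - by rewrite lee_fin.
  - by rewrite leeDr.
  rewrite !muleA -!EFinM -ge0_muleDl; last 2 first.
  - by rewrite lee_fin mulr_ge0// powR_ge0.
  - by rewrite lee_fin mulr_ge0// powR_ge0.
  rewrite -EFinD muleA -EFinM [leRHS]muleAC -EFinM le_eqVlt; apply/orP; left.
  apply/eqP; congr (_%:E * _).
  rewrite -powR_int// -(powR_mulrn _ (powR_ge0 alpha _)) -powRrM mulrNz.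
  have NE : ((n + j%:Z)%:~R = n%:~R + j%:R :> R)%R by rewrite intrD.
  transitivity (4 * (alpha `^ (- (n%:~R + j%:R)) *
      alpha `^ ((n%:~R + j%:R) * (1 - delta))))%R; first by rewrite NE; ring.
  rewrite -powR_add// -mulrA -powR_add//; congr (4 * alpha `^ _)%R; ring.
have Qe : (Q `^ p^-1) = (fine (Q `^ p^-1))%:E.
  by rewrite fineK// fin_num_poweR// ge0_fin_numE// ltey.
rewrite Qe; under eq_eseriesr do rewrite -EFinM EFinM.
rewrite nneseriesZl; last by move=> j _; rewrite lee_fin exprn_ge0// powR_ge0.
rewrite nneseries_geometric ?powR_ge0//.
rewrite -!EFinM lee_fin le_eqVlt; apply/orP; left; apply/eqP; field.
by rewrite gt_eqF// subr_gt0.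
Qed.

End Series.

(** * Oscillation of [f] bounded by the energies of nearby edges *)

Section Oscillation.
Context {R : realType} {alpha tau : R} {Z : completeMetricType R}.
Context {S : filling alpha tau Z} (X : completion S).
Hypothesis alpha_gt1 : 1 < alpha.
Hypothesis tau_gt3 : 3 < tau.
Variables (g : X -> \bar R) (p : R).
Hypothesis g_ge0 : forall x, (0 <= g x)%E.
Hypothesis mg : measurable_fun [set: borel_completion X] (g : borel_completion X -> \bar R).
Hypothesis p_ge1 : 1 <= p.

Let alpha_gt0 : 0 < alpha. Proof. exact: lt_trans alpha_gt1. Qed.
Let gt0 (n : int) : 0 < alpha ^ n. Proof. exact: scale_gt0. Qed.
Let p_gt0 : 0 < p. Proof. exact: lt_le_trans p_ge1. Qed.
Notation lam := (@lebesgue_measure R).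
Local Open Scope ereal_scope.

Definition edge_energy (v w : Z * int) : \bar R :=
  \int[lam]_(t in `[0%R, 1%R]) (g (emb X (edge S v w t))) `^ p.

Definition vertex_energy (v : Z * int) : \bar R :=
  \esum_(w in Defs.adjacent S v) edge_energy v w.

Definition net_ball (k : int) (u : Z) : set Z := ball u (2 * alpha ^ (- k))%R.

(** The net balls have the radius allowed in [is_ray], so this dominates the energy of the edge from
    level [k] to level [k + 1] of every ray to [x], whichever vertices the ray uses. *)
Definition level_energy (k : int) (x : Z) : \bar R :=
  \esum_(u in net S k) (vertex_energy (u, k) * (\1_(net_ball k u) x)%:E).

Lemma edge_energy_ge0 v w : 0 <= edge_energy v w.
Proof. by apply: integral_ge0 => t _; exact: poweR_ge0. Qed.

Lemma vertex_energy_ge0 v : 0 <= vertex_energy v.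
Proof. by apply: esum_ge0 => w _; exact: edge_energy_ge0. Qed.

Lemma level_energy_ge0 k x : 0 <= level_energy k x.
Proof.
by apply: esum_ge0 => u _; rewrite mule_ge0 ?vertex_energy_ge0// lee_fin.
Qed.

Definition tail_energy (delta : R) (n : int) (x : Z) : \bar R :=
  \sum_(j <oo) (alpha `^ (- (n + j%:Z)%:~R * ((1 - delta) * p)))%:E *
    level_energy (n + j%:Z) x.

Lemma tail_energy_ge0 delta n x : 0 <= tail_energy delta n x.
Proof.
apply: nneseries_ge0 => j _ _.
by rewrite mule_ge0 ?level_energy_ge0// lee_fin powR_ge0.
Qed.

Lemma measurable_edge v w : Defs.adjacent S v w ->
  measurable_fun `[(0 : R)%R, (1 : R)%R] (fun t => g (emb X (edge S v w t))).
Proof.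
move=> vw; have [M M0 dM] := dist_rho_edge vw.
apply: (measurableT_comp mg).
apply: (lipschitz_on_borel _ _ _ M) => // s t.
rewrite !in_itv/= => /andP[s0 s1] /andP[t0 t1]; rewrite emb_isometry.
have [st|/ltW ts] := leP s t.
  by rewrite ler0_norm ?subr_le0// opprB dM.
have [_ sym _] := graph_dist_pseudodist S alpha_gt1 tau_gt3.
by rewrite -(emb_isometry X) metric_sym emb_isometry ger0_norm ?subr_ge0// dM.
Qed.

Lemma ray_edge_le z u k : @is_ray R alpha tau Z S z u ->
  \int[lam]_(t in `[0%R, 1%R]) g (ray_edge X u k t) <=
  2%:E * (level_energy k z) `^ p^-1.
Proof.
move=> ru; have vw := ray_adjacent alpha_gt1 tau_gt3 z u u k ru ru.
apply: (le_trans (integral01_le_Lp _ p p_ge1 _ _)).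
- by move=> t; exact: g_ge0.
- exact: measurable_edge vw.
apply: lee_wpmul2l; first by rewrite lee_fin.
apply: lee_poweR; first by rewrite invr_ge0 ltW.
  exact: edge_energy_ge0.
have [Su uz] := ru k.
apply: (@le_trans _ _ (vertex_energy (u k, k))).
  apply: esum_ge; exists [set (u (k + 1)%R, (k + 1)%R)].
    by split; [exact: finite_set1|move=> _ ->].
  by rewrite fsbig_set1.
apply: esum_ge; exists [set u k]; first by split; [exact: finite_set1|move=> _ ->].
rewrite fsbig_set1 indicE mem_set ?mule1//.
by rewrite /net_ball ballEmdist.
Qed.

(** Both rays use anchors, except that the ray to [y] passes through the anchor of [x] at level
    [n]. *)
Lemma pair_rays x y n : (mdist x y < alpha ^ (- n))%R -> exists u w,
  [/\ @is_ray R alpha tau Z S x u, @is_ray R alpha tau Z S y w & u n = w n].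
Proof.
move=> xy; exists (fun k => anchor S k x).
exists (fun k => if k == n then anchor S n x else anchor S k y).
split; [exact: anchor_ray| |by rewrite eqxx].
move=> k; case: eqP => [->|_]; last exact: anchor_ray.
have [Su ux] := anchorP S alpha_gt1 n x; split => //.
apply: (le_lt_trans (metric_triangle _ x _)).
by rewrite mulrDl mul1r ltrD.
Qed.

Lemma boundary_dist_le x y n : (mdist x y < alpha ^ (- n))%R ->
  (boundary_dist X x y <= 2 * @tail R alpha n)%R.
Proof.
move=> /pair_rays[u [w [ru rw uw]]]; rewrite /boundary_dist.
apply: (le_trans (metric_triangle _ (emb X (vertex S (u n, n))) _)).
have := boundary_ray_le X alpha_gt1 tau_gt3 x u n ru.
have := boundary_ray_le X alpha_gt1 tau_gt3 y w n rw.
rewrite -uw (metric_sym (emb X _) (boundary_point X y)); lra.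
Qed.

Definition osc_const (delta : R) : R := (4 / (1 - alpha `^ (- delta)))%R.

Lemma osc_const_gt0 delta : (0 < delta)%R -> (0 < osc_const delta)%R.
Proof.
move=> d0; rewrite divr_gt0// subr_gt0 /powR gt_eqF// -expR0 ltr_expR.
by rewrite mulNr oppr_lt0 mulr_gt0// ln_gt0.
Qed.

(** The case [x = y] is included and useful: if [f x] is infinite, the left side is [+oo], and so
    the tail energy at [x] must be infinite. *)
Lemma oscillation_le (f : Z -> \bar R) (G : set Z) x y n delta :
  (forall x y, G x -> G y -> forall (gamma : R -> X) (a b : R),
    rectifiable_curve mdist gamma a b ->
    (exists2 t, t \in `[a, b] & gamma t <> gamma a) ->
    gamma a = boundary_point X x -> gamma b = boundary_point X y ->
    `|f x - f y| <= curve_integral mdist g gamma a b) ->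
  G x -> G y -> (mdist x y < alpha ^ (- n))%R -> (0 < delta)%R ->
  `|f x - f y| `^ p <=
  ((osc_const delta) `^ p * alpha `^ (- n%:~R * (delta * p)))%:E *
  (tail_energy delta n x + tail_energy delta n y).
Proof.
move=> ug Gx Gy xy d0; have [u [w [ru rw uw]]] := pair_rays _ _ _ xy.
have [gamma [b [rect nc g0 gb ci]]] :=
  rays_curve X alpha_gt1 tau_gt3 g x y u w n g_ge0 mg ru rw uw.
have := le_trans (ug _ _ Gx Gy gamma 0%R b rect nc g0 gb) ci.
have I0 v k : 0 <= \int[lam]_(t in `[0%R, 1%R]) g (ray_edge X v k t).
  by apply: integral_ge0.
have H := ray_series_le alpha p delta n
  (fun j => \int[lam]_(t in `[0%R, 1%R]) g (ray_edge X u (n + j%:Z) t))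
  (fun j => \int[lam]_(t in `[0%R, 1%R]) g (ray_edge X w (n + j%:Z) t))
  (fun j => level_energy (n + j%:Z) x) (fun j => level_energy (n + j%:Z) y)
  alpha_gt1 p_gt0 d0.
move=> /le_trans/(_ (H _ _ _ _)) {}H.
have {}H : `|f x - f y| <= (osc_const delta * alpha `^ (- n%:~R * delta))%:E *
    (tail_energy delta n x + tail_energy delta n y) `^ p^-1.
  apply: le_trans (H _ _ _ _) _ => {H}.
  - by move=> j; exact: level_energy_ge0.
  - by move=> j; exact: level_energy_ge0.
  - by move=> j; rewrite I0 ray_edge_le.
  - by move=> j; rewrite I0 ray_edge_le.
  rewrite /tail_energy -nneseriesD; last 2 first.
  - by move=> j _ _; rewrite mule_ge0 ?level_energy_ge0// lee_fin powR_ge0.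
  - by move=> j _ _; rewrite mule_ge0 ?level_energy_ge0// lee_fin powR_ge0.
  rewrite le_eqVlt; apply/orP; left; apply/eqP; congr (_ * _ `^ _).
  apply: eq_eseriesr => j _.
  by rewrite ge0_muleDr ?level_energy_ge0.
have T0 : 0 <= tail_energy delta n x + tail_energy delta n y.
  by rewrite adde_ge0// tail_energy_ge0.
have c0 := osc_const_gt0 _ d0.
apply: le_trans (lee_poweR _ _ p _ _ H) _ => //; first exact: ltW.
rewrite poweRM ?poweR_ge0//; last by rewrite lee_fin mulr_ge0 ?powR_ge0// ltW.
rewrite poweRK// poweR_EFin powRM ?powR_ge0 ?(ltW c0)//.
by rewrite -powRrM mulrA.
Qed.

End Oscillation.

Lemma esumZl {R : realType} {T : choiceType} (D : set T) (a : T -> \bar R) (c : R) :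
  (0 <= c)%R -> (forall i, D i -> 0 <= a i)%E ->
  (\esum_(i in D) (c%:E * a i) = c%:E * \esum_(i in D) a i)%E.
Proof.
move=> c0 a0.
have le (b : T -> \bar R) (r : R) : (0 <= r)%R -> (forall i, D i -> 0 <= b i)%E ->
    (\esum_(i in D) (r%:E * b i) <= r%:E * \esum_(i in D) b i)%E.
  move=> r0 b0; apply: ge_ereal_sup => _ [E [finE ED] <-].
  rewrite (eq_fsbigr (fun i => r%:E * (if i \in D then b i else 0))%E); last first.
    by move=> i /set_mem /ED /mem_set ->.
  rewrite -ge0_mule_fsumr; last first.
    by move=> i; case: ifPn => // /set_mem; exact: b0.
  rewrite lee_wpmul2l ?lee_fin//; apply: ereal_sup_ubound; exists E => //.
  by apply: eq_fsbigr => i /set_mem /ED /mem_set ->.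
move: c0; rewrite le_eqVlt => /predU1P[<-|c0].
  by rewrite mul0e esum1// => i _; rewrite mul0e.
(* The converse inequality is [le] again, with the inverse factor. *)
apply/eqP; rewrite eq_le le ?(ltW c0)//= -lee_pdivlMl//.
apply: (@le_trans _ _ (\esum_(i in D) (c^-1%:E * (c%:E * a i)))%E).
  by apply: le_esum => i _; rewrite muleA -EFinM mulVf ?gt_eqF// mul1e.
apply: le; first by rewrite invr_ge0 ltW.
by move=> i Di; rewrite mule_ge0 ?a0// lee_fin ltW.
Qed.

(** * The energies of the edges against the energy of [g] *)

Section Energy.
Context {R : realType} {alpha tau : R} {Z : completeMetricType R}.
Context {S : filling alpha tau Z} (X : completion S).
Hypothesis alpha_gt1 : 1 < alpha.
Hypothesis tau_gt3 : 3 < tau.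
Variable nu : {outer_measure set Z -> \bar R}.
Hypothesis nu_ball : forall (z : Z) (r : R), (0 < r)%R -> (0 < nu (ball z r) < +oo)%E.
Variables (g : X -> \bar R) (p beta : R).
Hypothesis g_ge0 : forall x, (0 <= g x)%E.
Hypothesis mg : measurable_fun [set: borel_completion X] (g : borel_completion X -> \bar R).
Hypothesis beta_gt0 : 0 < beta.

Let alpha_gt0 : 0 < alpha. Proof. exact: lt_trans alpha_gt1. Qed.
Let gt0 (n : int) : 0 < alpha ^ n. Proof. exact: scale_gt0. Qed.
Notation lam := (@lebesgue_measure R).
Local Open Scope ereal_scope.
Notation graphm := (@graph_measure R alpha tau Z S nu).

Let edges : set ((Z * int) * (Z * int)) := is_vertex S `*`` Defs.adjacent S.

Let vball_fin v : nu (vertex_ball (alpha := alpha) (tau := tau) v) \is a fin_num.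
Proof.
have : (0 < tau * alpha ^ (- v.2))%R by apply: mulr_gt0; [exact: lt_trans tau_gt3|exact: gt0].
by move=> /(nu_ball v.1) /andP[h0 h1]; rewrite ge0_fin_numE// ltW.
Qed.

Notation c e := (fine (nu (vertex_ball (alpha := alpha) (tau := tau) e.1))).

Lemma edge_measurable v w : Defs.adjacent S v w ->
  measurable_fun `[(0 : R)%R, (1 : R)%R] (edge S v w).
Proof. by move=> vw _ B mB; exact: mB v w vw. Qed.

(** Only the ball of the first endpoint is kept in the weight of an edge. Finite lists suffice,
    because an [esum] is a supremum over finite sets. *)
Lemma finite_edges_le_graph_measure (s : seq ((Z * int) * (Z * int))) (A : set (graph S)) :
  uniq s -> (forall e, e \in s -> edges e) -> measurable A ->
  \sum_(e <- s) (c e)%:E * lam (`[0%R, 1%R] `&` edge S e.1 e.2 @^-1` A) <=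
  graphm A.
Proof.
move=> us sE mA; rewrite /graph_measure esum_esum; last first.
  by move=> v w _ _; rewrite mule_ge0// adde_ge0// outer_measure_ge0.
apply: esum_ge; exists [set` s]; first by split; [exact: finite_seq|move=> e /= /sE].
rewrite -(fsbig_seq _ _ us) big_seq [leRHS]big_seq; apply: lee_sum => e es.
by rewrite fineK// lee_wpmul2r// leeDl// outer_measure_ge0.
Qed.

Lemma height_edge_le v w t : Defs.adjacent S v w -> t \in `[0%R, 1%R] ->
  (height (edge S v w t) <= (v.2 + 1)%:~R)%R.
Proof.
move=> vw t01; rewrite heightE// intrD mulr1z.
have := adjacent_level S v w vw; rewrite ler_norml => /andP[h1 h2].
move: t01; rewrite in_itv/= => /andP[t0 t1].
set a : R := v.2%:~R in h1 h2 *; set b : R := w.2%:~R in h1 h2 *.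
by nra.
Qed.

(** A lower bound for the density [alpha ^ (- beta h)] on all edges at [v], whose heights are at
    most [v.2 + 1]. *)
Let w0 (v : Z * int) : R := (alpha `^ (- beta * (v.2 + 1)%:~R))%R.

Lemma finite_edges_le_completion_measure (s : seq ((Z * int) * (Z * int)))
    (A : set (borel_completion X)) :
  uniq s -> (forall e, e \in s -> edges e) -> measurable A ->
  \sum_(e <- s) (c e * w0 e.1)%:E *
     lam (`[0%R, 1%R] `&` (emb X \o edge S e.1 e.2) @^-1` A) <=
  completion_measure X nu beta A.
Proof.
move=> us sE mA; pose A' := emb X @^-1` A.
have mA' : measurable (A' : set (graph S)).
  by have := @emb_measurable _ _ _ _ _ X measurableT A mA; rewrite setTI.
pose F := (fun x : graph S => (alpha `^ (- beta * height x))%:E) \_ A'.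
have F0 x : 0 <= F x by rewrite /F/patch; case: ifP => // _; rewrite lee_fin powR_ge0.
have mF : measurable_fun setT F.
  apply: (measurable_restrictT _ mA').1; apply: measurable_funTS.
  apply/measurable_EFinP; apply: (@measurableT_comp _ _ _ _ _ _ (powR alpha)).
    exact: measurable_powRr.
  apply: measurable_funM => //; exact: graph_measurable_height.
have sup := @le_integral_superposition _ _ _ _ _ _ R lam graphm _ s
  (fun e => c e) 1%R `[0%R, 1%R] setT (fun e t => edge S e.1 e.2 t) (fun x => x) F.
have {}sup : \sum_(e <- s) (c e)%:E * \int[lam]_(t in `[0%R, 1%R]) F (edge S e.1 e.2 t) <=
    1%:E * \int[graphm]_x F x.
  apply: sup => //.
  - by move=> e es; rewrite fine_ge0// outer_measure_ge0.
  - by move=> e /sE [_ /= vw]; exact: edge_measurable.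
  - by move=> B mB; rewrite mul1e setTI; exact: finite_edges_le_graph_measure.
rewrite /completion_measure /weighted_measure integral_mkcond -[leRHS]mul1e.
apply: le_trans sup; rewrite big_seq [leRHS]big_seq; apply: lee_sum => e es.
have [_ /= vw] := sE e es.
rewrite EFinM -muleA lee_wpmul2l ?lee_fin ?fine_ge0 ?outer_measure_ge0//.
set B := `[0%R, 1%R] `&` _.
have mB : measurable B by exact: (edge_measurable _ _ vw (measurable_itv _) _ mA').
rewrite -integral_cst// /B integral_mkcondr.
apply: ge0_le_integral_nomeas => t t01.
  by rewrite /patch; case: ifP => // _; rewrite lee_fin powR_ge0.
rewrite /F /patch.
have -> : (t \in (emb X \o edge S e.1 e.2) @^-1` A) = (edge S e.1 e.2 t \in A').
  by apply/idP/idP => /set_mem H; exact/mem_set.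
case: ifP => // _; rewrite lee_fin /w0 ler_powR ?(ltW alpha_gt1)//.
by rewrite !mulNr lerN2 ler_wpM2l ?(ltW beta_gt0)// height_edge_le.
Qed.

Lemma energy_le :
  \esum_(v in is_vertex S) ((fine (nu (vertex_ball (alpha := alpha) (tau := tau) v)) * w0 v)%:E *
    vertex_energy X g p v) <=
  \int[completion_measure X nu beta]_x (g x) `^ p.
Proof.
rewrite (eq_esum (b := fun v => \esum_(w in Defs.adjacent S v)
   ((fine (nu (vertex_ball (alpha := alpha) (tau := tau) v)) * w0 v)%:E *
     edge_energy X g p v w))); last first.
  move=> v _; rewrite esumZl// => [|w _]; last exact: edge_energy_ge0.
  by rewrite mulr_ge0 ?powR_ge0// fine_ge0// outer_measure_ge0.
rewrite esum_esum; last first.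
  move=> v w _ _; rewrite mule_ge0 ?edge_energy_ge0// lee_fin mulr_ge0 ?powR_ge0//.
  by rewrite fine_ge0// outer_measure_ge0.
apply: ge_ereal_sup => _ [E [finE EE] <-].
have [s us Es] : exists2 s : seq ((Z * int) * (Z * int)), uniq s & E = [set` s].
  have [s ->] := (finite_seqP E).1 finE.
  exists (undup s); first exact: undup_uniq.
  by apply/seteqP; split => e /=; rewrite mem_undup.
rewrite Es -(fsbig_seq _ _ us) -[leRHS]mul1e.
have := @le_integral_superposition _ _ _ (borel_completion X) _ _ R lam (completion_measure X nu beta) _ s
  (fun e => c e * w0 e.1)%R 1%R `[0%R, 1%R] setT
  (fun e t => emb X (edge S e.1 e.2 t)) (fun x => x) (fun x => g x `^ p).
have sE e : e \in s -> edges e by move=> es; apply: EE; rewrite Es.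
apply => //.
- by move=> e es; rewrite mulr_ge0 ?powR_ge0// fine_ge0// outer_measure_ge0.
- move=> e /sE [_ /= vw]; exact: (measurableT_comp (@emb_measurable _ _ _ _ _ X) (edge_measurable _ _ vw)).
- by move=> x; exact: poweR_ge0.
- exact: (measurableT_comp (measurable_poweR _)).
- by move=> A mA; rewrite mul1e setTI; exact: finite_edges_le_completion_measure.
Qed.

End Energy.

(** * Doubling *)

Section CountableSums.
Local Open Scope ereal_scope.

(** For [f] injective on a countable [D] the fibers have at most one element. This turns an [esum]
    into a series, to which measurability and monotone convergence of series apply. *)
Lemma esum_fibers {R : realType} {T : choiceType} (D : set T) (f : T -> nat)
    (a : T -> \bar R) : (forall i, 0 <= a i) ->
  \esum_(i in D) a i = \sum_(n <oo) \esum_(i in D `&` f @^-1` [set n]) a i.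
Proof.
move=> a0; rewrite -nneseries_sum_bigcup//.
  by congr (esum _ _); apply/seteqP; split => [i Di|i [n _ []]//]; exists (f i).
apply/trivIsetP => m n _ _ mn; apply/seteqP; split => // i [[_ /= im] [_ /= iN]].
by move: mn; rewrite -im -iN eqxx.
Qed.

Lemma fiber_dichotomy {T : choiceType} (D : set T) (f : T -> nat) (n : nat) :
  {in D &, injective f} ->
  D `&` f @^-1` [set n] = set0 \/ exists i, D `&` f @^-1` [set n] = [set i].
Proof.
move=> injf; have [->|/set0P[i [Di fi]]] := eqVneq (D `&` f @^-1` [set n]) set0.
  by left.
right; exists i; apply/seteqP; split => [j [Dj fj]|j ->]//=.
by apply: injf; rewrite ?inE//; rewrite fi fj.
Qed.

Lemma measurable_esum {d} {U : measurableType d} {R : realType} {T : choiceType}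
    (D : set T) (F : T -> U -> \bar R) : countable D ->
  (forall i x, 0 <= F i x) -> (forall i, D i -> measurable_fun setT (F i)) ->
  measurable_fun setT (fun x => \esum_(i in D) F i x).
Proof.
move=> /countable_injP[f injf] F0 mF.
rewrite (_ : (fun x => _) = fun x =>
    \sum_(n <oo) \esum_(i in D `&` f @^-1` [set n]) F i x); last first.
  by apply/funext => x; exact: esum_fibers.
apply: ge0_emeasurable_sum => [n x _ _|n _]; first exact: esum_ge0.
have [->|[i E]] := fiber_dichotomy D f n injf.
  by under eq_fun do rewrite esum_set0; exact: measurable_cst.
rewrite E; under eq_fun do rewrite esum_set1//.
by apply: mF; have [] : (D `&` f @^-1` [set n]) i by rewrite E.
Qed.

Lemma integral_esum {d} {U : measurableType d} {R : realType} {T : choiceType}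
    (m : {measure set U -> \bar R}) (D : set T) (F : T -> U -> \bar R) :
  countable D -> (forall i x, 0 <= F i x) ->
  (forall i, D i -> measurable_fun setT (F i)) ->
  \int[m]_x (\esum_(i in D) F i x) = \esum_(i in D) \int[m]_x F i x.
Proof.
move=> /countable_injP[f injf] F0 mF.
have mn n : measurable_fun setT (fun x => \esum_(i in D `&` f @^-1` [set n]) F i x).
  have [->|[i E]] := fiber_dichotomy D f n injf.
    by under eq_fun do rewrite esum_set0; exact: measurable_cst.
  rewrite E; under eq_fun do rewrite esum_set1//.
  by apply: mF; have [] : (D `&` f @^-1` [set n]) i by rewrite E.
under eq_integral do rewrite (esum_fibers D f)//.
rewrite integral_nneseries//; last by move=> n x _; exact: esum_ge0.
rewrite [RHS](esum_fibers D f); last by move=> i; exact: integral_ge0.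
apply: eq_eseriesr => n _.
have [->|[i E]] := fiber_dichotomy D f n injf.
  by rewrite esum_set0; under eq_integral do rewrite esum_set0; rewrite integral0.
rewrite E esum_set1; last exact: integral_ge0.
by under eq_integral do rewrite esum_set1//.
Qed.

Lemma esum1_finite {R : realType} {T : choiceType} (D : set T) (M : R) :
  \esum_(i in D) (1 : \bar R) <= M%:E -> finite_set D.
Proof.
move=> DM; apply: contrapT => /infinite_set_fset H.
have [B BD Bn] := H (Num.truncn M).+1.
pose s : seq T := finmap.enum_fset B.
have us : uniq s by exact: finmap.fset_uniq.
have : ((size s)%:R)%:E <= M%:E.
  apply: le_trans DM; apply: esum_ge; exists [set` s].
    by split; [exact: finite_seq|move=> x /= xs; exact: BD].
  by rewrite -(fsbig_seq _ _ us) -sum1_size natr_sum -sumEFin.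
rewrite lee_fin; apply/negP; rewrite -ltNge.
by apply: (lt_le_trans (truncnS_gt M)); rewrite ler_nat.
Qed.

End CountableSums.

Section Doubling.
Context {R : realType} {alpha tau : R} {Z : completeMetricType R}.
Context (S : filling alpha tau Z).
Hypothesis alpha_gt1 : 1 < alpha.
Variable nu : {outer_measure set Z -> \bar R}.
Hypothesis nuP : metric_measure_space nu.
Variable C : R.
Hypothesis C1 : 1 <= C.
Hypothesis nuC : doubling nu C.

Let alpha_gt0 : 0 < alpha. Proof. exact: lt_trans alpha_gt1. Qed.
Let gt0 (n : int) : 0 < alpha ^ n. Proof. exact: scale_gt0. Qed.
Local Notation nuZ := (nu : set (caratheodory_type nu) -> \bar R).
Local Open Scope ereal_scope.

Lemma nu_ball_gt0 z r : (0 < r)%R -> 0 < nu (ball z r).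
Proof. by move=> r0; have [_ /(_ z r r0)/andP[]] := nuP. Qed.

Lemma nu_ball_fin z r : (0 < r)%R -> nu (ball z r) \is a fin_num.
Proof.
move=> r0; have [_ /(_ z r r0)/andP[h0 h1]] := nuP.
by rewrite ge0_fin_numE// ltW.
Qed.

Lemma open_ball z r : open (ball z r : set Z).
Proof.
rewrite openE => y; rewrite ballEmdist /= => zy; rewrite /interior -nbhs_ballE.
exists (r - mdist z y)%R; first by rewrite /= subr_gt0.
move=> x; rewrite !ballEmdist /= => yx.
by apply: (le_lt_trans (metric_triangle _ y _)); rewrite -ltrBrDl.
Qed.

Lemma measurable_ballZ z r : measurable (ball z r : set (caratheodory_type nu)).
Proof. by have [[H _] _] := nuP; apply: H; apply: sub_gen_smallest; exact: open_ball. Qed.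

Lemma doubling_iter z r k : (0 < r)%R ->
  nu (ball z (2 ^+ k * r)) <= (C ^+ k)%:E * nu (ball z r).
Proof.
move=> r0; elim: k => [|k IH]; first by rewrite !expr0 mul1r mul1e.
rewrite exprS -mulrA; apply: (le_trans (nuC _ _ _)).
  by rewrite mulr_gt0// exprn_gt0.
by rewrite exprS EFinM -muleA lee_wpmul2l// lee_fin (le_trans _ C1).
Qed.

Lemma nu_ball_subset z z' r r' k : (0 < r)%R -> (mdist z z' + r' <= 2 ^+ k * r)%R ->
  nu (ball z' r') <= (C ^+ k)%:E * nu (ball z r).
Proof.
move=> r0 h; apply: le_trans (doubling_iter _ _ k r0).
apply: le_outer_measure => x; rewrite !ballEmdist /= => z'x.
apply: (le_lt_trans (metric_triangle _ z' _)); apply: lt_le_trans h.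
by rewrite ltrD2l.
Qed.

(** A packing argument: with [r = alpha ^ (- n)], the balls of radius [r / 2] about the net points
    are disjoint and lie in the ball of radius [2 ^+ i.+1 * r] about [x], which [i + 3] doublings of
    each of them cover. *)
Lemma net_count n i x :
  \esum_(u in net S n `&` [set u | mdist u x < 2 ^+ i * alpha ^ (- n)]%R) (1 : \bar R)
    <= (C ^+ (i + 3))%:E.
Proof.
set r := (alpha ^ (- n))%R; have r0 : (0 < r)%R by exact: gt0.
have i1 : (1 <= 2 ^+ i :> R)%R by rewrite exprn_ege1// ler1n.
set M := nu (ball x (2 ^+ i.+1 * r)).
have ir0 : (0 < 2 ^+ i.+1 * r)%R by rewrite mulr_gt0// exprn_gt0.
have M0 : 0 < M by exact: nu_ball_gt0.
have Mf : M \is a fin_num by exact: nu_ball_fin.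
apply: ge_ereal_sup => _ [F [finF FD] <-].
have C0 : (0 < C ^+ (i + 3))%R by rewrite exprn_gt0// (lt_le_trans _ C1).
have key : \sum_(u \in F) M <= (C ^+ (i + 3))%:E * M.
  apply: (@le_trans _ _ (\sum_(u \in F) ((C ^+ (i + 3))%:E * nu (ball u (r / 2))))).
    apply: lee_fsum => // u Fu; have [Su ux] := FD u Fu.
    apply: nu_ball_subset; first by rewrite divr_gt0.
    have -> : (2 ^+ (i + 3) * (r / 2) = 4 * 2 ^+ i * r)%R.
      by rewrite exprD; field.
    by rewrite exprS; move: ux; rewrite /=; nra.
  rewrite -ge0_mule_fsumr; last by move=> u; exact: outer_measure_ge0.
  rewrite lee_wpmul2l ?lee_fin ?(ltW C0)//.
  have -> : \sum_(u \in F) nu (ball u (r / 2)) =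
      nuZ (\bigcup_(u in F) (ball u (r / 2))).
    apply/esym; apply: measure_fin_bigcup => //; last first.
      by move=> u _; exact: measurable_ballZ.
    apply/trivIsetP => u v Fu Fv uv; apply/seteqP; split => // y [].
    rewrite !ballEmdist /= => uy vy.
    have [Su _] := FD u Fu; have [Sv _] := FD v Fv.
    have [sep _] := net_maximal S n.
    have := sep u v Su Sv (elimN eqP uv).
    have := metric_triangle u y v; rewrite (metric_sym y v) -/r; lra.
  apply: le_outer_measure => y [u Fu]; rewrite !ballEmdist /= => uy.
  have [_ /= ux] := FD u Fu.
  apply: (le_lt_trans (metric_triangle _ u _)); rewrite (metric_sym x).
  by rewrite exprS; nra.
have : M * \sum_(u \in F) (1 : \bar R) <= M * (C ^+ (i + 3))%:E.
  rewrite ge0_mule_fsumr//; rewrite [leRHS]muleC; apply: le_trans key.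
  by rewrite le_eqVlt; apply/orP; left; apply/eqP; apply: eq_fsbigr => u _; rewrite mule1.
by rewrite lee_pmul2l.
Qed.

Lemma net_countable n : countable (net S n).
Proof.
pose x0 : Z := point.
have -> : net S n = \bigcup_i (net S n `&` [set u | mdist u x0 < 2 ^+ i * alpha ^ (- n)]%R).
  apply/seteqP; split => [u Su|u [i _ []]//].
  have [i h] : exists i : nat, (mdist u x0 / alpha ^ (- n) < 2 ^+ i)%R.
    exists (Num.truncn (mdist u x0 / alpha ^ (- n))).+1.
    apply: (lt_le_trans (truncnS_gt _)).
    by rewrite -natrX ler_nat ltnW// ltn_expl.
  by exists i => //; split => //=; rewrite -ltr_pdivrMr.
apply: bigcup_countable => // i _; apply: finite_set_countable.
exact: esum1_finite (net_count n i x0).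
Qed.

Lemma net_overlap n x :
  \esum_(u in net S n) (\1_(net_ball (alpha := alpha) n u) x)%:E <= (C ^+ 4)%:E.
Proof.
apply: le_trans (net_count n 1 x); rewrite esum_mkcondr.
apply: le_esum => u _; rewrite indicE /net_ball ballEmdist /= expr1.
case: ifPn => [_|/negP H]; first by rewrite lee_fin lern1 leq_b1.
by rewrite memNset// => ux; apply: H; exact/mem_set.
Qed.

End Doubling.

(** * The Besov energy *)

Section KernelIntegral.
Local Open Scope ereal_scope.
Context {d} {U : measurableType d} {R : realType} (m : {measure set U -> \bar R}).

Lemma ge0_integralZlT (k : \bar R) (f : U -> \bar R) : 0 <= k ->
  (forall x, 0 <= f x) -> measurable_fun setT f ->
  \int[m]_x (k * f x) = k * \int[m]_x f x.
Proof. by move=> k0 f0 mf; rewrite ge0_integralZl. Qed.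

Lemma ge0_integralDT (f1 f2 : U -> \bar R) :
  (forall x, 0 <= f1 x) -> (forall x, 0 <= f2 x) ->
  measurable_fun setT f1 -> measurable_fun setT f2 ->
  \int[m]_x (f1 x + f2 x) = \int[m]_x f1 x + \int[m]_x f2 x.
Proof. by move=> f10 f20 mf1 mf2; rewrite ge0_integralD. Qed.

Lemma measurable_indicE (B : set U) : measurable B ->
  measurable_fun setT (fun x => (\1_B x : R)%:E).
Proof. by move=> mB; apply/measurable_EFinP; exact: measurable_indic. Qed.

Lemma integral_indic_mul (B : set U) (c : \bar R) : measurable B -> 0 <= c ->
  \int[m]_x ((\1_B x)%:E * c) = c * m B.
Proof.
move=> mB c0; under eq_integral do rewrite muleC.
rewrite ge0_integralZlT//; last exact: measurable_indicE.
by rewrite integral_indic// setIT.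
Qed.

(** For each [i], one of the two integrations of each summand [T i x] and [T i y] only produces
    [m (B i)], which cancels the normalization. The two summands contribute equally, hence the
    factor 2. *)
Lemma kernel_integral {I : choiceType} (D : set I) (B : I -> set U)
    (T : I -> U -> \bar R) (c : I -> R) :
  countable D -> (forall i, measurable (B i)) ->
  (forall i, 0 < m (B i) < +oo) -> (forall i, 0 <= c i)%R ->
  (forall i x, 0 <= T i x) -> (forall i, measurable_fun setT (T i)) ->
  let W y := \int[m]_x (\esum_(i in D) ((c i / fine (m (B i)))%:E *
     ((\1_(B i) x)%:E * ((\1_(B i) y)%:E * (T i x + T i y))))) in
  measurable_fun setT W /\
  \int[m]_y W y =
  \esum_(i in D) ((2 * c i)%:E * \int[m]_x ((\1_(B i) x)%:E * T i x)).
Proof.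
move=> cD mB B0 c0 T0 mT W.
pose A i := \int[m]_x ((\1_(B i) x)%:E * T i x).
have i0 i x : 0 <= (\1_(B i) x)%:E :> \bar R by rewrite lee_fin.
have b0 i : (0 < fine (m (B i)))%R by rewrite fine_gt0.
have bE i : m (B i) = (fine (m (B i)))%:E.
  by rewrite fineK// ge0_fin_numE//; have /andP[] := B0 i.
have cb i : (0 <= c i / fine (m (B i)))%R by rewrite divr_ge0// ltW.
have mI i : measurable_fun setT (fun x => (\1_(B i) x : R)%:E).
  exact: measurable_indicE.
have mIT i : measurable_fun setT (fun x => (\1_(B i) x)%:E * T i x).
  exact: emeasurable_funM.
have A0 i : 0 <= A i by apply: integral_ge0 => x _; rewrite mule_ge0.
have mTy i y : measurable_fun setT (fun x => T i x + T i y).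
  by apply: emeasurable_funD.
have inner y i : D i -> \int[m]_x ((c i / fine (m (B i)))%:E *
     ((\1_(B i) x)%:E * ((\1_(B i) y)%:E * (T i x + T i y)))) =
   (c i / fine (m (B i)))%:E * ((\1_(B i) y)%:E * A i +
      (\1_(B i) y)%:E * T i y * (fine (m (B i)))%:E).
  move=> Di; rewrite ge0_integralZlT ?lee_fin//; last 2 first.
  - by move=> x; rewrite !mule_ge0// adde_ge0.
  - by apply: emeasurable_funM => //; exact: measurable_funeM.
  congr (_ * _).
  under eq_integral do rewrite muleCA ge0_muleDr//.
  rewrite ge0_integralZlT//; last 2 first.
  - by move=> x; rewrite adde_ge0// mule_ge0.
  - by apply: emeasurable_funD => //; exact: emeasurable_funM.
  rewrite ge0_integralDT//; last 3 first.
  - by move=> x; rewrite mule_ge0.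
  - by move=> x; rewrite mule_ge0.
  - exact: emeasurable_funM.
  rewrite ge0_muleDr; last 2 first.
  - by apply: integral_ge0 => x _; rewrite mule_ge0.
  - by apply: integral_ge0 => x _; rewrite mule_ge0.
  by rewrite integral_indic_mul// -bE muleA.
have WE : W = fun y => \esum_(i in D) ((c i / fine (m (B i)))%:E *
    ((\1_(B i) y)%:E * A i + (\1_(B i) y)%:E * T i y * (fine (m (B i)))%:E)).
  apply/funext => y; rewrite /W integral_esum//; last 2 first.
  - by move=> i x; rewrite !mule_ge0 ?lee_fin// adde_ge0.
  - move=> i Di; apply: measurable_funeM.
    by apply: emeasurable_funM => //; exact: measurable_funeM.
  by apply: eq_esum => i Di; exact: inner.
have G0 i y : 0 <= (\1_(B i) y)%:E * A i +
    (\1_(B i) y)%:E * T i y * (fine (m (B i)))%:E.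
  by rewrite adde_ge0 ?mule_ge0// lee_fin ltW.
have mIA i : measurable_fun setT (fun y => (\1_(B i) y)%:E * A i).
  exact: emeasurable_funM.
have mITb i : measurable_fun setT (fun y => (\1_(B i) y)%:E * T i y * (fine (m (B i)))%:E).
  exact: emeasurable_funM.
have mG i : measurable_fun setT (fun y => (\1_(B i) y)%:E * A i +
    (\1_(B i) y)%:E * T i y * (fine (m (B i)))%:E).
  exact: emeasurable_funD.
rewrite WE; split.
  apply: measurable_esum => // [i y|i _]; first by rewrite mule_ge0 ?lee_fin.
  exact: measurable_funeM.
rewrite integral_esum//; last 2 first.
- by move=> i y; rewrite mule_ge0 ?lee_fin.
- by move=> i Di; exact: measurable_funeM.
apply: eq_esum => i Di.
rewrite ge0_integralZlT ?lee_fin//.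
rewrite ge0_integralDT//; last 2 first.
- by move=> y; rewrite mule_ge0.
- by move=> y; rewrite !mule_ge0// lee_fin ltW.
rewrite integral_indic_mul//.
under [X in _ * (_ + X)]eq_integral do rewrite muleC.
rewrite ge0_integralZlT ?lee_fin ?(ltW (b0 _))//; last by move=> y; rewrite mule_ge0.
rewrite -/(A i) [X in A i * X]bE [A i * _]muleC -ge0_muleDl ?lee_fin ?(ltW (b0 _))//.
rewrite muleA -EFinD -EFinM; congr (_%:E * _).
by field; rewrite gt_eqF.
Qed.

End KernelIntegral.

(** * Sums of energies over all levels *)

Section EnergySums.
Context {R : realType} {alpha tau : R} {Z : completeMetricType R}.
Context {S : filling alpha tau Z} (X : completion S).
Hypothesis alpha_gt1 : 1 < alpha.
Hypothesis tau_gt3 : 3 < tau.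
Variable nu : {outer_measure set Z -> \bar R}.
Hypothesis nuP : metric_measure_space nu.
Variable C : R.
Hypothesis C1 : 1 <= C.
Hypothesis nuC : doubling nu C.
Variables (g : X -> \bar R) (p beta : R).
Hypothesis g_ge0 : forall x, (0 <= g x)%E.
Hypothesis mg : measurable_fun [set: borel_completion X] (g : borel_completion X -> \bar R).
Hypothesis beta_gt0 : 0 < beta.

Let alpha_gt0 : 0 < alpha. Proof. exact: lt_trans alpha_gt1. Qed.
Let gt0 (n : int) : 0 < alpha ^ n. Proof. exact: scale_gt0. Qed.
Local Notation nuZ := (nu : set (caratheodory_type nu) -> \bar R).
Local Open Scope ereal_scope.

Lemma esum_swap {I J : choiceType} (A : set I) (B : set J) (a : I -> J -> \bar R) :
  (forall i j, 0 <= a i j) ->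
  \esum_(i in A) \esum_(j in B) a i j = \esum_(j in B) \esum_(i in A) a i j.
Proof.
move=> a0; rewrite !esum_esum//.
rewrite (@reindex_esum _ _ _ (B `*`` fun=> A) _ (fun q => (q.2, q.1)))//.
split=> [[j i] /= []//| |[i j] /= [Ai Bj]]; last by exists (j, i).
by move=> [j i] [j' i'] _ _ /= [-> ->].
Qed.

Lemma measurable_net_ball k u :
  measurable (net_ball (alpha := alpha) k u : set (caratheodory_type nu)).
Proof. exact: measurable_ballZ. Qed.

Lemma net_ball_bounds k u : 0 < nu (net_ball (alpha := alpha) k u) < +oo.
Proof. by have [_ h] := nuP; apply: h; rewrite mulr_gt0. Qed.

Definition level_mass (k : int) : \bar R :=
  \esum_(u in net S k) (vertex_energy X g p (u, k) * nu (net_ball (alpha := alpha) k u)).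

Lemma level_mass_ge0 k : 0 <= level_mass k.
Proof.
apply: esum_ge0 => u _; rewrite mule_ge0 ?outer_measure_ge0//.
exact: vertex_energy_ge0.
Qed.

Let mterm k u : measurable_fun setT (fun x : caratheodory_type nu =>
  vertex_energy X g p (u, k) * (\1_(net_ball (alpha := alpha) k u) x)%:E).
Proof.
by apply: measurable_funeM; apply: measurable_indicE; exact: measurable_net_ball.
Qed.

Let term_ge0 k u (x : caratheodory_type nu) :
  0 <= vertex_energy X g p (u, k) * (\1_(net_ball (alpha := alpha) k u) x)%:E.
Proof. by rewrite mule_ge0 ?vertex_energy_ge0// lee_fin. Qed.

Let netc k : countable (net S k).
Proof. exact: (net_countable S alpha_gt1 nu nuP C C1 nuC). Qed.

Lemma measurable_level_energy k :
  measurable_fun setT (level_energy X g p k : caratheodory_type nu -> \bar R).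
Proof. by apply: measurable_esum. Qed.

Lemma integral_level_energy k :
  \int[nuZ]_x level_energy X g p k x = level_mass k.
Proof.
rewrite /level_energy integral_esum//; apply: eq_esum => u _.
under eq_integral do rewrite muleC.
rewrite integral_indic_mul ?vertex_energy_ge0//.
exact: measurable_net_ball.
Qed.

Lemma measurable_tail_energy delta n :
  measurable_fun setT (tail_energy X g p delta n : caratheodory_type nu -> \bar R).
Proof.
apply: ge0_emeasurable_sum => [j x _ _|j _].
  by rewrite mule_ge0 ?level_energy_ge0// lee_fin powR_ge0.
by apply: measurable_funeM; exact: measurable_level_energy.
Qed.

Lemma integral_tail_energy delta n :
  \int[nuZ]_x tail_energy X g p delta n x =
  \sum_(j <oo) (alpha `^ (- (n + j%:Z)%:~R * ((1 - delta) * p)))%:E *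
    level_mass (n + j%:Z).
Proof.
rewrite /tail_energy integral_nneseries//; last 2 first.
- by move=> j; apply: measurable_funeM; exact: measurable_level_energy.
- by move=> j x _; rewrite mule_ge0 ?level_energy_ge0// lee_fin powR_ge0.
apply: eq_eseriesr => j _; rewrite ge0_integralZlT ?lee_fin ?powR_ge0//.
- by rewrite integral_level_energy.
- by move=> x; exact: level_energy_ge0.
- exact: measurable_level_energy.
Qed.

(** The vertices are grouped by level in [energy_le], and net balls lie in vertex balls because
    [2 < tau]. The factor [alpha ^ beta] makes up for the height [k + 1] in the weights there. *)
Lemma sum_level_mass_le :
  \esum_(k in [set: int]) ((alpha `^ (- beta * k%:~R))%:E * level_mass k) <=
  (alpha `^ beta)%:E * \int[completion_measure X nu beta]_x (g x) `^ p.
Proof.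
have E := energy_le X alpha_gt1 tau_gt3 nu _ g p beta mg beta_gt0.
apply: le_trans (lee_wpmul2l _ (E _)); [|by rewrite lee_fin powR_ge0|by case: nuP].
have h0 v : 0 <= (fine (nu (vertex_ball (alpha := alpha) (tau := tau) v)) *
    alpha `^ (- beta * (v.2 + 1)%:~R))%:E * vertex_energy X g p v.
  rewrite mule_ge0 ?vertex_energy_ge0// lee_fin mulr_ge0 ?powR_ge0//.
  by rewrite fine_ge0// outer_measure_ge0.
rewrite -esumZl ?powR_ge0//.
rewrite (@reindex_esum _ _ _ ([set: int] `*`` net S) _ (fun q => (q.2, q.1)))//; last first.
  split=> [[k u] /= []//| |[u k] /= Su]; last by exists (k, u).
  by move=> [j i] [j' i'] _ _ /= [-> ->].
rewrite -(esum_esum (a := fun k u => (alpha `^ beta)%:E *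
  ((fine (nu (vertex_ball (alpha := alpha) (tau := tau) (u, k))) *
    alpha `^ (- beta * (k + 1)%:~R))%:E * vertex_energy X g p (u, k)))); last first.
  by move=> k u _ _; rewrite mule_ge0 ?lee_fin ?powR_ge0//; exact: (h0 (u, k)).
apply: le_esum => k _; rewrite /level_mass -esumZl ?powR_ge0//; last first.
  by move=> u _; rewrite mule_ge0 ?outer_measure_ge0 ?vertex_energy_ge0.
apply: le_esum => u _.
rewrite muleCA [leRHS]muleA [leRHS]muleC.
apply: lee_wpmul2l; first exact: vertex_energy_ge0.
have vb : 0 < nu (vertex_ball (alpha := alpha) (tau := tau) (u, k)) < +oo.
  have [_ h] := nuP; apply: h; rewrite mulr_gt0//.
  exact: lt_trans tau_gt3.
have le_net : nu (net_ball (alpha := alpha) k u) <=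
    (fine (nu (vertex_ball (alpha := alpha) (tau := tau) (u, k))))%:E.
  rewrite fineK; last first.
    by have /andP[v0 v1] := vb; rewrite ge0_fin_numE// ltW.
  apply: le_outer_measure => x; rewrite /net_ball /vertex_ball !ballEmdist /=.
  move=> /lt_le_trans; apply; rewrite ler_wpM2r ?(ltW (gt0 _))//.
  by apply/ltW; apply: lt_trans tau_gt3; rewrite ltr_nat.
apply: (le_trans (lee_wpmul2l _ le_net)); first by rewrite lee_fin powR_ge0.
rewrite -!EFinM lee_fin mulrCA le_eqVlt; apply/orP; left; apply/eqP.
rewrite mulrC; congr (_ * _)%R; rewrite -powR_add//; congr (_ `^ _)%R.
by rewrite intrD mulr1z; ring.
Qed.

(* The exponents combine to [- j * (p * (theta - delta)) - beta * (n + j)],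
   because [p * (1 - theta) = beta]. *)
Lemma sum_tail_energy_le (delta theta : R) :
  (0 < p)%R -> theta = (1 - beta / p)%R -> (delta < theta)%R ->
  \esum_(n in [set: int]) ((alpha `^ (n%:~R * (p * (theta - delta))))%:E *
     \int[nuZ]_x tail_energy X g p delta n x) <=
  (alpha `^ beta / (1 - alpha `^ (- (p * (theta - delta)))))%:E *
  \int[completion_measure X nu beta]_x (g x) `^ p.
Proof.
move=> p0 thetaE dt; set q := (p * (theta - delta))%R.
have q0 : (0 < q)%R by rewrite mulr_gt0// subr_gt0.
have q1 : (alpha `^ (- q) < 1)%R.
  rewrite /powR gt_eqF// -expR0 ltr_expR mulNr oppr_lt0 mulr_gt0//.
  by rewrite ln_gt0.
set E := \int[_]_x _.
have step n : (alpha `^ (n%:~R * q))%:E * \int[nuZ]_x tail_energy X g p delta n x =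
    \esum_(j in [set: nat]) ((alpha `^ (- q) ^+ j)%:E *
      ((alpha `^ (- beta * (n + j%:Z)%:~R))%:E * level_mass (n + j%:Z))).
  rewrite integral_tail_energy -nneseries_esumT; last first.
    move=> j; rewrite !mule_ge0 ?level_mass_ge0// lee_fin ?powR_ge0//.
    by rewrite exprn_ge0// powR_ge0.
  rewrite -nneseriesZl; last first.
    by move=> j _; rewrite mule_ge0 ?level_mass_ge0// lee_fin powR_ge0.
  apply: eq_eseriesr => j _; rewrite !muleA -!EFinM; congr (_%:E * _).
  rewrite -powR_mulrn ?powR_ge0// -powRrM -!powR_add//; congr (_ `^ _)%R.
  by rewrite /q thetaE intrD; field; rewrite gt_eqF.
under eq_esum do rewrite step.
rewrite esum_swap; last first.
  move=> n j; rewrite !mule_ge0 ?level_mass_ge0// lee_fin ?powR_ge0//.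
  by rewrite exprn_ge0// powR_ge0.
have F0 k : 0 <= (alpha `^ (- beta * k%:~R))%:E * level_mass k.
  by rewrite mule_ge0 ?level_mass_ge0// lee_fin powR_ge0.
have E0 : 0 <= E by apply: integral_ge0 => x _; exact: poweR_ge0.
apply: (@le_trans _ _ (\esum_(j in [set: nat]) ((alpha `^ (- q) ^+ j)%:E *
    ((alpha `^ beta)%:E * E)))).
  apply: le_esum => j _; rewrite esumZl; last 2 first.
  - by rewrite exprn_ge0// powR_ge0.
  - by move=> n _; exact: F0.
  apply: lee_wpmul2l; first by rewrite lee_fin exprn_ge0// powR_ge0.
  apply: le_trans sum_level_mass_le.
  rewrite [leRHS](@reindex_esum _ _ _ [set: int] _ (fun n => n + j%:Z)%R)//.
  split => //; first by move=> m n _ _ /addIr.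
  by move=> m _; exists (m - j%:Z)%R => //; rewrite subrK.
have [Eoo|Efin] := eqVneq E +oo.
  rewrite [in leRHS]Eoo gt0_muley ?leey// lte_fin divr_gt0 ?powR_gt0//.
  by rewrite subr_gt0.
have -> : E = (fine E)%:E by rewrite fineK// ge0_fin_numE// ltey.
rewrite -nneseries_esumT; last first.
  move=> j; rewrite !mule_ge0 ?lee_fin ?exprn_ge0 ?powR_ge0//.
  by rewrite fine_ge0.
rewrite -[(alpha `^ beta)%:E * _]EFinM; under eq_eseriesr do rewrite muleC.
rewrite nneseriesZl; last by move=> j _; rewrite lee_fin exprn_ge0// powR_ge0.
rewrite nneseries_geometric ?powR_ge0// -!EFinM lee_fin.
by rewrite le_eqVlt; apply/orP; left; apply/eqP; ring.
Qed.

Lemma integral_overlap_le (T : Z -> \bar R) n : (forall x, 0 <= T x) ->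
  measurable_fun setT (T : caratheodory_type nu -> \bar R) ->
  \esum_(u in net S n) \int[nuZ]_x ((\1_(net_ball (alpha := alpha) n u) x)%:E * T x) <=
  (C ^+ 4)%:E * \int[nuZ]_x T x.
Proof.
move=> T0 mT; have C0 : (0 < C ^+ 4)%R by rewrite exprn_gt0// (lt_le_trans _ C1).
rewrite -integral_esum//; last 2 first.
- by move=> u x; rewrite mule_ge0// lee_fin.
- move=> u _; apply: emeasurable_funM => //; apply: measurable_indicE.
  exact: measurable_net_ball.
rewrite -ge0_integralZlT ?lee_fin ?(ltW C0)//.
apply: ge0_le_integral_nomeas => x _.
  by apply: esum_ge0 => u _; rewrite mule_ge0// lee_fin.
have := net_overlap S alpha_gt1 nu nuP C C1 nuC n x.
(* An infinite [T x] is treated apart, since [esumZl] extracts real factors only. *)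
case: (T x) (T0 x) => [t|_ _|//]; last first.
  by rewrite gt0_muley ?lte_fin// leey.
rewrite lee_fin => t0 h; under eq_esum do rewrite muleC.
rewrite esumZl//.
by rewrite [leRHS]muleC; apply: lee_wpmul2l h; rewrite lee_fin.
Qed.

End EnergySums.

Lemma esum_ge1 {R : realType} {I : choiceType} (D : set I) (a : I -> \bar R) i :
  D i -> (a i <= \esum_(j in D) a j)%E.
Proof.
move=> Di; apply: esum_ge; exists [set i]; last by rewrite fsbig_set1.
by split; [exact: finite_set1|move=> _ ->].
Qed.

(** [tail_level], rescaled, gives [alpha ^ (- (k + 1)) < r <= alpha ^ (- k)]. Making the upper bound
    strict costs one more level, hence [n = k - 1] and the gap of 2. *)
Lemma scale_between {R : realType} (alpha r : R) : 1 < alpha -> 0 < r ->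
  exists n, alpha ^ (- (n + 2)) < r /\ r < alpha ^ (- n).
Proof.
move=> a1 r0; have kp : 0 < alpha / (alpha - 1).
  by rewrite divr_gt0 ?subr_gt0// (lt_trans _ a1).
have := tail_level a1 (r * (alpha / (alpha - 1))); rewrite mulr_gt0//.
move=> /(_ isT)[k]; rewrite /tail ltr_pM2r// ler_pM2r// => /andP[k1 k2].
exists (k - 1); split; first by have -> : k - 1 + 2 = k + 1 by ring.
by apply: (le_lt_trans k2); apply: scale_lt => //; rewrite ltrN2 gtrBl.
Qed.

(** * Pointwise bound of the Besov integrand by a kernel over the net balls *)

Section BesovKernel.
Context {R : realType} {alpha tau : R} {Z : completeMetricType R}.
Context {S : filling alpha tau Z} (X : completion S).
Hypothesis alpha_gt1 : 1 < alpha.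
Hypothesis tau_gt3 : 3 < tau.
Variable nu : {outer_measure set Z -> \bar R}.
Hypothesis nuP : metric_measure_space nu.
Variable C : R.
Hypothesis C1 : 1 <= C.
Hypothesis nuC : doubling nu C.
Variables (g : X -> \bar R) (p theta delta : R).
Hypothesis g_ge0 : forall x, (0 <= g x)%E.
Hypothesis mg : measurable_fun [set: borel_completion X] (g : borel_completion X -> \bar R).
Hypothesis p_ge1 : 1 <= p.
Hypothesis theta_gt0 : 0 < theta.
Hypothesis delta_gt0 : 0 < delta.

Let alpha_gt0 : 0 < alpha. Proof. exact: lt_trans alpha_gt1. Qed.
Let p_gt0 : 0 < p. Proof. exact: lt_le_trans p_ge1. Qed.
Let tau_gt0 : 0 < tau. Proof. exact: lt_trans tau_gt3. Qed.
Let gt0 (n : int) : 0 < alpha ^ n. Proof. exact: scale_gt0. Qed.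

Notation bd := (boundary_dist X).
Let K := tau * (1 + alpha) * alpha ^+ 3.
Let K_gt0 : 0 < K.
Proof. by rewrite mulr_gt0 ?exprn_gt0// mulr_gt0// addr_gt0. Qed.

(* [i0] and [N] only depend on [alpha] and [tau]: [i0] makes a ball of [d] of
   radius [alpha ^ (- n - 2 - i0)] lie in the ball of [d_rho] at stake, and [N]
   is the number of doublings from there to radius [3 * alpha ^ (- n)]. *)
Variables i0 N : nat.
Hypothesis i0P : 2 * (alpha / (alpha - 1)) * K <= alpha ^ i0%:Z.
Hypothesis NP : 3 * alpha ^ (2 + i0%:Z) <= 2 ^+ N.

Lemma boundary_dist_gt (x y : Z) n : alpha ^ (- (n + 2)) < mdist x y ->
  alpha ^ (- (n + 2)) / K < bd x y.
Proof.
move=> xy; rewrite ltr_pdivrMr//; apply: (lt_le_trans xy).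
by rewrite mulrC; exact: boundary_dist_ge.
Qed.

Lemma nu_boundary_ball (x y u : Z) n : alpha ^ (- (n + 2)) < mdist x y ->
  mdist u x < alpha ^ (- n) ->
  (nu (net_ball (alpha := alpha) n u) <=
   (C ^+ N)%:E * nu [set z | (bd x z < bd x y)%R])%E.
Proof.
move=> xy ux; set k := n + 2 + i0%:Z.
have sub : ball x (alpha ^ (- k)) `<=` [set z | (bd x z < bd x y)%R].
  move=> z; rewrite ballEmdist /= => xz.
  apply: le_lt_trans (boundary_dist_gt _ _ _ xy).
  apply: (le_trans (boundary_dist_le X alpha_gt1 tau_gt3 _ _ _ xz)).
  rewrite ler_pdivlMr// /tail.
  have -> : alpha ^ (- k) = alpha ^ (- (n + 2)) * alpha ^ (- i0%:Z).
    by rewrite /k opprD scaleD.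
  have a0 := gt0 (- (n + 2)).
  have aK : alpha ^ (- i0%:Z) * (2 * (alpha / (alpha - 1)) * K) <= 1.
    apply: (le_trans (ler_wpM2l (ltW (gt0 _)) i0P)).
    by rewrite -scaleD// addNr expr0z.
  by have := ler_wpM2l (ltW a0) aK; lra.
apply: (@le_trans _ _ ((C ^+ N)%:E * nu (ball x (alpha ^ (- k))))%E); last first.
  apply: lee_wpmul2l; first by rewrite lee_fin exprn_ge0// (le_trans _ C1).
  exact: le_outer_measure.
apply: (nu_ball_subset nu C C1 nuC); first exact: gt0.
have -> : alpha ^ (- k) = alpha ^ (- n) / alpha ^ (2 + i0%:Z).
  rewrite invr_expz -scaleD// /k; congr (_ ^ _).
  by rewrite -addrA opprD.
have a0 := gt0 (- n); rewrite metric_sym.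
(* One [alpha ^ (- n)] for the distance of the centres and two for the radius of the net ball. *)
apply: (@le_trans _ _ (3 * alpha ^ (- n))); first by lra.
by rewrite mulrA ler_pdivlMr// mulrAC mulrC [leRHS]mulrC ler_wpM2l// ltW.
Qed.

Variables (f : Z -> \bar R) (G : set Z).
Local Open Scope ereal_scope.
Hypothesis ug : forall x y, G x -> G y -> forall (gamma : R -> X) (a b : R),
  rectifiable_curve mdist gamma a b ->
  (exists2 t, t \in `[a, b] & gamma t <> gamma a) ->
  gamma a = boundary_point X x -> gamma b = boundary_point X y ->
  `|f x - f y| <= curve_integral mdist g gamma a b.

Let T (i : int * Z) : Z -> \bar R := tail_energy X g p delta i.1.
Let B (i : int * Z) : set Z := net_ball (alpha := alpha) i.1 i.2.

(** The factors come, in order, from the oscillation, from the comparison of volumes and from the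
    lower bound for [bd x y] in the denominator. *)
Definition kernel_const : R :=
  ((osc_const (alpha := alpha) delta) `^ p * C ^+ N * (K * alpha ^ 2) `^ (p * theta))%R.

Let c (i : int * Z) : R :=
  (kernel_const * alpha `^ (i.1%:~R * (p * (theta - delta))))%R.

Definition besov_integrand (x y : Z) : \bar R :=
  `|f x - f y| `^ p / ((bd x y) `^ (p * theta))%:E /
    nu [set z | (bd x z < bd x y)%R].

(** For a given pair of distinct points one index [(n, u)] already suffices. Summing over all of
    them frees the bound of the choice of [n] and [u]. *)
Definition besov_kernel (x y : Z) : \bar R :=
  \esum_(i in [set: int] `*`` net S) ((c i / fine (nu (B i)))%:E *
     ((\1_(B i) x)%:E * ((\1_(B i) y)%:E * (T i x + T i y)))).

Lemma besov_integrand_ge0 x y : 0 <= besov_integrand x y.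
Proof.
by rewrite /besov_integrand !mule_ge0 ?poweR_ge0 ?inve_ge0 ?lee_fin ?powR_ge0
  ?outer_measure_ge0.
Qed.

Let osc_gt0 : (0 < osc_const (alpha := alpha) delta)%R.
Proof. exact: osc_const_gt0. Qed.

Lemma kernel_const_gt0 : (0 < kernel_const)%R.
Proof.
have C0 : (0 < C)%R by exact: lt_le_trans C1.
by rewrite !mulr_gt0// ?powR_gt0// ?exprn_gt0// mulr_gt0.
Qed.

Let nuB_gt0 i : (0 < fine (nu (B i)))%R.
Proof. by rewrite fine_gt0//; exact: net_ball_bounds. Qed.

Let nuBE i : (fine (nu (B i)))%:E = nu (B i).
Proof.
have /andP[h0 h1] := net_ball_bounds alpha_gt1 nu nuP i.1 i.2.
by rewrite fineK// ge0_fin_numE// ltW.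
Qed.

Let T0 i x : 0 <= T i x. Proof. exact: tail_energy_ge0. Qed.

Let c_gt0 i : (0 < c i)%R.
Proof. by rewrite mulr_gt0 ?powR_gt0// kernel_const_gt0. Qed.

Let term_ge0 x y i : 0 <= (c i / fine (nu (B i)))%:E *
     ((\1_(B i) x)%:E * ((\1_(B i) y)%:E * (T i x + T i y))).
Proof.
by rewrite !mule_ge0 ?lee_fin ?divr_ge0 ?adde_ge0// ltW.
Qed.

Let termE x y u n : (mdist u x < 2 * alpha ^ (- n))%R ->
  (mdist u y < 2 * alpha ^ (- n))%R -> net S n u ->
  (c (n, u) / fine (nu (B (n, u))))%:E * (T (n, u) x + T (n, u) y) <=
  besov_kernel x y.
Proof.
move=> ux uy Su; apply: le_trans (esum_ge1 _ _ (n, u) _) => //.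
rewrite !indicE !mem_set ?mul1e//; rewrite /B /net_ball ballEmdist//.
Qed.

Lemma besov_integrand_le x y : G x -> G y ->
  besov_integrand x y <= besov_kernel x y.
Proof.
(* On the diagonal the integrand vanishes if [f x] is finite. Otherwise [oscillation_le] for the
   pair [x], [x] forces infinite tail energy, at level 0 as at any other, and the kernel is
   [+oo]. *)
move=> Gx Gy; have [<-|/eqP xy] := pselect (x = y).
  have [fx|fx] := boolP (f x \is a fin_num).
    rewrite /besov_integrand subee// abse0 poweR0r ?gt_eqF// !mul0e.
    by apply: esum_ge0 => i _; exact: term_ge0.
  have := oscillation_le X alpha_gt1 tau_gt3 g p g_ge0 mg p_ge1 f G x x 0 delta
    ug Gx Gx.
  rewrite mdistxx gt0 => /(_ isT delta_gt0).
  have -> : `|f x - f x| = +oo by case: (f x) fx.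
  rewrite poweRyr ?gt_eqF// leye_eq => /eqP Too.
  have T0oo : T (0%R, x) x + T (0%R, x) x = +oo.
    apply/eqP; apply: contraT => hoo.
    have h : T (0%R, x) x + T (0%R, x) x < +oo by rewrite ltey.
    have : (((osc_const (alpha := alpha) delta `^ p *
      alpha `^ (- 0%:~R * (delta * p)))%:E * (T (0%R, x) x + T (0%R, x) x)) < +oo).
      by apply: lte_mul_pinfty; rewrite ?lee_fin ?mulr_ge0 ?powR_ge0.
    by rewrite Too ltxx.
  have [Su ux] := anchorP S alpha_gt1 0 x.
  have ux2 : (mdist (anchor S 0 x) x < 2 * alpha ^ (- 0))%R.
    by apply: (lt_trans ux); rewrite ltr_pMl ?gt0// ltr1n.
  apply: le_trans (termE x x (anchor S 0 x) 0 ux2 ux2 Su).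
  rewrite [X in _ * X]T0oo gt0_muley ?leey// lte_fin divr_gt0//.
have d0 : (0 < mdist x y)%R by rewrite mdist_gt0.
have [n [xy1 xy2]] := scale_between _ _ alpha_gt1 d0.
have [Su ux] := anchorP S alpha_gt1 n x; set u := anchor S n x in Su ux.
have r0 := gt0 (- n).
have ux2 : (mdist u x < 2 * alpha ^ (- n))%R by lra.
have uy2 : (mdist u y < 2 * alpha ^ (- n))%R.
  by have := metric_triangle u x y; lra.
apply: le_trans (termE x y u n ux2 uy2 Su).
have osc := oscillation_le X alpha_gt1 tau_gt3 g p g_ge0 mg p_ge1 f G x y n delta
    ug Gx Gy xy2 delta_gt0.
have vol := nu_boundary_ball x y u n xy1 ux.
have bdlt := boundary_dist_gt x y n xy1.
have Tx : 0 <= T (n, u) x + T (n, u) y by rewrite adde_ge0.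
set V := nu [set z | (bd x z < bd x y)%R] in vol *.
set b := fine (nu (B (n, u))).
have b0 : (0 < b)%R by exact: nuB_gt0.
have Cn0 : (0 < C ^+ N)%R by rewrite exprn_gt0// (lt_le_trans _ C1).
have Vb : V^-1 <= (C ^+ N / b)%:E.
  move: vol; rewrite -[nu (net_ball _ _)]/(nu (B (n, u))) -nuBE -/b.
  have : 0 <= V by exact: outer_measure_ge0.
  (* An infinite volume has inverse 0; a finite one is positive, being bounded below through
     [vol]. *)
  case: V => [v||//] V0 h; last by rewrite invey lee_fin divr_ge0// ltW.
  rewrite -EFinM lee_fin in h.
  have v0 : (0 < v)%R by rewrite -(pmulr_rgt0 _ Cn0) (lt_le_trans b0).
  by rewrite inver gt_eqF// lee_fin ler_pdivlMr// mulrC ler_pdivrMr.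
set pt := (p * theta)%R; have pt0 : (0 < pt)%R by rewrite mulr_gt0.
have bdp : ((bd x y `^ pt)%:E)^-1 <= ((K * alpha ^ 2) `^ pt * alpha `^ (n%:~R * pt))%:E.
  have e0 : (0 < alpha ^ (- (n + 2)) / K)%R by rewrite divr_gt0.
  have bd0 : (0 < bd x y)%R by exact: lt_trans bdlt.
  have Ka0 : (0 <= K * alpha ^ 2)%R by exact/ltW/(mulr_gt0 K_gt0).
  have an0 : (0 <= alpha ^ n)%R by exact/ltW/gt0.
  rewrite inver gt_eqF ?powR_gt0// lee_fin.
  have -> : ((K * alpha ^ 2) `^ pt * alpha `^ (n%:~R * pt) =
      ((alpha ^ (- (n + 2)) / K) `^ pt)^-1)%R.
    rewrite [(alpha `^ (n%:~R * pt))%R]powRrM powR_int// -powRM//.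
    rewrite -[RHS]powR_inv1 ?powR_ge0// -[RHS]powRrM [X in (_ = _ `^ X)%R]mulrC
      [RHS]powRrM powR_inv1 ?(ltW e0)//.
    congr (_ `^ _)%R; rewrite invf_div -mulrA -scaleD// -invr_expz invrK.
    by congr (_ * _ ^ _)%R; ring.
  rewrite lef_pV2 ?posrE ?powR_gt0//.
  by rewrite ge0_ler_powR ?nnegrE ?(ltW pt0) ?(ltW e0) ?(ltW bd0)// ltW.
rewrite /besov_integrand -/V -/pt.
apply: (@le_trans _ _ (((osc_const (alpha := alpha) delta) `^ p *
    alpha `^ (- n%:~R * (delta * p)))%:E * (T (n, u) x + T (n, u) y) *
   ((K * alpha ^ 2) `^ pt * alpha `^ (n%:~R * pt))%:E * (C ^+ N / b)%:E)).
  apply: lee_pmul => //.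
  - by rewrite mule_ge0 ?poweR_ge0// inve_ge0 lee_fin powR_ge0.
  - by rewrite inve_ge0 outer_measure_ge0.
  - apply: lee_pmul => //; first exact: poweR_ge0.
    by rewrite inve_ge0 lee_fin powR_ge0.
rewrite [X in X * _ * _]muleC -!muleA -!EFinM muleC.
rewrite le_eqVlt; apply/orP; left; apply/eqP; congr (_%:E * _).
rewrite /c /= /kernel_const -/pt.
have -> : (alpha `^ (n%:~R * (p * (theta - delta))) =
    alpha `^ (- n%:~R * (delta * p)) * alpha `^ (n%:~R * pt))%R.
  by rewrite -powR_add//; congr (_ `^ _)%R; rewrite /pt; ring.
by ring.
Qed.

End BesovKernel.

Section NullSets.
Context {R : realType} {Z : completeMetricType R}.
Variable nu : {outer_measure set Z -> \bar R}.
Local Notation nuZ := (nu : set (caratheodory_type nu) -> \bar R).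
Local Open Scope ereal_scope.

Lemma null_caratheodory (A : set Z) : nu A = 0 ->
  measurable (A : set (caratheodory_type nu)).
Proof.
move=> A0; apply: le_caratheodory_measurable => Y.
have -> : nu (Y `&` A) = 0.
  apply/eqP; rewrite eq_le outer_measure_ge0 andbT -A0.
  by apply: le_outer_measure; exact: subIsetr.
by rewrite add0e; apply: le_outer_measure; exact: subIsetl.
Qed.

(** Adding [+oo] times the indicator of [A] to [k] gives a majorant of [h] everywhere without
    changing the integral, so [h] may be nonmeasurable. *)
Lemma integral_le_off_null (A : set Z) (h k : Z -> \bar R) : nu A = 0 ->
  (forall x, 0 <= h x) -> (forall x, 0 <= k x) ->
  measurable_fun setT (k : caratheodory_type nu -> \bar R) ->
  (forall x, ~ A x -> h x <= k x) ->
  \int[nuZ]_x h x <= \int[nuZ]_x k x.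
Proof.
move=> A0 h0 k0 mk hk; have mA := null_caratheodory _ A0.
have mI : measurable_fun setT
    (fun x : caratheodory_type nu => (\1_A x : R)%:E * +oo).
  by apply: emeasurable_funM => //; exact: measurable_indicE.
apply: (@le_trans _ _ (\int[nuZ]_x (k x + (\1_A x)%:E * +oo))).
  apply: ge0_le_integral_nomeas => // x _; rewrite indicE.
  have [xA|xA] := boolP (x \in A).
    by rewrite mul1e addey ?leey// gt_eqF// (lt_le_trans _ (k0 x)).
  by rewrite mul0e adde0; apply: hk => /mem_set; apply/negP.
rewrite ge0_integralDT//.
by rewrite integral_indic_mul ?leey// [X in _ * X]A0 mule0 adde0.
Qed.

End NullSets.

Section PowerInequalities.
Context {R : realType}.
Local Open Scope ereal_scope.

Lemma poweRD_le (a b : \bar R) (p : R) : (0 <= p)%R -> 0 <= a -> 0 <= b ->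
  (a + b) `^ p <= (2 `^ p)%:E * (a `^ p + b `^ p).
Proof.
move=> p0 a0 b0.
have key (x y : \bar R) : 0 <= x -> x <= y ->
    (x + y) `^ p <= (2 `^ p)%:E * (x `^ p + y `^ p).
  move=> x0 xy; have y0 : 0 <= y := le_trans x0 xy.
  apply: (@le_trans _ _ ((2%:E * y) `^ p)).
    apply: lee_poweR => //; first exact: adde_ge0.
    have -> : (2 : R)%:E = 1 + 1 by [].
    by rewrite ge0_muleDl// mul1e leeD2r.
  rewrite poweRM// poweR_EFin lee_wpmul2l ?lee_fin ?powR_ge0//.
  by rewrite leeDr// poweR_ge0.
have [ab|/ltW ba] := leP a b; first exact: key.
by rewrite addeC [X in _ * X]addeC; exact: key.
Qed.

End PowerInequalities.

(** * The Besov bound and local integrability *)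

Section Trace.
Context {R : realType} {alpha tau : R} {Z : completeMetricType R}.
Context {S : filling alpha tau Z} (X : completion S).
Hypothesis alpha_gt1 : 1 < alpha.
Hypothesis tau_gt3 : 3 < tau.
Variable nu : {outer_measure set Z -> \bar R}.
Hypothesis nuP : metric_measure_space nu.
Variable C : R.
Hypothesis C1 : 1 <= C.
Hypothesis nuC : doubling nu C.
Variables (g : X -> \bar R) (p beta theta : R).
Hypothesis g_ge0 : forall x, (0 <= g x)%E.
Hypothesis mg : measurable_fun [set: borel_completion X] (g : borel_completion X -> \bar R).
Hypothesis p_ge1 : 1 <= p.
Hypothesis beta_gt0 : 0 < beta.
Hypothesis beta_ltp : beta < p.
Hypothesis thetaE : theta = 1 - beta / p.
Variables (f : Z -> \bar R) (G : set Z).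
Hypothesis G_full : nu (~` G) = 0%E.
Hypothesis ug : forall x y, G x -> G y -> forall (gamma : R -> X) (a b : R),
  rectifiable_curve mdist gamma a b ->
  (exists2 t, t \in `[a, b] & gamma t <> gamma a) ->
  gamma a = boundary_point X x -> gamma b = boundary_point X y ->
  (`|f x - f y| <= curve_integral mdist g gamma a b)%E.

Let alpha_gt0 : 0 < alpha. Proof. exact: lt_trans alpha_gt1. Qed.
Let p_gt0 : 0 < p. Proof. exact: lt_le_trans p_ge1. Qed.
Let theta_gt0 : 0 < theta.
Proof. by rewrite thetaE subr_gt0 ltr_pdivrMr// mul1r. Qed.
(** Any number strictly between 0 and [theta] would do. *)
Let delta := theta / 2.
Let delta_gt0 : 0 < delta. Proof. by rewrite divr_gt0. Qed.
Let delta_lt : delta < theta.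
Proof. by rewrite ltr_pdivrMr// ltr_pMr// ltr1n. Qed.

Local Notation nuZ := (nu : set (caratheodory_type nu) -> \bar R).
Notation bd := (boundary_dist X).
Local Open Scope ereal_scope.

Notation energy := (\int[completion_measure X nu beta]_x (g x) `^ p).

Definition energy_const : R :=
  (alpha `^ beta / (1 - alpha `^ (- (p * (theta - delta)))))%R.

Lemma besov_integral_le (i0 N : nat) :
  (2 * (alpha / (alpha - 1)) * (tau * (1 + alpha) * alpha ^+ 3) <= alpha ^ i0%:Z)%R ->
  (3 * alpha ^ (2 + i0%:Z) <= 2 ^+ N)%R ->
  \int[nuZ]_y \int[nuZ]_x besov_integrand X nu p theta f x y <=
  (2 * kernel_const (alpha := alpha) (tau := tau) C p theta delta N * C ^+ 4 *
     energy_const)%:E * energy.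
Proof.
move=> i0P NP; set M := kernel_const _ _ _ _ _.
have M0 : (0 < M)%R by apply: kernel_const_gt0.
pose T (i : int * Z) : Z -> \bar R := tail_energy X g p delta i.1.
pose B (i : int * Z) : set Z := net_ball (alpha := alpha) i.1 i.2.
pose c (i : int * Z) : R := (M * alpha `^ (i.1%:~R * (p * (theta - delta))))%R.
have c0 i : (0 <= c i)%R by rewrite mulr_ge0 ?powR_ge0// ltW.
have T0 i x : 0 <= T i x by exact: tail_energy_ge0.
have cD : countable ([set: int] `*`` net S).
  apply: countableXR => // n _.
  exact: (net_countable S alpha_gt1 nu nuP C C1 nuC).
have mT i : measurable_fun setT (T i : caratheodory_type nu -> \bar R).
  exact: (measurable_tail_energy X alpha_gt1 nu nuP C C1 nuC).
have B0 i : 0 < nu (B i) < +oo by exact: net_ball_bounds.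
have mB i : measurable (B i : set (caratheodory_type nu)).
  exact: measurable_net_ball.
have [mW WE] := kernel_integral nuZ ([set: int] `*`` net S) B T c cD mB B0 c0 T0 mT.
have term0 i x y : 0 <= (c i / fine (nu (B i)))%:E *
     ((\1_(B i) x)%:E * ((\1_(B i) y)%:E * (T i x + T i y))).
  by rewrite !mule_ge0 ?lee_fin ?divr_ge0 ?adde_ge0 ?fine_ge0 ?outer_measure_ge0.
apply: (@le_trans _ _ (\int[nuZ]_y \int[nuZ]_x
    besov_kernel X nu C g p theta delta N x y)).
  (* The null set is discarded first for [y], then for [x] with [y] fixed; no product measure is
     involved. *)
  apply: (integral_le_off_null nu _ _ _ G_full) => //.
  - by move=> y; apply: integral_ge0 => x _; exact: besov_integrand_ge0.
  - by move=> y; apply: integral_ge0 => x _; apply: esum_ge0 => i _; exact: term0.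
  move=> y /contrapT Gy; apply: (integral_le_off_null nu _ _ _ G_full) => //.
  - by move=> x; exact: besov_integrand_ge0.
  - by move=> x; apply: esum_ge0 => i _; exact: term0.
  - apply: measurable_esum; [exact: cD|by move=> i x; exact: term0|move=> i _].
    apply: measurable_funeM.
    apply: emeasurable_funM; first exact: (measurable_indicE _ (mB i)).
    apply: measurable_funeM; apply: emeasurable_funD; first exact: mT.
    exact: measurable_cst.
  move=> x /contrapT Gx.
  exact: (besov_integrand_le X alpha_gt1 tau_gt3 nu nuP C C1 nuC g p theta delta
    g_ge0 mg p_ge1 theta_gt0 delta_gt0 i0 N i0P NP f G ug).
rewrite [leLHS]WE.
have AE0 i : 0 <= \int[nuZ]_x ((\1_(B i) x)%:E * T i x).
  by apply: integral_ge0 => x _; rewrite mule_ge0// lee_fin.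
rewrite -(esum_esum (a := fun n u => (2 * c (n, u))%:E *
    \int[nuZ]_x ((\1_(B (n, u)) x)%:E * T (n, u) x))); last first.
  by move=> n u _ _; rewrite mule_ge0// lee_fin mulr_ge0.
apply: (@le_trans _ _ (\esum_(n in [set: int]) ((2 * M * C ^+ 4)%:E *
   ((alpha `^ (n%:~R * (p * (theta - delta))))%:E *
     \int[nuZ]_x tail_energy X g p delta n x)))).
  apply: le_esum => n _.
  (* The coefficient depends on the level only, so [point] can stand for the net point and the
     coefficient leaves the sum over [u]. *)
  rewrite (eq_esum (b := fun u => (2 * c (n, point))%:E *
    \int[nuZ]_x ((\1_(B (n, u)) x)%:E * T (n, u) x)))//.
  rewrite esumZl//; last by rewrite mulr_ge0.
  have c20 : 0 <= (2 * c (n, point))%:E by rewrite lee_fin mulr_ge0.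
  apply: (le_trans (lee_wpmul2l c20 (integral_overlap_le alpha_gt1 nu nuP C C1
    nuC (tail_energy X g p delta n) n (T0 (n, point)) (mT (n, point))))).
  rewrite !muleA -!EFinM le_eqVlt; apply/orP; left; apply/eqP.
  by congr (_%:E * _); rewrite /c /=; ring.
have MC0 : (0 <= 2 * M * C ^+ 4)%R.
  apply: mulr_ge0; first by apply: mulr_ge0 => //; exact: ltW.
  by apply: exprn_ge0; exact: le_trans C1.
rewrite esumZl//; last first.
  move=> n _; rewrite mule_ge0 ?lee_fin ?powR_ge0//.
  by apply: integral_ge0 => x _; exact: (T0 (n, point)).
rewrite [X in _ <= X * _]EFinM -[leRHS]muleA; apply: lee_wpmul2l.
  by rewrite lee_fin.
exact: (sum_tail_energy_le X alpha_gt1 tau_gt3 nu nuP C C1 nuC g p beta).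
Qed.

Hypothesis energy_fin : energy < +oo.

Lemma integral_tail_energy_fin n :
  \int[nuZ]_x tail_energy X g p delta n x < +oo.
Proof.
have q1 : (alpha `^ (- (p * (theta - delta))) < 1)%R.
  rewrite /powR gt_eqF// -expR0 ltr_expR mulNr oppr_lt0 mulr_gt0//.
    by rewrite mulr_gt0// subr_gt0.
  by rewrite ln_gt0.
have ec0 : (0 <= energy_const)%R by rewrite divr_ge0 ?powR_ge0// subr_ge0 ltW.
have := sum_tail_energy_le X alpha_gt1 tau_gt3 nu nuP C C1 nuC g p beta mg beta_gt0
  delta theta p_gt0 thetaE delta_lt.
move=> /(le_trans (esum_ge1 _ _ n I)) h.
have {}h : (alpha `^ (n%:~R * (p * (theta - delta))))%:E *
    \int[nuZ]_x tail_energy X g p delta n x < +oo.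
  apply: (le_lt_trans h); apply: lte_mul_pinfty => //.
move: h; rewrite ltey => /eqP h; rewrite ltey; apply/eqP => E; apply: h.
by rewrite E gt0_muley// lte_fin powR_gt0.
Qed.

(** The ball is enclosed in a metric ball [A] of diameter below [alpha ^ (- n)], with [n] negative
    enough. On [A], [f] is compared by [oscillation_le] with its value at one good point [y0], and
    the tail energy is integrable. *)
Lemma local_integral_fin (z : Z) (r : R) : (0 < r)%R ->
  \int[nuZ]_(x in [set x | (bd z x < r)%R]) `|f x| `^ p < +oo.
Proof.
move=> r0; set K := (tau * (1 + alpha) * alpha ^+ 3)%R.
have K0 : (0 < K)%R.
  rewrite mulr_gt0 ?exprn_gt0// mulr_gt0 ?addr_gt0//.
  exact: lt_trans tau_gt3.
have [m mP] := scale_unbounded alpha_gt1 (2 * (K * r))%R.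
pose n : int := (- m%:Z)%R.
have nE : (- n = m%:Z)%R by rewrite /n opprK.
pose rho := (alpha ^ m%:Z / 2)%R.
have rho0 : (0 < rho)%R by rewrite divr_gt0// scale_gt0.
have rhoE : (alpha ^ m%:Z = 2 * rho)%R by rewrite /rho; field.
set T := tail_energy X g p delta n.
have T0 x : 0 <= T x by exact: tail_energy_ge0.
have mT : measurable_fun setT (T : caratheodory_type nu -> \bar R).
  exact: (measurable_tail_energy X alpha_gt1 nu nuP C C1 nuC).
have Tfin : \int[nuZ]_x T x < +oo by exact: integral_tail_energy_fin.
pose A : set Z := ball z rho.
have mA : measurable (A : set (caratheodory_type nu)) by exact: measurable_ballZ.
have A0 : 0 < nu A by exact: nu_ball_gt0.
have Afin : nu A \is a fin_num by exact: nu_ball_fin.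
have BA : [set x | (bd z x < r)%R] `<=` A.
  move=> x /= zx; rewrite /A ballEmdist /=.
  apply: (le_lt_trans (boundary_dist_ge X alpha_gt1 tau_gt3 z x)); rewrite -/K.
  have := ltr_pM2l K0 (bd z x) r; rewrite zx => /idP h.
  by apply: (lt_trans h); rewrite rhoE in mP; lra.
have AA x y : A x -> A y -> (mdist x y < alpha ^ (- n))%R.
  rewrite /A ballEmdist /= => zx zy; rewrite nE rhoE.
  apply: (le_lt_trans (metric_triangle _ z _)); rewrite (metric_sym x z); lra.
(* Otherwise the tail energy would be infinite almost everywhere on [A], which has positive
   measure. *)
have [y0 [Ay0 Gy0 Ty0]] : exists y0, [/\ A y0, G y0 & T y0 < +oo].
  apply: contrapT => H.
  have : \int[nuZ]_x ((\1_A x)%:E * +oo) <= \int[nuZ]_x T x.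
    apply: (integral_le_off_null nu _ _ _ G_full); [| exact: T0 | exact: mT |].
      by move=> x; rewrite mule_ge0// lee_fin.
    move=> x /contrapT Gx; rewrite indicE.
    have [/set_mem xA|_] := boolP (x \in A); last by rewrite mul0e.
    rewrite mul1e leNgt; apply/negP => Tx; apply: H; exists x; split => //.
  rewrite integral_indic_mul ?leey// gt0_mulye// leye_eq => /eqP E.
  by move: Tfin; rewrite E ltxx.
have c0 : (0 <= (osc_const (alpha := alpha) delta) `^ p *
    alpha `^ (- n%:~R * (delta * p)))%R by rewrite mulr_ge0 ?powR_ge0.
set c := (_ `^ p * _)%R in c0.
have osc x : A x -> G x -> `|f x - f y0| `^ p <= c%:E * (T x + T y0).
  move=> Ax Gx.
  exact: (oscillation_le X alpha_gt1 tau_gt3 g p g_ge0 mg p_ge1 f G x y0 n delta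
    ug Gx Gy0 (AA _ _ Ax Ay0) delta_gt0).
(* The oscillation bound for the pair [y0], [y0] would make [T y0] infinite. *)
have fy0 : f y0 \is a fin_num.
  apply: contrapT => /negP H.
  have E : `|f y0 - f y0| = +oo by case: (f y0) H.
  have := osc y0 Ay0 Gy0; rewrite E poweRyr ?gt_eqF// leye_eq => /eqP Too.
  have : c%:E * (T y0 + T y0) < +oo.
    by apply: lte_mul_pinfty; rewrite ?lee_fin// lte_add_pinfty.
  by rewrite Too ltxx.
have Ty0E : T y0 = (fine (T y0))%:E by rewrite fineK// ge0_fin_numE.
pose k0 := (2 `^ p * (c * fine (T y0) + fine `|f y0| `^ p))%R.
have k00 : (0 <= k0)%R.
  by rewrite mulr_ge0 ?powR_ge0// addr_ge0 ?powR_ge0// mulr_ge0// fine_ge0.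
have pc0 : (0 <= 2 `^ p * c)%R by rewrite mulr_ge0// powR_ge0.
have mI : measurable_fun setT (fun x : caratheodory_type nu => (\1_A x : R)%:E * k0%:E).
  by apply: emeasurable_funM => //; exact: measurable_indicE.
apply: (@le_lt_trans _ _ (\int[nuZ]_x ((2 `^ p * c)%:E * T x + (\1_A x)%:E * k0%:E))).
  rewrite integral_mkcond; apply: (integral_le_off_null nu _ _ _ G_full).
  - by move=> x; rewrite /patch; case: ifP => // _; exact: poweR_ge0.
  - by move=> x; rewrite adde_ge0 ?mule_ge0 ?lee_fin.
  - by apply: emeasurable_funD => //; exact: measurable_funeM.
  move=> x /contrapT Gx; rewrite /patch; case: ifPn => [/set_mem /BA Ax|_]; last first.
    by rewrite adde_ge0 ?mule_ge0 ?lee_fin.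
  rewrite indicE mem_set// mul1e.
  apply: (@le_trans _ _ ((`|f x - f y0| + `|f y0|) `^ p)).
    apply: lee_poweR => //; first exact: ltW.
    case: (f x) => [a||]; case: (f y0) fy0 => // b _.
      by rewrite /= lee_fin -{1}(subrK b a) ler_normD.
  apply: (le_trans (poweRD_le _ _ _ (ltW p_gt0) _ _)) => //.
  apply: (le_trans (lee_wpmul2l _ (leeD (osc x Ax Gx) (lexx _)))).
    by rewrite lee_fin powR_ge0.
  have -> : `|f y0| `^ p = (fine `|f y0| `^ p)%:E.
    by rewrite -poweR_EFin fineK// abse_fin_num.
  rewrite Ty0E [c%:E * (_ + _)]ge0_muleDr ?lee_fin ?fine_ge0// -addeA -EFinM -EFinD.
  rewrite ge0_muleDr; last 2 first.
  - by rewrite mule_ge0// lee_fin.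
  - by rewrite lee_fin addr_ge0 ?powR_ge0// mulr_ge0// fine_ge0.
  by rewrite muleA -!EFinM.
rewrite ge0_integralDT//; last 3 first.
- by move=> x; rewrite mule_ge0 ?lee_fin.
- by move=> x; rewrite mule_ge0 ?lee_fin.
- exact: measurable_funeM.
rewrite ge0_integralZlT ?lee_fin// integral_indic_mul ?lee_fin//.
apply: lte_add_pinfty; apply: lte_mul_pinfty; rewrite ?lee_fin//.
by rewrite ltey_eq Afin.
Qed.

End Trace.

Theorem proposition6p11 (R : realType) (alpha tau Cnu beta p : R)
  (alpha_gt1 : 1 < alpha)
  (tau_gt : Num.max 3 (alpha / (alpha - 1)) < tau)
  (p_ge1 : 1 <= p) (beta_gt0 : 0 < beta) (beta_ltp : beta < p) :
  exists2 C : R, 0 < C &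
    forall (Z : completeMetricType R) (nu : {outer_measure set Z -> \bar R})
      (S : filling alpha tau Z) (X : completion S)
      (f : Z -> \bar R) (g : X -> \bar R),
    metric_measure_space nu -> doubling nu Cnu ->
    measurable_fun [set: caratheodory_type nu] f ->
    hyperbolic_upper_gradient X nu f g ->
    ('N[completion_measure X nu beta]_p%:E[g] < +oo)%E ->
    let theta := 1 - beta / p in
    besov_space nu (boundary_dist X) p theta f /\
    (besov_norm nu (boundary_dist X) p theta f <=
       C%:E * 'N[completion_measure X nu beta]_p%:E[g])%E.
Proof.
have tau_gt3 : 3 < tau by apply: le_lt_trans tau_gt; rewrite le_max lexx.
have p_gt0 : 0 < p := lt_le_trans ltr01 p_ge1.
have alpha_gt0 : 0 < alpha := lt_trans ltr01 alpha_gt1.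
have tau_gt0 : 0 < tau by apply: lt_trans tau_gt3.
pose theta := 1 - beta / p.
have theta_gt0 : 0 < theta by rewrite subr_gt0 ltr_pdivrMr// mul1r.
(* The constant is fixed before the space is given; the maximum provides a doubling constant of at
   least 1, whose powers can be used freely. *)
pose C := Num.max 1 Cnu.
have C1 : 1 <= C by rewrite le_max lexx.
(* [i0] and [N] are chosen from [alpha] and [tau] alone, so the final constant depends on the
   permitted parameters only. *)
have [i0 /ltW i0P] := scale_unbounded alpha_gt1
  (2 * (alpha / (alpha - 1)) * (tau * (1 + alpha) * alpha ^+ 3)).
have [N /ltW NP] := scale_unbounded (ltr1n R 2) (3 * alpha ^ (2 + i0%:Z)).
pose M := 2 * kernel_const (alpha := alpha) (tau := tau) C p theta (theta / 2) N *
  C ^+ 4 * energy_const (alpha := alpha) p beta theta.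
have d_gt0 : 0 < theta / 2 by rewrite divr_gt0.
have M_gt0 : 0 < M.
  have K0 := kernel_const_gt0 alpha_gt1 tau_gt3 C C1 p theta (theta / 2) d_gt0 N.
  have C0 : 0 < C by exact: lt_le_trans C1.
  apply: mulr_gt0; first by apply: mulr_gt0; [exact: mulr_gt0|exact: exprn_gt0].
  rewrite /energy_const divr_gt0 ?powR_gt0// subr_gt0 /powR gt_eqF// -[ltRHS]expR0 ltr_expR.
  rewrite mulNr oppr_lt0; apply: mulr_gt0; last by rewrite ln_gt0.
  by apply: mulr_gt0 => //; lra.
exists (M `^ p^-1); first exact: powR_gt0.
move=> Z nu S X f g nuP nuCnu mf [g_ge0 mg [G G_full ug]] g_fin theta'.
have nuC : doubling nu C.
  move=> z r r0; apply: (le_trans (nuCnu z r r0)).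
  by apply: lee_wpmul2r; [exact: outer_measure_ge0|rewrite lee_fin le_max lexx orbT].
pose E := (\int[completion_measure X nu beta]_x (g x) `^ p)%E.
have NE : ('N[completion_measure X nu beta]_p%:E[g] `^ p = E)%E.
  rewrite powR_Lnorm ?gt_eqF//; apply: eq_integral => x _.
  by rewrite gee0_abs.
have E_fin : (E < +oo)%E by rewrite -NE poweR_lty.
have besov := besov_integral_le X alpha_gt1 tau_gt3 nu nuP C C1 nuC g p beta theta
  g_ge0 mg p_ge1 beta_gt0 beta_ltp erefl f G G_full ug i0 N i0P NP.
have norm_le : (besov_norm nu (boundary_dist X) p theta f <=
    (M `^ p^-1)%:E * 'N[completion_measure X nu beta]_p%:E[g])%E.
  have I0 : (0 <= \int[(nu : set (caratheodory_type nu) -> \bar R)]_y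
      \int[(nu : set (caratheodory_type nu) -> \bar R)]_x
      besov_integrand X nu p theta f x y)%E.
    by apply: integral_ge0 => y _; apply: integral_ge0 => x _; exact: besov_integrand_ge0.
  have pV0 : 0 <= p^-1 by rewrite invr_ge0 ltW.
  apply: (le_trans (lee_poweR _ _ _ pV0 I0 besov)).
  rewrite poweRM ?lee_fin ?(ltW M_gt0)//; last first.
    by apply: integral_ge0 => x _; exact: poweR_ge0.
  rewrite poweR_EFin -/E -NE -poweRrM mulfV ?gt_eqF// poweRe1 ?Lnorm_ge0//.
split => //; split => //.
- move=> z r r0.
  exact: (local_integral_fin X alpha_gt1 tau_gt3 nu nuP C C1 nuC g p beta theta
    g_ge0 mg p_ge1 beta_gt0 beta_ltp erefl f G G_full ug E_fin).
- apply: (le_lt_trans norm_le); apply: lte_mul_pinfty => //.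
  by rewrite lee_fin powR_ge0.
Qed.
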